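(* Let $\psi\in L^1(\mathbb{R}^n)$ satisfy $\int_{\mathbb{R}^n}\psi(x)\,dx=0$, and put $$L(\psi)=\sup_{|\xi|=1}\iint_{\mathbb{R}^n\times\mathbb{R}^n}|\psi(x)\psi(y)|\,\bigl|\log|\langle\xi,x-y\rangle|\bigr|\,dx\,dy .$$ If $L(\psi)<\infty$, then the operator $S_\psi$ is bounded on $L^2(\mathbb{R}^n)$, i.e. there is a constant $C$ such that $\|S_\psi(f)\|_{L^2}\le C\|f\|_{L^2}$ for all $f\in L^2(\mathbb{R}^n)$.
   Context: For $\psi\in L^1(\mathbb{R}^n)$ and $t>0$ put $\psi_t(x)=t^{-n}\psi(t^{-1}x)$ and define the Littlewood-Paley square function $$S_\psi(f)(x)=\left(\int_0^\infty|\psi_t * f(x)|^2\,\frac{dt}{t}\right)^{1/2}.$$ $\langle\cdot,\cdot\rangle$ denotes the inner product of $\mathbb{R}^n$. *)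

(* Defs.v *)
From HB Require Import structures.
From mathcomp Require Import all_boot all_order all_algebra.
From mathcomp Require Import all_classical all_reals all_analysis.
From mathcomp Require Import complex.

Set Implicit Arguments.
Unset Strict Implicit.
Unset Printing Implicit Defensive.

Import Order.TTheory GRing.Theory Num.Theory.
Import numFieldNormedType.Exports.

Local Open Scope classical_set_scope.
Local Open Scope ring_scope.
Local Open Scope complex_scope.

Definition measure_matrix_display : measure_display -> measure_display.
Proof. exact. Qed.

Section measurable_matrix.
Context {d} {T : sigmaRingType d} (m n : nat).

(* For T = R this is the Borel sigma-algebra of R^(m * n). *)
Definition measurable_matrix : set (set 'M[T]_(m, n)) :=
  <<s \bigcup_(ij in [set: 'I_m * 'I_n])
        preimage_set_system setT (fun M : 'M[T]_(m, n) => M ij.1 ij.2)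
          measurable >>.

Let matrix_set0 : measurable_matrix set0.
Proof. exact: sigma_algebra0. Qed.

Let matrix_setC A : measurable_matrix A -> measurable_matrix (~` A).
Proof. exact: sigma_algebraC. Qed.

Let matrix_bigcup (F : _^nat) : (forall i, measurable_matrix (F i)) ->
  measurable_matrix (\bigcup_i (F i)).
Proof. exact: sigma_algebra_bigcup. Qed.

HB.instance Definition _ := @isMeasurable.Build (measure_matrix_display d)
  'M[T]_(m, n) measurable_matrix matrix_set0 matrix_setC matrix_bigcup.

End measurable_matrix.

Lemma measurable_coef d (T : sigmaRingType d) m n (i : 'I_m) (j : 'I_n) :
  measurable_fun [set: 'M[T]_(m, n)] (fun M => M i j).
Proof.
move=> _ Y mY; apply: sub_sigma_algebra; exists (i, j) => //=.
by exists Y.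
Qed.

Lemma measurable_fun_matrixP d d' (T1 : measurableType d)
    (T2 : measurableType d') m n (f : T1 -> 'M[T2]_(m, n)) :
  measurable_fun [set: T1] f <->
  forall i j, measurable_fun [set: T1] (fun x => f x i j).
Proof.
split=> [mf i j|mf].
  exact: (measurableT_comp (@measurable_coef _ T2 m n i j) mf).
apply: (measurability (\bigcup_(ij in [set: 'I_m * 'I_n])
        preimage_set_system setT (fun M : 'M[T2]_(m, n) => M ij.1 ij.2)
          measurable)) => //.
move=> _ [_ [[i j] _ [Y mY <-]] <-].
rewrite setTI -comp_preimage.
exact: mf.
Qed.

Section consmx.
Context {R : realType}.

Definition consmx n (x : R * 'rV[R]_n) : 'rV[R]_n.+1 :=
  \row_j if unlift ord0 j is Some k then x.2 ord0 k else x.1.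

Lemma consmx0 n x : consmx x ord0 (ord0 : 'I_n.+1) = x.1.
Proof. by rewrite mxE unlift_none. Qed.

Lemma consmxS n x (j : 'I_n) : consmx x ord0 (lift ord0 j) = x.2 ord0 j.
Proof. by rewrite mxE liftK. Qed.

Lemma measurable_consmx n : measurable_fun [set: R * 'rV[R]_n] (@consmx n).
Proof.
apply/measurable_fun_matrixP => i j; rewrite (ord1 i).
have [k ->|->] := unliftP ord0 j.
- under eq_fun do rewrite consmxS.
  by apply: (measurableT_comp (measurable_coef _ _)); exact: measurable_snd.
- under eq_fun do rewrite consmx0.
  exact: measurable_fst.
Qed.

Definition unconsmx n (x : 'rV[R]_n.+1) : R * 'rV[R]_n :=
  (x ord0 ord0, \row_j x ord0 (lift ord0 j)).

Lemma consmxK n : cancel (@consmx n) (@unconsmx n).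
Proof.
move=> [a x]; congr pair; first exact: consmx0.
by apply/rowP => j; rewrite mxE consmxS.
Qed.

Lemma unconsmxK n : cancel (@unconsmx n) (@consmx n).
Proof.
move=> x; apply/rowP => j.
by have [k ->|->] := unliftP ord0 j; rewrite ?consmxS ?consmx0 ?mxE.
Qed.

Lemma measurable_unconsmx n :
  measurable_fun [set: 'rV[R]_n.+1] (@unconsmx n).
Proof.
apply/measurable_fun_pairP; split; first exact: measurable_coef.
apply/measurable_fun_matrixP => i j /=.
under eq_fun do rewrite mxE.
exact: measurable_coef.
Qed.

End consmx.

Section lebesgue_rV.
Local Open Scope ereal_scope.
Context {R : realType}.

Section step.
Variables (n : nat) (m : {sigma_finite_measure set 'rV[R]_n -> \bar R}).

Definition lebesgue_rV_step : set 'rV[R]_n.+1 -> \bar R :=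
  pushforward ((@lebesgue_measure R) \x m) (@consmx R n).

Let step0 : lebesgue_rV_step set0 = 0.
Proof. by rewrite /lebesgue_rV_step /pushforward preimage_set0 measure0. Qed.

Let step_ge0 A : 0 <= lebesgue_rV_step A.
Proof. by rewrite /lebesgue_rV_step /pushforward; apply: measure_ge0. Qed.

Let step_sigma_additive : semi_sigma_additive lebesgue_rV_step.
Proof.
move=> F mF tF mUF; rewrite /lebesgue_rV_step /pushforward preimage_bigcup.
have mc := @measurable_consmx R n.
apply: measure_semi_sigma_additive.
- by move=> k; rewrite -[X in measurable X]setTI; exact: mc.
- apply/trivIsetP => /= i j _ _ ij; rewrite -preimage_setI.
  by move/trivIsetP : tF => /(_ _ _ _ _ ij) ->//; rewrite preimage_set0.
- by rewrite -preimage_bigcup -[X in measurable X]setTI; exact: mc.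
Qed.

HB.instance Definition _ := isMeasure.Build _ _ _ lebesgue_rV_step
  step0 step_ge0 step_sigma_additive.

(* Proved by hand: on \x, inference finds the subprobability instance before
   the sigma-finite one. *)
Let step_sigma_finite : sigma_finite setT lebesgue_rV_step.
Proof.
have /sigma_finiteP[F [TF ndF Foo]] := sigma_finiteT (@lebesgue_measure R).
have /sigma_finiteP[G [TG ndG Goo]] := sigma_finiteT m.
exists (fun k => @unconsmx R n @^-1` (F k `*` G k)).
  apply/esym; rewrite -subTset => x _.
  have : setT (@unconsmx R n x).1 by [].
  have : setT (@unconsmx R n x).2 by [].
  rewrite [in X in X -> _]TG [in X in _ -> X -> _]TF.
  move=> [k _ Gk] [l _ Fl]; exists (maxn k l) => //; split.
    by move: Fl; exact/subsetPset/ndF/leq_maxr.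
  by move: Gk; exact/subsetPset/ndG/leq_maxl.
move=> k; have [mF Fk] := Foo k; have [mG Gk] := Goo k; split.
  rewrite -[X in measurable X]setTI.
  by apply: measurable_unconsmx => //; exact: measurableX.
rewrite /lebesgue_rV_step /pushforward -comp_preimage.
rewrite (_ : _ \o _ = id) ?preimage_id.
  by rewrite product_measure1E// lte_mul_pinfty// ge0_fin_numE.
by apply/funext => x /=; rewrite consmxK.
Qed.

HB.instance Definition _ := Measure_isSigmaFinite.Build _ _ _ lebesgue_rV_step
  step_sigma_finite.

End step.

(* Iterated products of the Lebesgue measure of R; see lebesgue_rV_box. *)
Fixpoint lebesgue_rV n : {sigma_finite_measure set 'rV[R]_n -> \bar R} :=
  match n with
  | 0 => \d_(0%R : 'rV[R]_0)
  | n'.+1 => lebesgue_rV_step (lebesgue_rV n')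
  end.

Lemma measurable_box n (A : 'I_n -> set R) : (forall i, measurable (A i)) ->
  measurable [set x : 'rV[R]_n | forall i, A i (x ord0 i)].
Proof.
move=> mA; rewrite [X in measurable X](_ : _ = \bigcap_(i in [set: 'I_n])
    (setT `&` (fun x : 'rV[R]_n => x ord0 i) @^-1` A i)).
  apply: fin_bigcap_measurable => // i _.
  exact: (@measurable_coef _ R 1 n ord0 i measurableT).
apply/seteqP; split => [x /= Ax i _|x /= Ax i].
  by split => //=; exact: Ax.
by have [] := Ax i Logic.I.
Qed.

Lemma lebesgue_rV_box n (A : 'I_n -> set R) :
  (forall i, measurable (A i)) ->
  lebesgue_rV n [set x | forall i, A i (x ord0 i)] =
  \prod_(i < n) lebesgue_measure (A i).
Proof.
elim: n A => [|n IH] A mA /=.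
  by rewrite big_ord0 diracE mem_set//= => -[].
rewrite big_ord_recl -IH//.
have mB : measurable [set x : 'rV[R]_n | forall i, A (lift ord0 i) (x ord0 i)].
  by apply: (@measurable_box n (fun i => A (lift ord0 i))) => i; exact: mA.
rewrite -product_measure1E//; last exact: mA.
rewrite /lebesgue_rV_step /pushforward; congr product_measure1.
apply/seteqP; split => [[a x] /= Aax|[a x] /= [Aa Ax] i].
  split; first by have := Aax ord0; rewrite consmx0.
  by move=> i; have := Aax (lift ord0 i); rewrite consmxS.
by have [k ->|->] := unliftP ord0 i; rewrite ?consmxS ?consmx0.
Qed.

End lebesgue_rV.

Section littlewood_paley.
Context {R : realType}.
Import Normc.

Section complex_valued.
Context {d} {T : measurableType d} (mu : {measure set T -> \bar R}).

Definition Cmeasurable (f : T -> R[i]) :=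
  measurable_fun setT (fun x => complex.Re (f x)) /\
  measurable_fun setT (fun x => complex.Im (f x)).

Definition CLnorm (p : \bar R) (f : T -> R[i]) : \bar R :=
  ('N[mu]_p[EFin \o (@normc R \o f)])%E.

(* Functions, not classes modulo a.e. equality. *)
Definition CLfun (p : \bar R) (f : T -> R[i]) :=
  Cmeasurable f /\ (CLnorm p f < +oo)%E.

(* Rintegral is 0 when the integral is infinite or undefined; so is
   Cintegral, componentwise. *)
Definition Cintegral (f : T -> R[i]) : R[i] :=
  (\int[mu]_x complex.Re (f x)) +i* (\int[mu]_x complex.Im (f x)).

End complex_valued.

Variable n : nat.
Implicit Types (psi f : 'rV[R]_n -> R[i]) (x y xi : 'rV[R]_n) (t : R).

Local Notation mu := (@lebesgue_rV R n).

Definition dotv x y : R := \sum_(i < n) x ord0 i * y ord0 i.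

(* The norm that the library puts on 'rV[R]_n is the sup norm. *)
Definition enorm x : R := Num.sqrt (dotv x x).

Definition dilation psi t : 'rV[R]_n -> R[i] :=
  fun x => (t ^- n)%:C * psi (t^-1 *: x).

Definition convolution psi f : 'rV[R]_n -> R[i] :=
  fun x => Cintegral mu (fun y => psi (x - y) * f y).

Local Open Scope ereal_scope.

Definition square_function psi f : 'rV[R]_n -> \bar R :=
  fun x => (\int[lebesgue_measure]_(t in `]0%R, +oo[)
    (normc (convolution (dilation psi t) f x) ^+ 2 / t)%:E) `^ 2^-1.

(* lne 0 = -oo, so the integrand is +oo where <xi, x - y> = 0 and
   psi(x) psi(y) != 0. *)
Definition log_energy psi : \bar R :=
  ereal_sup [set \int[mu \x mu]_z
      ((normc (psi z.1 * psi z.2))%:E * `| lne `|dotv xi (z.1 - z.2)%R|%:E |)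
    | xi in [set xi | enorm xi = 1%R]].

End littlewood_paley.

(* Main.v *)
Require Import Defs.
From HB Require Import structures.
From mathcomp Require Import all_boot all_order all_algebra.
From mathcomp Require Import all_classical all_reals all_analysis.
From mathcomp Require Import measurable_realfun complex.
From mathcomp Require Import ring lra.

(** On the Fourier side the square function is a multiplier: by Plancherel, the
    square of the L^2 norm of the square function of [f] is, up to a constant, the
    integral over [xi] of [|f^(xi)|^2 m(xi)], where [m(xi)] is the integral of
    [|psi^(t xi)|^2 / t] over [t > 0]. It suffices to bound [m] by [L(psi)].

    For real [psi], the squared modulus [|psi^(t xi)|^2] is the double integral of
    [psi(x) psi(y) cos(t s)] with [s = <xi, x - y>] ([power_spectrumE]). Write [1 / t]
    as the integral of [exp(- l t)] over [l > 0]. The integral over [t] becomes the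
    Laplace transform [l / (l^2 + s^2)] of the cosine. As [psi] has mean zero, the
    same kernel at [s = c], for any constant [c > 0], can be subtracted without
    changing the double integral. Now absolute values may be taken, because the
    integral of [|l / (l^2 + s^2) - l / (l^2 + c^2)|] over [l > 0] is exactly
    [|log(|s| / c)|] ([integral_laplace_cos_diff]). With [c = |xi|] the quotient [|s| / c]
    is [|<xi / |xi|, x - y>|], so that the double integral is at most [L(psi)]
    ([multiplier_le]).

    Only the squared modulus of the Fourier transform of real functions occurs: it is
    [power_spectrum], the sum of the squares of the cosine and the sine transform.
    Plancherel is proved for bounded integrable functions by Abel summation. The
    weight [exp(- r (|xi_1| + ... + |xi_n|))] has a product of one-dimensional Poisson
    kernels as its transform, and polarization shows that the weighted energy falls
    short of [(2 pi)^n] times the square of the L^2 norm by half of a defect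
    ([smoothed_identity]). The defect averages [(u(x) - u(y))^2] against the Poisson
    kernel at [x - y], so it tends to 0 with [r], because translations are continuous
    in L^1 ([L1_translation]). The inequalities [plancherel_ge] and [plancherel_le],
    the convolution theorem [power_spectrum_rconv] and the multiplier estimate give
    the bound for real [psi] and bounded integrable real [f]
    ([real_square_function_le]).

    For the general case, [psi] and [f] are split into real and imaginary parts, and
    [f] is truncated and recovered by Fatou ([pair_square_function_le]). The constant
    obtained is [2 L(psi)^(1/2)]. *)

Set Implicit Arguments.
Unset Strict Implicit.
Unset Printing Implicit Defensive.

Import Order.TTheory GRing.Theory Num.Theory.
Import numFieldNormedType.Exports.

Local Open Scope classical_set_scope.
Local Open Scope ring_scope.

(** * Integration: product measures, Fubini for real-valued integrals, Fatou *)

Section product_sigma_finite.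
Local Open Scope ereal_scope.
Context {d1 d2 : measure_display} {T1 : measurableType d1}
  {T2 : measurableType d2} {R : realType}.
Variables (m1 : {sigma_finite_measure set T1 -> \bar R})
  (m2 : {sigma_finite_measure set T2 -> \bar R}).

(** The product measure under a name of its own, so that the sigma-finite
    instance below can be attached to it; products with a third measure need it. *)
Definition prodm : set (T1 * T2) -> \bar R := m1 \x m2.

HB.instance Definition _ := Measure.on prodm.

Let prodm_sigma_finite : sigma_finite setT prodm.
Proof.
have /sigma_finiteP[F [TF ndF Foo]] := sigma_finiteT m1.
have /sigma_finiteP[G [TG ndG Goo]] := sigma_finiteT m2.
exists (fun k => F k `*` G k).
  apply/esym; rewrite -subTset => -[x y] _.
  have : setT x by [].
  have : setT y by [].
  rewrite [in X in X -> _]TG [in X in _ -> X -> _]TF.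
  move=> [k _ Gk] [l _ Fl]; exists (maxn k l) => //; split => /=.
    by move: Fl; exact/subsetPset/ndF/leq_maxr.
  by move: Gk; exact/subsetPset/ndG/leq_maxl.
move=> k; have [mF Fk] := Foo k; have [mG Gk] := Goo k; split.
  exact: measurableX.
by rewrite /prodm product_measure1E// lte_mul_pinfty// ge0_fin_numE.
Qed.

HB.instance Definition _ := Measure_isSigmaFinite.Build _ _ _ prodm
  prodm_sigma_finite.

End product_sigma_finite.

Lemma ge0_integrable d (T : measurableType d) (R : realType)
    (mu : {measure set T -> \bar R}) (D : set T) (f : T -> R) : measurable D ->
  (forall t, 0 <= f t) -> measurable_fun D f ->
  (\int[mu]_(t in D) (f t)%:E < +oo)%E -> mu.-integrable D (EFin \o f).
Proof.
move=> mD f0 mf foo; apply/integrableP; split; first exact/measurable_EFinP.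
by under eq_integral do rewrite gee0_abs ?lee_fin//.
Qed.

Lemma EFin_Rintegral d (T : measurableType d) (R : realType)
    (mu : {measure set T -> \bar R}) (D : set T) (f : T -> R) : measurable D ->
  mu.-integrable D (EFin \o f) ->
  (\int[mu]_(x in D) f x)%:E = (\int[mu]_(x in D) (f x)%:E)%E.
Proof. by move=> mD fi; rewrite fineK//; exact: integrable_fin_num mD _ fi. Qed.

Section fubini.
Context {d1 d2 : measure_display} {T1 : measurableType d1}
  {T2 : measurableType d2} {R : realType}.
Variables (m1 : {sigma_finite_measure set T1 -> \bar R})
  (m2 : {sigma_finite_measure set T2 -> \bar R}).
Implicit Types F : T1 * T2 -> R.

(** Sections that are not integrable are covered as well: the integrals of the
    positive and negative parts are measurable, and so is [fine]. *)
Lemma measurable_Rintegral F : measurable_fun setT F ->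
  measurable_fun setT (fun x => \int[m2]_y F (x, y)).
Proof.
move=> mF; apply: (measurableT_comp (fine_measurable measurableT)) => /=.
under eq_fun do rewrite integralE.
have mEF : measurable_fun setT (EFin \o F) by exact/measurable_EFinP.
apply: emeasurable_funB.
  rewrite [X in measurable_fun _ X](_ : _ = fubini_F m2 (EFin \o F)^\+%E).
    apply: measurable_fun_fubini_tonelli_F; first exact: measurable_funepos.
    by move=> z; exact: funepos_ge0.
  by apply/funext => x; apply: eq_integral => y _; rewrite !funeposE.
rewrite [X in measurable_fun _ X](_ : _ = fubini_F m2 (EFin \o F)^\-%E).
  apply: measurable_fun_fubini_tonelli_F; first exact: measurable_funeneg.
  by move=> z; exact: funeneg_ge0.
by apply/funext => x; apply: eq_integral => y _; rewrite !funenegE.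
Qed.

(** Integrability of every section, and not just of almost every one, removes
    the exceptional null set from the Fubini theorem. *)
Lemma integrable_Rintegral F :
  (m1 \x m2)%E.-integrable setT (EFin \o F) ->
  (forall x, m2.-integrable setT (EFin \o (fun y => F (x, y)))) ->
  m1.-integrable setT (EFin \o (fun x => \int[m2]_y F (x, y))).
Proof.
move=> iF iFx; apply: (eq_integrable measurableT (fubini_F m2 (EFin \o F))).
  move=> x _ /=.
  by rewrite EFin_Rintegral.
exact: integrable_fubini_F.
Qed.

Lemma Rintegral_prod F :
  (m1 \x m2)%E.-integrable setT (EFin \o F) ->
  (forall x, m2.-integrable setT (EFin \o (fun y => F (x, y)))) ->
  \int[(m1 \x m2)%E]_z F z = \int[m1]_x \int[m2]_y F (x, y).
Proof.
move=> iF iFx; congr fine; rewrite -(integral12_prod_meas1 iF).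
apply: eq_integral => x _.
by rewrite /= EFin_Rintegral.
Qed.

Lemma Rintegral_swap F :
  (m1 \x m2)%E.-integrable setT (EFin \o F) ->
  (forall x, m2.-integrable setT (EFin \o (fun y => F (x, y)))) ->
  (forall y, m1.-integrable setT (EFin \o (fun x => F (x, y)))) ->
  \int[m1]_x \int[m2]_y F (x, y) = \int[m2]_y \int[m1]_x F (x, y).
Proof.
move=> iF iFx iFy; congr fine.
transitivity (\int[m1]_x \int[m2]_y (F (x, y))%:E)%E.
  by apply: eq_integral => x _; rewrite EFin_Rintegral.
rewrite (Fubini iF); apply: eq_integral => y _.
by rewrite EFin_Rintegral.
Qed.

Lemma integrable_prodM (f : T1 -> R) (g : T2 -> R) :
  m1.-integrable setT (EFin \o f) -> m2.-integrable setT (EFin \o g) ->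
  (m1 \x m2)%E.-integrable setT (EFin \o (fun z => f z.1 * g z.2)).
Proof.
move=> fi gi.
have mf : measurable_fun setT f by exact/measurable_EFinP/measurable_int/fi.
have mg : measurable_fun setT g by exact/measurable_EFinP/measurable_int/gi.
apply/integrable12ltyP => /=.
  apply/measurable_EFinP; apply: measurable_funM.
    exact: measurableT_comp mf (measurable_fst).
  exact: measurableT_comp mg (measurable_snd).
have -> : (\int[m1]_x \int[m2]_y `|f x * g y|%:E =
    \int[m1]_x (`|f x|%:E * \int[m2]_y `|g y|%:E))%E.
  apply: eq_integral => x _; rewrite -ge0_integralZl_EFin//.
    by apply: eq_integral => y _; rewrite -EFinM normrM.
  by apply/measurable_EFinP; exact: measurableT_comp.
have /integrableP[_ fo] := fi; have /integrableP[_ go] := gi.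
rewrite ge0_integralZr//.
- by rewrite lte_mul_pinfty// ?integral_ge0// ge0_fin_numE// integral_ge0.
- by apply/measurable_EFinP; exact: measurableT_comp.
- exact: integral_ge0.
Qed.

Lemma Rintegral_prodM (f : T1 -> R) (g : T2 -> R) :
  m1.-integrable setT (EFin \o f) -> m2.-integrable setT (EFin \o g) ->
  \int[(m1 \x m2)%E]_z (f z.1 * g z.2) = (\int[m1]_x f x) * (\int[m2]_y g y).
Proof.
move=> fi gi; rewrite Rintegral_prod/=; last 2 first.
- exact: integrable_prodM.
- by move=> x; exact: (integrableZl measurableT (f x) gi).
rewrite -RintegralZr//; apply: eq_Rintegral => x _.
by rewrite RintegralZl.
Qed.

End fubini.

Lemma le_fatou d (T : measurableType d) (R : realType)
    (m : {measure set T -> \bar R}) (D : set T) (f_ : nat -> T -> \bar R)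
    (f : T -> \bar R) : measurable D ->
  (forall j, measurable_fun D (f_ j)) -> (forall j t, D t -> 0 <= f_ j t)%E ->
  measurable_fun D f -> (forall t, D t -> 0 <= f t)%E ->
  (forall t, D t -> f t <= limn_einf (f_^~ t))%E ->
  (\int[m]_(t in D) f t <= limn_einf (fun j => \int[m]_(t in D) f_ j t))%E.
Proof.
move=> mD mf_ f_0 mf f0 f_f.
have mlim : measurable_fun D (fun t => limn_einf (f_^~ t)).
  apply: measurableT_comp => //; apply: measurable_fun_limn_esup => j.
  exact: measurableT_comp.
apply: (@le_trans _ _ (\int[m]_(t in D) limn_einf (f_^~ t))%E).
  exact: ge0_le_integral.
exact: fatou.
Qed.

Lemma fatou_le d (T : measurableType d) (R : realType)
    (m : {measure set T -> \bar R}) (f_ : nat -> T -> \bar R)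
    (f : T -> \bar R) (c : \bar R) :
  (forall j, measurable_fun setT (f_ j)) -> (forall j t, 0 <= f_ j t)%E ->
  measurable_fun setT f -> (forall t, 0 <= f t)%E ->
  (forall t, f t <= limn_einf (f_^~ t))%E ->
  (forall j, \int[m]_t f_ j t <= c)%E -> (\int[m]_t f t <= c)%E.
Proof.
move=> mf_ f_0 mf f0 f_f fc.
have := @le_fatou _ _ _ m setT f_ f measurableT mf_ (fun j t _ => f_0 j t) mf
  (fun t _ => f0 t) (fun t _ => f_f t).
move=> /le_trans; apply.
rewrite limn_einf_lim; apply: lime_le; first exact: is_cvg_einfs.
apply: nearW => j; apply: le_trans (fc j).
by apply: ereal_inf_lbound; exists j => /=.
Qed.

Lemma tonelli_setX d1 d2 (T1 : measurableType d1) (T2 : measurableType d2)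
    (R : realType) (m1 : {sigma_finite_measure set T1 -> \bar R})
    (m2 : {sigma_finite_measure set T2 -> \bar R}) (A : set T1) (B : set T2)
    (f : T1 * T2 -> \bar R) : measurable A -> measurable B ->
  measurable_fun setT f -> (forall z, 0 <= f z)%E ->
  (\int[m1]_(x in A) \int[m2]_(y in B) f (x, y) =
   \int[m2]_(y in B) \int[m1]_(x in A) f (x, y))%E.
Proof.
move=> mA mB mf f0; pose g := f \_ (A `*` B).
have mg : measurable_fun setT g.
  apply/(measurable_restrictT _ (measurableX mA mB)).
  exact: measurable_funTS.
have g0 z : (0 <= g z)%E by rewrite /g patchE; case: ifP.
have gE x y : g (x, y) = if (x \in A) && (y \in B) then f (x, y) else 0%E.
  by rewrite /g patchE in_setX.
transitivity (\int[m1]_x \int[m2]_y g (x, y))%E.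
  rewrite integral_mkcond; apply: eq_integral => x _; rewrite patchE.
  case: ifPn => xA; last by rewrite integral0_eq// => y _; rewrite gE (negbTE xA).
  rewrite integral_mkcond; apply: eq_integral => y _.
  by rewrite gE xA patchE.
rewrite (@fubini_tonelli _ _ _ _ R m1 m2 g mg g0) [RHS]integral_mkcond.
apply: eq_integral => y _; rewrite patchE.
case: ifPn => yB; last by rewrite integral0_eq// => x _; rewrite gE (negbTE yB) andbF.
by rewrite [RHS]integral_mkcond; apply: eq_integral => x _; rewrite gE yB andbT patchE.
Qed.

Lemma measurable_integral_fst d1 d2 (T1 : measurableType d1)
    (T2 : measurableType d2) (R : realType)
    (m1 : {sigma_finite_measure set T1 -> \bar R}) (A : set T1)
    (f : T1 * T2 -> \bar R) : measurable A ->
  measurable_fun setT f -> (forall z, 0 <= f z)%E ->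
  measurable_fun setT (fun y => \int[m1]_(x in A) f (x, y))%E.
Proof.
move=> mA mf f0; pose g := f \_ (A `*` setT).
have mg : measurable_fun setT g.
  apply/(measurable_restrictT _ (measurableX mA measurableT)).
  exact: measurable_funTS.
rewrite (_ : (fun y => _) = fubini_G m1 g).
  apply: measurable_fun_fubini_tonelli_G => // z.
  by rewrite /g patchE; case: ifP.
apply/funext => y; rewrite [LHS]integral_mkcond; apply: eq_integral => x _.
by rewrite /g !patchE in_setX in_setT andbT.
Qed.

Lemma measurable_integral_snd d1 d2 (T1 : measurableType d1)
    (T2 : measurableType d2) (R : realType)
    (m2 : {sigma_finite_measure set T2 -> \bar R}) (B : set T2)
    (f : T1 * T2 -> \bar R) : measurable B ->
  measurable_fun setT f -> (forall z, 0 <= f z)%E ->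
  measurable_fun setT (fun x => \int[m2]_(y in B) f (x, y))%E.
Proof.
move=> mB mf f0.
apply: (@measurable_integral_fst _ _ _ _ R m2 B (fun z => f (z.2, z.1))) => //.
apply: (measurableT_comp mf).
exact: (measurable_fun_pair measurable_snd measurable_fst).
Qed.

Lemma measurable_lne_EFin (R : realType) : measurable_fun setT (fun r : R => lne r%:E).
Proof.
rewrite (_ : (fun r : R => _) = fun r : R => if r <= 0 then -oo%E else (ln r)%:E)//.
apply: measurable_fun_ifT => //.
  by apply: measurable_fun_ler.
by apply/measurable_EFinP; exact: measurable_ln.
Qed.

Lemma measurable_invr (R : realType) : measurable_fun setT (@GRing.inv R).
Proof.
rewrite (_ : @GRing.inv R = fun t : R => t * ((t ^+ 2) `^ (-1))); last first.
  apply/funext => t; rewrite powR_inv1 ?sqr_ge0//.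
  have [->|t0] := eqVneq t 0; first by rewrite invr0 mul0r.
  by rewrite expr2 invfM mulrA divff// mul1r.
apply: measurable_funM => //.
by apply: (measurableT_comp (measurable_powR (-1))); exact: measurable_funX.
Qed.

(** * Affine changes of variables for the Lebesgue measure of R^n *)

Section measurable_rV.
Context {d : measure_display} {T : measurableType d} {R : realType} {n : nat}.
Implicit Types (f g : T -> 'rV[R]_n) (c : T -> R).

Lemma measurable_rVP f : measurable_fun setT f <->
  forall j, measurable_fun setT (fun x => f x ord0 j).
Proof.
rewrite measurable_fun_matrixP; split => [H j|H i j]; first exact: H.
by rewrite (ord1 i); exact: H.
Qed.

Lemma measurable_rVD f g : measurable_fun setT f -> measurable_fun setT g ->
  measurable_fun setT (fun x => f x + g x).
Proof.
move=> /measurable_rVP mf /measurable_rVP mg; apply/measurable_rVP => j.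
by under eq_fun do rewrite mxE; exact: measurable_funD.
Qed.

Lemma measurable_rVZ c f : measurable_fun setT c -> measurable_fun setT f ->
  measurable_fun setT (fun x => c x *: f x).
Proof.
move=> mc /measurable_rVP mf; apply/measurable_rVP => j.
by under eq_fun do rewrite mxE; exact: measurable_funM.
Qed.

Lemma measurable_rVB f g : measurable_fun setT f -> measurable_fun setT g ->
  measurable_fun setT (fun x => f x - g x).
Proof.
move=> mf mg; apply: measurable_rVD => //.
by under eq_fun do rewrite -scaleN1r; exact: measurable_rVZ.
Qed.

Lemma measurable_dotv f g : measurable_fun setT f -> measurable_fun setT g ->
  measurable_fun setT (fun x => dotv (f x) (g x)).
Proof.
move=> /measurable_rVP mf /measurable_rVP mg.
by apply: measurable_sum => j; exact: measurable_funM.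
Qed.

End measurable_rV.

(** Both sides integrate against measures that agree on bounded intervals:
    the pushforward of the Lebesgue measure by the affine map, rescaled by
    [`|r|], is the Lebesgue measure. *)
Lemma ge0_integral_affine1 (R : realType) (r v : R) (F : R -> \bar R) :
  r != 0 -> measurable_fun setT F -> (forall a, 0 <= F a)%E ->
  (\int[lebesgue_measure]_a F (r * a + v)%R =
   (`|r|^-1)%:E * \int[lebesgue_measure]_a F a)%E.
Proof.
move=> r0 mF F0.
pose phi (a : measurableTypeR R) : measurableTypeR R := r * a + v.
have mphi : measurable_fun [set: measurableTypeR R] phi.
  by apply: measurable_funD => //; exact: measurable_funM.
have r_gt0 : 0 < `|r| by rewrite normr_gt0.
pose pm : {measure set (measurableTypeR R) -> \bar R} :=
  measure_function_pushforward__canonical__measure_function_Measure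
    (@lebesgue_measure R) mphi.
pose m := mscale (NngNum (ltW r_gt0)) pm.
have mE A : measurable A -> lebesgue_measure A = m A.
  apply: lebesgue_measure_unique => _ [[a b] _ <-].
  transitivity (`|r|%:E * lebesgue_measure (phi @^-1` `]a, b]))%E => //.
  rewrite lebesgue_measure_itv/=.
  have [rp|rn] := ltP 0 r.
    have -> : phi @^-1` `]a, b] = `](a - v) / r, (b - v) / r]%classic.
      apply/seteqP; split=> x /=; rewrite !in_itv/= /phi;
        by rewrite ltr_pdivrMr// ler_pdivlMr// ltrBlDr lerBrDr (mulrC x).
    rewrite lebesgue_measure_itv/= !lte_fin ltr_pM2r ?invr_gt0// ltrD2r.
    case: ifPn => _; rewrite ?mule0// -EFinM gtr0_norm//.
    by congr EFin; field.
  have {}rn : r < 0 by rewrite lt_neqAle r0.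
  have -> : phi @^-1` `]a, b] = `[(b - v) / r, (a - v) / r[%classic.
    apply/seteqP; split=> x /=; rewrite !in_itv/= /phi;
      by rewrite ler_ndivrMr// ltr_ndivlMr// ltrBlDr lerBrDr (mulrC x) andbC.
  rewrite lebesgue_measure_itv/= !lte_fin ltr_nM2r ?invr_lt0// ltrD2r.
  case: ifPn => _; rewrite ?mule0// -EFinM ltr0_norm//.
  by congr EFin; field.
rewrite [in RHS](eq_measure_integral m)//=; last by move=> A mA _; exact: mE.
rewrite ge0_integral_mscale//= muleA -EFinM mulVf ?gt_eqF// mul1e.
by rewrite ge0_integral_pushforward.
Qed.

Section lebesgue_rV_theory.
Context {R : realType}.
Local Notation lam := (@lebesgue_measure R).

Section successor.
Context {n : nat}.
Local Notation mu := (@lebesgue_rV R n).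

Let measurable_consmx_lam :
  measurable_fun [set: measurableTypeR R * 'rV[R]_n] (@consmx R n).
Proof. exact: measurable_consmx. Qed.

Lemma ge0_integral_rVS (F : 'rV[R]_n.+1 -> \bar R) : measurable_fun setT F ->
  (forall x, 0 <= F x)%E ->
  (\int[lebesgue_rV n.+1]_x F x =
   \int[lam]_a \int[mu]_x F (consmx (a, x)))%E.
Proof.
move=> mF F0.
have mFc : measurable_fun setT (F \o @consmx R n).
  exact: measurableT_comp mF (@measurable_consmx R n).
transitivity (\int[(lam \x mu)%E]_z F (consmx z))%E; last first.
  exact: (@fubini_tonelli1 _ _ _ _ R lam mu _ mFc (fun z => F0 _)).
exact: (ge0_integral_pushforward measurable_consmx_lam (lam \x mu)%E
  measurableT mF (fun y _ => F0 y)).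
Qed.

Lemma Rintegral_rVS (F : 'rV[R]_n.+1 -> R) :
  measurable_fun setT F ->
  (lam \x mu)%E.-integrable setT (EFin \o (F \o @consmx R n)) ->
  \int[lebesgue_rV n.+1]_x F x = \int[(lam \x mu)%E]_z F (consmx z).
Proof.
move=> mF iF; congr fine.
have mEF : measurable_fun setT (EFin \o F) by exact/measurable_EFinP.
exact: (integral_pushforward measurable_consmx_lam mEF iF measurableT).
Qed.

Lemma integrable_rVS (F : 'rV[R]_n.+1 -> R) :
  measurable_fun setT F ->
  (lam \x mu)%E.-integrable setT (EFin \o (F \o @consmx R n)) ->
  (lebesgue_rV n.+1).-integrable setT (EFin \o F).
Proof.
move=> mF iF.
have mEF : measurable_fun setT (EFin \o F) by exact/measurable_EFinP.
exact: (integrable_pushforward measurable_consmx_lam mEF iF measurableT).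
Qed.

End successor.

Lemma ge0_integral_affine n (r : R) (v : 'rV[R]_n) (F : 'rV[R]_n -> \bar R) :
  r != 0 -> measurable_fun setT F -> (forall x, 0 <= F x)%E ->
  (\int[lebesgue_rV n]_x F (r *: x + v)%R =
   (`|r| ^- n)%:E * \int[lebesgue_rV n]_x F x)%E.
Proof.
move=> r0; elim: n v F => [|n IHn] v F mF F0.
  rewrite expr0 invr1 mul1e; apply: eq_integral => x _.
  by congr F; apply/rowP => -[].
have mc := @measurable_consmx R n.
have mFa : measurable_fun setT (fun x : 'rV[R]_n.+1 => F (r *: x + v)%R).
  by apply: (measurableT_comp mF); apply: measurable_rVD => //;
    exact: measurable_rVZ.
rewrite !ge0_integral_rVS//.
pose v' : 'rV[R]_n := \row_j v ord0 (lift ord0 j).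
have consE a (x : 'rV[R]_n) :
    r *: consmx (a, x) + v = consmx (r * a + v ord0 ord0, r *: x + v').
  apply/rowP => j; rewrite !mxE.
  by have [k ->|->] := unliftP ord0 j; rewrite ?liftK ?unlift_none/= ?mxE.
have mFx a : measurable_fun setT (fun x : 'rV[R]_n => F (consmx (a, x))).
  by apply: (measurableT_comp mF); apply: (measurableT_comp mc).
have mG : measurable_fun setT (fun a => \int[lebesgue_rV n]_x F (consmx (a, x)))%E.
  apply: (@measurable_fun_fubini_tonelli_F _ _ _ _ _ (lebesgue_rV n)
     (F \o @consmx R n)) => //; first exact: measurableT_comp mF mc.
  by move=> z; exact: F0.
under eq_integral => a _.
  under eq_integral do rewrite consE.
  rewrite (IHn _ (fun x => F (consmx (r * a + v ord0 ord0, x))))//.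
  over.
rewrite ge0_integralZl_EFin//=; last 2 first.
- by move=> a _; exact: integral_ge0.
- by apply: (measurableT_comp mG); apply: measurable_funD => //;
    exact: measurable_funM.
rewrite (ge0_integral_affine1 _ _ mG)//; last by move=> a; exact: integral_ge0.
by rewrite muleA -EFinM exprSr invfM.
Qed.

Lemma ge0_integral_translate1 (b : R) (F : R -> \bar R) :
  measurable_fun setT F -> (forall a, 0 <= F a)%E ->
  (\int[lam]_a F (a + b)%R = \int[lam]_a F a)%E.
Proof.
move=> mF F0; have := ge0_integral_affine1 b (oner_neq0 R) mF F0.
rewrite normr1 invr1 mul1e => <-.
by apply: eq_integral => a _; rewrite mul1r.
Qed.

Lemma ge0_integral_translate n (v : 'rV[R]_n) (F : 'rV[R]_n -> \bar R) :
  measurable_fun setT F -> (forall x, 0 <= F x)%E ->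
  (\int[lebesgue_rV n]_x F (x + v)%R = \int[lebesgue_rV n]_x F x)%E.
Proof.
move=> mF F0; have := ge0_integral_affine v (oner_neq0 R) mF F0.
rewrite normr1 expr1n invr1 mul1e => <-.
by apply: eq_integral => x _; rewrite scale1r.
Qed.

Section affine.
Context {n : nat}.
Local Notation mu := (@lebesgue_rV R n).
Implicit Types F : 'rV[R]_n -> R.

(** Positive and negative parts; when they do not have finite integrals, the
    positive factor commutes with the conventions for infinite values. *)
Lemma integral_affine (r : R) (v : 'rV[R]_n) F :
  r != 0 -> measurable_fun setT F ->
  (\int[mu]_x (F (r *: x + v)%R)%:E =
   (`|r| ^- n)%:E * \int[mu]_x (F x)%:E)%E.
Proof.
move=> r0 mF; have mEF : measurable_fun setT (EFin \o F) by exact/measurable_EFinP.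
rewrite integralE [in RHS]integralE.
have -> : (\int[mu]_x (fun x => (F (r *: x + v)%R)%:E)^\+ x =
    (`|r| ^- n)%:E * \int[mu]_x (fun x => (F x)%:E)^\+ x)%E.
  rewrite -(ge0_integral_affine v r0)//; last exact: measurable_funepos.
  by apply: eq_integral => x _; rewrite !funeposE.
have -> : (\int[mu]_x (fun x => (F (r *: x + v)%R)%:E)^\- x =
    (`|r| ^- n)%:E * \int[mu]_x (fun x => (F x)%:E)^\- x)%E.
  rewrite -(ge0_integral_affine v r0)//; last exact: measurable_funeneg.
  by apply: eq_integral => x _; rewrite !funenegE.
have p0 : (0 <= \int[mu]_x (fun x => (F x)%:E)^\+ x)%E by exact: integral_ge0.
have n0 : (0 <= \int[mu]_x (fun x => (F x)%:E)^\- x)%E by exact: integral_ge0.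
have k0 : 0 < `|r| ^- n by rewrite invr_gt0 exprn_gt0// normr_gt0.
move: p0 n0; case: integral => [p| |]//; case: integral => [q| |]// p0 q0.
- by congr EFin; rewrite mulrBr.
- by rewrite gt0_muley ?lte_fin//= gt0_muleNy ?lte_fin.
- by rewrite gt0_muley ?lte_fin//= gt0_muley ?lte_fin.
- by rewrite gt0_muley ?lte_fin//= gt0_muleNy ?lte_fin.
Qed.

Lemma Rintegral_affine (r : R) (v : 'rV[R]_n) F :
  r != 0 -> measurable_fun setT F ->
  \int[mu]_x F (r *: x + v) = `|r| ^- n * \int[mu]_x F x.
Proof.
move=> r0 mF; rewrite /Rintegral integral_affine//.
have k0 : 0 < `|r| ^- n by rewrite invr_gt0 exprn_gt0// normr_gt0.
case: integral => [p| |]//=.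
  by rewrite gt0_muley ?lte_fin// mulr0.
by rewrite gt0_muleNy ?lte_fin// mulr0.
Qed.

Lemma integrable_affine (r : R) (v : 'rV[R]_n) F :
  r != 0 -> mu.-integrable setT (EFin \o F) ->
  mu.-integrable setT (EFin \o (fun x => F (r *: x + v))).
Proof.
move=> r0 /integrableP[/measurable_EFinP mF Foo]; apply/integrableP; split.
  apply/measurable_EFinP/(measurableT_comp mF).
  by apply: measurable_rVD => //; exact: measurable_rVZ.
rewrite (ge0_integral_affine v r0 (F := fun x => `|(F x)%:E|%E))//.
  by rewrite lte_mul_pinfty// lee_fin invr_ge0 exprn_ge0.
by apply/measurable_EFinP; exact: measurableT_comp.
Qed.

End affine.

End lebesgue_rV_theory.

(** * Integrals over the half line *)

Section half_line.
Context {R : realType}.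
Local Notation lam := (@lebesgue_measure R).
Implicit Types (f F : R -> R) (s c l : R).

Lemma is_derive_cvg f (t df : R) : is_derive t (1 : R) f df ->
  f u @[u --> t] --> f t.
Proof.
by move=> fdf; exact/differentiable_continuous/derivable1_diffP/ex_derive.
Qed.

Lemma ge0_FTC_half_line f F l :
  (forall t, 0 <= t -> 0 <= f t) -> (forall t, is_derive t (1 : R) F (f t)) ->
  continuous f -> F t @[t --> +oo] --> l ->
  (\int[lam]_(t in `]0%R, +oo[) (f t)%:E = (l - F 0)%:E)%E.
Proof.
move=> f0 dF cf Fl; rewrite integral_itv_obnd_cbnd; last first.
  apply/measurable_EFinP; apply: measurable_funTS.
  exact: continuous_measurable_fun.
rewrite (ge0_continuous_FTC2y (F := F) (l := l)) //.
- exact: continuous_subspaceT.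
- apply: cvg_at_right_filter.
  exact/differentiable_continuous/derivable1_diffP/ex_derive.
- by move=> t _; rewrite derive1E derive_val.
Qed.

Lemma cvg_expRN_mul l : 0 < l -> expR (- (l * t)) @[t --> +oo] --> (0 : R).
Proof.
move=> l0; apply: (cvg_comp (fun t => l * t) (fun u => expR (- u))).
  by apply: gt0_cvgMry => //; exact: cvg_id.
exact: cvgr_expR.
Qed.

Lemma is_derive_expRN_mul l (t : R) :
  is_derive t (1 : R) (fun t : R => expR (- (l * t))) (- l * expR (- (l * t))).
Proof.
have dl : is_derive t (1 : R) (fun t : R => - (l * t)) (- l).
  have := is_deriveN (is_deriveZ l (is_derive_id t (1 : R))).
  by rewrite /GRing.scale/= mulr1.
by have := is_derive1_comp (is_derive_expR _) dl; rewrite mulrC.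
Qed.

Lemma integral_expRN l : 0 < l ->
  (\int[lam]_(t in `]0%R, +oo[) (expR (- (l * t)))%:E = (l^-1)%:E)%E.
Proof.
move=> l0; pose F t : R := - l^-1 * expR (- (l * t)).
have dF (t : R) : is_derive t (1 : R) F (expR (- (l * t))).
  have := is_deriveZ (- l^-1) (is_derive_expRN_mul l t).
  by rewrite /GRing.scale/= mulrA mulrNN mulVf ?mul1r// gt_eqF.
have cf : continuous (fun t : R => expR (- (l * t))).
  move=> t; apply: continuous_comp; last exact: continuous_expR.
  by apply: continuousN; apply: continuousM; [exact: cvg_cst|exact: cvg_id].
have F0 : F t @[t --> +oo] --> (0 : R).
  rewrite -(mulr0 (- l^-1)); apply: cvgM; first exact: cvg_cst.
  exact: cvg_expRN_mul.
rewrite (ge0_FTC_half_line (fun t _ => expR_ge0 (- (l * t))) dF cf F0).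
by rewrite /F mulr0 oppr0 expR0 mulr1 opprK add0r.
Qed.

Let lap_ge0 l s (t : R) : 0 <= expR (- (l * t)) * (1 + cos (t * s)).
Proof.
by rewrite mulr_ge0 ?expR_ge0// -(subrr 1) addrC -opprB opprK lerD2l cos_geN1.
Qed.

(** The cosine alone takes both signs; adding 1 makes the integrand nonnegative,
    so that the fundamental theorem of calculus on the half line applies. *)
Lemma integral_expRN_1cos l s : 0 < l ->
  (\int[lam]_(t in `]0%R, +oo[) (expR (- (l * t)) * (1 + cos (t * s)))%:E =
   (l^-1 + l / (l ^+ 2 + s ^+ 2))%:E)%E.
Proof.
move=> l0; have d0 : l ^+ 2 + s ^+ 2 != 0.
  by rewrite gt_eqF// ltr_wpDr ?sqr_ge0// exprn_gt0.
pose F t : R := expR (- (l * t)) *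
  (- l^-1 + (l ^+ 2 + s ^+ 2)^-1 * (s * sin (t * s) - l * cos (t * s))).
have dts (t : R) : is_derive t (1 : R) (fun t : R => t * s) s.
  have := is_deriveZ s (is_derive_id t (1 : R)).
  rewrite /GRing.scale/= mulr1; congr is_derive.
  by apply/funext => x /=; rewrite /GRing.scale/= mulrC.
have dsin (t : R) : is_derive t (1 : R) (fun t : R => sin (t * s)) (cos (t * s) * s).
  exact: is_derive1_comp (is_derive_sin _) (dts t).
have dcos (t : R) : is_derive t (1 : R) (fun t : R => cos (t * s)) (- sin (t * s) * s).
  exact: is_derive1_comp (is_derive_cos _) (dts t).
have dF (t : R) : is_derive t (1 : R) F (expR (- (l * t)) * (1 + cos (t * s))).
  have dB := is_deriveB (is_deriveZ s (dsin t)) (is_deriveZ l (dcos t)).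
  have dC := is_deriveD (is_derive_cst (- l^-1) t (1 : R))
    (is_deriveZ (l ^+ 2 + s ^+ 2)^-1 dB).
  have dM := is_deriveM (is_derive_expRN_mul l t) dC.
  apply: (@is_derive_eq _ _ _ _ _ _ _ _ dM).
  rewrite /= !fctE /GRing.scale/=.
  have l1 : l != 0 by rewrite gt_eqF.
  by rewrite /GRing.scale/=; field; rewrite d0 l1.
have cf : continuous (fun t : R => expR (- (l * t)) * (1 + cos (t * s))).
  move=> t; apply: cvgM.
    exact: is_derive_cvg (is_derive_expRN_mul l t).
  apply: cvgD; first exact: cvg_cst.
  exact: is_derive_cvg (dcos t).
have F0 : F t @[t --> +oo] --> (0 : R).
  pose K := l^-1 + (l ^+ 2 + s ^+ 2)^-1 * (`|s| + l).
  apply: norm_cvg0.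
  apply: (@squeeze_cvgr _ _ _ _ (cst 0) (fun t => expR (- (l * t)) * K)).
  - apply: nearW => t /=; rewrite normr_ge0 /F normrM ger0_norm ?expR_ge0//=.
    rewrite ler_wpM2l ?expR_ge0// (le_trans (ler_normD _ _))//.
    rewrite normrN gtr0_norm ?invr_gt0// lerD2l normrM ger0_norm; last first.
      by rewrite invr_ge0 addr_ge0 ?sqr_ge0.
    rewrite ler_wpM2l ?invr_ge0 ?addr_ge0 ?sqr_ge0//.
    rewrite (le_trans (ler_normB _ _))// !normrM (gtr0_norm l0) lerD//.
      by rewrite ler_piMr// ler_norml sin_le1 sin_geN1.
    by rewrite ler_piMr ?(ltW l0)// ler_norml cos_le1 cos_geN1.
  - exact: cvg_cst.
  - rewrite -(mul0r K); apply: cvgM; last exact: cvg_cst.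
    exact: cvg_expRN_mul.
rewrite (ge0_FTC_half_line (fun t _ => lap_ge0 l s t) dF cf F0).
congr EFin; rewrite /F mulr0 mul0r oppr0 expR0 sin0 cos0.
have l1 : l != 0 by rewrite gt_eqF.
by field; rewrite d0 l1.
Qed.

Lemma measurable_expRN_mul l : measurable_fun setT (fun t : R => expR (- (l * t))).
Proof.
apply: measurableT_comp => //; apply: measurable_funN.
exact: measurable_funM.
Qed.

Lemma measurable_cos_mul s : measurable_fun setT (fun t : R => cos (t * s)).
Proof.
apply: measurableT_comp; last exact: measurable_funM.
by apply: continuous_measurable_fun; exact: continuous_cos.
Qed.

Lemma integrable_expRN l : 0 < l ->
  lam.-integrable `]0%R, +oo[ (EFin \o (fun t => expR (- (l * t)))).
Proof.
move=> l0; apply: ge0_integrable => //.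
- by apply: measurable_funTS; exact: measurable_expRN_mul.
- by rewrite integral_expRN// ltry.
Qed.

Let integrable_lap l s : 0 < l ->
  lam.-integrable `]0%R, +oo[
    (EFin \o (fun t => expR (- (l * t)) * (1 + cos (t * s)))).
Proof.
move=> l0; apply: ge0_integrable => //.
- apply: measurable_funTS; apply: measurable_funM; first exact: measurable_expRN_mul.
  by apply: measurable_funD => //; exact: measurable_cos_mul.
- by rewrite integral_expRN_1cos// ltry.
Qed.

Let lapE l s (t : R) : expR (- (l * t)) * cos (t * s) =
  expR (- (l * t)) * (1 + cos (t * s)) - expR (- (l * t)).
Proof. by rewrite mulrDr mulr1 addrC addKr. Qed.

Lemma Rintegral_expRN_cos l s : 0 < l ->
  \int[lam]_(t in `]0%R, +oo[) (expR (- (l * t)) * cos (t * s)) =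
  l / (l ^+ 2 + s ^+ 2).
Proof.
move=> l0; under eq_Rintegral do rewrite lapE.
rewrite RintegralB//; [|exact: integrable_lap|exact: integrable_expRN].
by rewrite /Rintegral integral_expRN_1cos// integral_expRN//= addrC addKr.
Qed.

(** In [l], the kernel [l / (l ^ 2 + s ^ 2)] has the antiderivative
    [ln (l ^ 2 + s ^ 2) / 2], which diverges at infinity; the difference of two
    kernels has a constant sign and a convergent antiderivative, and the value at 0
    is the logarithm of the ratio. This is where the logarithm comes from. *)
Lemma integral_laplace_cos_diff s c : 0 < s -> 0 < c ->
  (\int[lam]_(l in `]0%R, +oo[)
    `|l / (l ^+ 2 + s ^+ 2) - l / (l ^+ 2 + c ^+ 2)|%:E = `|ln (s / c)|%:E)%E.
Proof.
wlog sc : s c / s <= c => [hw|] s0 c0.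
  have [sc|/ltW cs] := leP s c; first exact: hw.
  under eq_integral do rewrite distrC.
  by rewrite hw// -[s / c]invrK invf_div lnV ?normrN// posrE divr_gt0.
have D0 u (l : R) : 0 < u -> 0 < l ^+ 2 + u ^+ 2.
  by move=> u0; rewrite ltr_wpDl ?sqr_ge0// exprn_gt0.
pose f l := l / (l ^+ 2 + s ^+ 2) - l / (l ^+ 2 + c ^+ 2).
pose F l := 2^-1 * (ln (l ^+ 2 + s ^+ 2) - ln (l ^+ 2 + c ^+ 2)).
have f0 l : 0 <= l -> 0 <= f l.
  move=> l0; rewrite subr_ge0 ler_wpM2l// lef_pV2 ?posrE ?D0//.
  by rewrite lerD2l ler_sqr ?nnegrE// ltW.
transitivity (\int[lam]_(l in `]0%R, +oo[) (f l)%:E)%E.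
  apply: eq_integral => l; rewrite inE/= in_itv/= andbT => l0.
  by rewrite ger0_norm ?f0 ?ltW.
have dsq u (l : R) : is_derive l (1 : R) (fun l : R => l ^+ 2 + u ^+ 2) (2 * l).
  have := is_deriveD (is_deriveX 2 (is_derive_id l (1 : R)))
    (is_derive_cst (u ^+ 2) l (1 : R)).
  by rewrite /GRing.scale/= expr1 addr0 mulr1.
have dln u (l : R) : 0 < u -> is_derive l (1 : R) (fun l : R => ln (l ^+ 2 + u ^+ 2))
    ((l ^+ 2 + u ^+ 2)^-1 * (2 * l)).
  move=> u0.
  exact: (@is_derive1_comp _ (@ln R) (fun l => l ^+ 2 + u ^+ 2) l _ _
    (is_derive1_ln (D0 u l u0)) (dsq u l)).
have dF (l : R) : is_derive l (1 : R) F (f l).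
  have dM := is_deriveZ 2^-1 (is_deriveB (dln s l s0) (dln c l c0)).
  apply: (@is_derive_eq _ _ _ _ _ _ _ _ dM); rewrite /GRing.scale/= /f.
  by field; rewrite !gt_eqF ?D0.
have cf : continuous f.
  move=> l; apply: cvgB; (apply: cvgM; first exact: cvg_id); apply: cvgV;
    rewrite ?gt_eqF ?D0//; exact: is_derive_cvg (dsq _ l).
have FE l : F l = 2^-1 * ln (1 - (c ^+ 2 - s ^+ 2) / (l ^+ 2 + c ^+ 2)).
  rewrite /F -ln_div ?posrE ?D0//; congr (_ * ln _).
  by field; rewrite gt_eqF ?D0.
have F0 : F t @[t --> +oo] --> (0 : R).
  pose k := c ^+ 2 - s ^+ 2.
  have h0 : (l ^+ 2 + c ^+ 2)^-1 @[l --> +oo] --> (0 : R).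
    apply: (iffRL (@gtr0_cvgV0 _ _ _ _ (fun l : R => l ^+ 2 + c ^+ 2) _)).
      by apply: nearW => l; exact: D0.
    apply: (cvg_comp (fun l : R => l ^+ 2) (fun u => u + c ^+ 2)).
      exact: cvgr_expr2.
    exact: cvg_addrr.
  have h1 : 1 - k / (l ^+ 2 + c ^+ 2) @[l --> +oo] --> 1 - k * 0.
    by apply: cvgB; [exact: cvg_cst|apply: cvgM; [exact: cvg_cst|exact: h0]].
  rewrite mulr0 subr0 in h1.
  have h2 : ln (1 - k / (l ^+ 2 + c ^+ 2)) @[l --> +oo] --> ln (1 : R).
    exact: (cvg_comp _ _ h1 (continuous_ln ltr01)).
  rewrite ln1 in h2.
  have h3 : 2^-1 * ln (1 - k / (l ^+ 2 + c ^+ 2)) @[l --> +oo] --> 2^-1 * (0 : R).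
    by apply: cvgM; [exact: cvg_cst|exact: h2].
  by rewrite mulr0 in h3; under eq_fun do rewrite FE.
rewrite (ge0_FTC_half_line f0 dF cf F0) sub0r /F expr0n/= !add0r; congr EFin.
have -> : 2^-1 * (ln (s ^+ 2) - ln (c ^+ 2)) = ln (s / c).
  rewrite !lnXn// ln_div ?posrE//.
  by rewrite -mulrnBl -mulr_natl; field.
by rewrite ler0_norm// ln_le0// ler_pdivrMr// mul1r.
Qed.

End half_line.

(** * Continuity of translations in L^1 *)

Lemma ge0_cvge0P (R : realType) (a : nat -> \bar R) : (forall j, 0 <= a j)%E ->
  a @ \oo --> 0%E <->
  forall e : R, 0 < e -> \forall j \near \oo, (a j < e%:E)%E.
Proof.
move=> a0; split=> [/fine_cvgP[afin a_0] e e0|H].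
  have /cvgr0Pnorm_lt /(_ e e0) := a_0.
  apply: filterS2 afin => j aj /=.
  by rewrite ger0_norm ?fine_ge0// -lte_fin fineK.
apply/fine_cvgP; split.
  apply: filterS (H 1 ltr01) => j aj.
  by rewrite ge0_fin_numE// (lt_trans aj)// ltry.
apply/cvgr0Pnorm_lt => e e0; apply: filterS (H e e0) => j aj /=.
by rewrite ger0_norm ?fine_ge0// -lte_fin fineK// ge0_fin_numE// (lt_trans aj)// ltry.
Qed.

Section L1_translation.
Context {R : realType}.
Local Notation lam := (@lebesgue_measure R).
Local Notation r_ j := (j.+1%:R^-1 : R).
Implicit Types (u v g : R -> R) (h : R).

(** The L^1 modulus of continuity. Its limit is taken along the steps [h / (j + 1)],
    since dominated convergence is about sequences. *)
Let omega u h := (\int[lam]_a `|u a - u (a + h)|%:E)%E.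

Let omega_ge0 u h : (0 <= omega u h)%E.
Proof. by apply: integral_ge0 => a _; rewrite lee_fin. Qed.

Let measurable_shift u h : measurable_fun setT u ->
  measurable_fun setT (fun a : R => u (a + h)).
Proof.
by move=> mu; apply: (measurableT_comp mu); exact: measurable_funD.
Qed.

Let measurable_normB u v : measurable_fun setT u -> measurable_fun setT v ->
  measurable_fun setT (fun a : R => `|u a - v a|%:E).
Proof.
move=> mu mv; apply/measurable_EFinP; apply: measurableT_comp => //.
exact: measurable_funB.
Qed.

Let integral_shift u h : measurable_fun setT u -> (forall a, 0 <= u a) ->
  (\int[lam]_a (u (a + h))%:E = \int[lam]_a (u a)%:E)%E.
Proof.
move=> mu u0.
apply: (@ge0_integral_translate1 R h (EFin \o u)).
- exact/measurable_EFinP.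
- by move=> a; rewrite lee_fin.
Qed.

Let omega_le u v h : measurable_fun setT u -> measurable_fun setT v ->
  (omega u h <= omega v h + 2%:E * \int[lam]_a `|u a - v a|%:E)%E.
Proof.
move=> mu mv.
have mD : measurable_fun setT (fun a => `|u a - v a|).
  by apply: measurableT_comp => //; exact: measurable_funB.
have -> : (2%:E * \int[lam]_a `|u a - v a|%:E =
    \int[lam]_a `|u a - v a|%:E + \int[lam]_a `|u (a + h)%R - v (a + h)%R|%:E)%E.
  rewrite (integral_shift (u := fun a => `|u a - v a|) h)//.
  by rewrite -[2%:E]/((1 + 1)%:E)%E EFinD ge0_muleDl// mul1e.
have m1 := measurable_normB mu mv.
have m2 := measurable_normB mv (measurable_shift h mv).
have m3 := measurable_normB (measurable_shift h mu) (measurable_shift h mv).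
rewrite /omega -ge0_integralD// -ge0_integralD//.
- apply: ge0_le_integral => //.
  + exact: (measurable_normB mu (measurable_shift h mu)).
  + by do !apply: emeasurable_funD.
  move=> a _; rewrite -!EFinD lee_fin.
  have -> : u a - u (a + h) = (v a - v (a + h)) +
     ((u a - v a) - (u (a + h) - v (a + h))) by ring.
  by rewrite (le_trans (ler_normD _ _))// lerD2l (le_trans (ler_normB _ _)).
- by move=> a _; rewrite adde_ge0.
- exact: emeasurable_funD.
Qed.

(** The modulus of [u] differs from that of [v] by at most twice the L^1 distance
    of [u] and [v], so the property passes to L^1 limits. *)
Let omega_closed u h : measurable_fun setT u ->
  (forall e : R, 0 < e -> exists v : R -> R, [/\ measurable_fun setT v,
     omega v (r_ j * h) @[j --> \oo] --> 0%E &
     (\int[lam]_a `|u a - v a|%:E <= e%:E)%E]) ->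
  omega u (r_ j * h) @[j --> \oo] --> 0%E.
Proof.
move=> mu H; apply/ge0_cvge0P => [j|e e0]; first exact: omega_ge0.
have e3 : 0 < e / 3 by rewrite divr_gt0.
have [v [mv v0 uv]] := H _ e3.
have /ge0_cvge0P /(_ _ e3) := v0; move=> /(_ (fun
    j => omega_ge0 v (r_ j * h))).
apply: filterS => j vj; rewrite (le_lt_trans (omega_le _ mu mv))//.
have -> : e%:E = ((e / 3)%:E + 2%:E * (e / 3)%:E)%E.
  by rewrite -EFinM -EFinD; congr EFin; field.
have uv2 : (2%:E * \int[lam]_a `|u a - v a|%:E <= 2%:E * (e / 3)%:E)%E.
  by rewrite lee_wpmul2l ?lee_fin.
apply: lte_leD => //; rewrite ge0_fin_numE ?mule_ge0 ?integral_ge0//.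
by rewrite (le_lt_trans uv2)// -EFinM ltry.
Qed.

(** Dominated convergence: a continuous function with bounded support is bounded,
    and all the translates considered vanish outside one bounded interval. *)
Let omega_cont v h (M : R) : continuous v -> (forall a, M < `|a| -> v a = 0) ->
  omega v (r_ j * h) @[j --> \oo] --> 0%E.
Proof.
move=> cv v0.
have mv : measurable_fun setT v by exact: continuous_measurable_fun.
have [B vB] : exists B, forall a, `|v a| <= B.
  have [M0|M0] := ltP M 0.
    by exists 0 => a; rewrite v0 ?normr0// (lt_le_trans M0).
  have [c _ cB] : exists2 c, c \in `[- M, M] & forall t, t \in `[- M, M] ->
      `|v t| <= `|v c|.
    apply: (@EVT_max _ (fun a => `|v a|)); first by rewrite ge0_cp.
    apply: continuous_subspaceT => a.
    by apply: (@continuous_comp _ _ _ v (fun y => `|y|)); [exact: cv|exact: norm_continuous].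
  exists `|v c| => a; have [aM|Ma] := leP `|a| M; last by rewrite v0 ?normr0.
  by apply: cB; rewrite in_itv/= -ler_norml.
pose K := `[- (M + `|h|), M + `|h|]%classic : set R.
pose G a := (2 * B * \1_K a)%:E.
have B0 : 0 <= B by rewrite (le_trans _ (vB 0)).
rewrite -[X in _ @ _ --> X](_ : \int[lam]_a cst 0%E a = 0)%E; last exact: integral0.
apply: (@dominated_cvg _ _ _ lam setT measurableT _ (cst 0%E) G).
- by move=> j; exact: measurable_normB mv (measurable_shift _ mv).
- move=> a _; have ra : a + r_ j * h @[j --> \oo] --> a + 0 * h.
    apply: cvgD; first exact: cvg_cst.
    by apply: cvgM; [exact: cvg_harmonic|exact: cvg_cst].
  rewrite mul0r addr0 in ra.
  have va : `|v a - v (a + r_ j * h)| @[j --> \oo] --> `|v a - v a|.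
    by apply: cvg_norm; apply: cvgB; [exact: cvg_cst|exact: (cvg_comp _ _ ra (cv a))].
  rewrite subrr normr0 in va.
  by apply: cvg_EFin; first exact: nearW.
- by [].
- apply: (@integrableZl _ _ _ lam setT measurableT (2 * B) (EFin \o \1_K)).
  by have := @integrable_indic_itv R (- (M + `|h|)) (M + `|h|) true false.
- move=> j a _; rewrite gee0_abs ?lee_fin// /G indicE.
  have rh : `|r_ j * h| <= `|h|.
    by rewrite normrM ger0_norm ?invr_ge0// ler_piMl// invf_le1// ler1n.
  case: (boolP (a \in K)) => [_|aK].
    by rewrite mulr1 (le_trans (ler_normB _ _))// mulr2n mulrDl mul1r lerD.
  have {aK}Ma : M + `|h| < `|a|.
    move: aK; apply: contraNT; rewrite -leNgt ler_norml => aM.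
    by apply/mem_set; rewrite /K/= in_itv/=.
  rewrite mulr0 (v0 a) ?(v0 (a + _)) ?subrr ?normr0//.
    rewrite -(addrK (r_ j * h) a) in Ma.
    by have := lt_le_trans Ma (ler_normB _ _); move: rh; lra.
  by have := normr_ge0 h; lra.
Qed.

(** Continuous, equal to 1 on [[-N, N]] and to 0 outside of [[-(N + 1), N + 1]]. *)
Let cutoff (N : nat) (a : R) : R := Num.max 0 (Num.min 1 (N.+1%:R - `|a|)).

Let cutoff_ge0 N a : 0 <= cutoff N a.
Proof. by rewrite le_max lexx. Qed.

Let cutoff_le1 N a : cutoff N a <= 1.
Proof. by rewrite ge_max ler01 ge_min lexx. Qed.

Let cutoff1 N a : `|a| <= N%:R -> cutoff N a = 1.
Proof.
move=> aN; rewrite /cutoff min_l ?max_r//.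
by rewrite lerBrDr -natr1 addrC lerD2r.
Qed.

Let cutoff0 N a : N.+1%:R < `|a| -> cutoff N a = 0.
Proof.
move=> aN; apply: max_l; rewrite ge_min; apply/orP; right.
by rewrite subr_le0 ltW.
Qed.

Let continuous_cutoff N : continuous (cutoff N).
Proof.
move=> a; pose l (a : R) := N.+1%:R - `|a|.
apply: (@continuous_max _ _ (cst 0) (cst 1 \min l)); first exact: cvg_cst.
apply: (@continuous_min _ _ (cst 1) l); first exact: cvg_cst.
by apply: cvgB; [exact: cvg_cst|exact: norm_continuous].
Qed.

Let cvg_cutoff u : lam.-integrable setT (EFin \o u) ->
  (\int[lam]_a (`|u a| * (1 - cutoff N a))%:E)%E @[N --> \oo] --> 0%E.
Proof.
move=> iu; have /integrableP[/measurable_EFinP mu _] := iu.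
rewrite -[X in _ @ _ --> X](_ : \int[lam]_a cst 0%E a = 0)%E; last exact: integral0.
apply: (@dominated_cvg _ _ _ lam setT measurableT _ (cst 0%E) (fun a => `|u a|%:E)).
- move=> N; apply/measurable_EFinP; apply: measurable_funM.
    exact: measurableT_comp.
  apply: measurable_funB => //.
  by apply: continuous_measurable_fun; exact: continuous_cutoff.
- move=> a _; apply: cvg_near_cst.
  exists (Num.truncn `|a|).+1 => // N /= aN.
  rewrite cutoff1 ?subrr ?mulr0//.
  have /andP[_ /ltW] := truncn_itv (normr_ge0 a).
  by move=> /le_trans; apply; rewrite ler_nat.
- by [].
- exact: integrable_norm.
- move=> N a _; rewrite gee0_abs ?lee_fin ?mulr_ge0 ?subr_ge0//.
  by rewrite ler_piMr// lerBlDr lerDl.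
Qed.

(** Density of the continuous functions with bounded support: continuous functions are
    dense in L^1 of a set of finite measure, so [u] is approximated on a bounded
    interval, and the approximation is multiplied by a cutoff. *)
Lemma L1_translation_line u h : lam.-integrable setT (EFin \o u) ->
  (\int[lam]_a `|u a - u (a + r_ j * h)|%:E)%E @[j --> \oo] --> 0%E.
Proof.
move=> iu; have /integrableP[/measurable_EFinP mu _] := iu.
apply: omega_closed => // e e0; have e2 : 0 < e / 2 by rewrite divr_gt0.
have tail_ge0 N : (0 <= \int[lam]_a (`|u a| * (1 - cutoff N a))%:E)%E.
  by apply: integral_ge0 => a _; rewrite lee_fin mulr_ge0// subr_ge0.
have /(ge0_cvge0P tail_ge0)/(_ _ e2)[N _ /(_ _ (leqnn N)) tN] := cvg_cutoff iu.
pose i := `[- N.+1%:R, N.+1%:R] : interval R.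
pose E := [set` i].
have mE : measurable E by exact: measurable_itv.
have [||g [cg ig g0]] := @approximation_continuous_integrable R E u mE.
- apply: (@le_lt_trans _ _ (lebesgue_measure ([set` i] : set R))) => //.
  rewrite lebesgue_measure_itv; by case: ifPn => // _; rewrite -EFinB ltry.
- exact: integrableS iu.
have dist_ge0 k : (0 <= \int[lam]_(a in E) `|(u a - g k a)%:E|)%E by exact: integral_ge0.
have /(ge0_cvge0P dist_ge0)/(_ _ e2)[k _ /(_ _ (leqnn k)) gk] := g0.
pose v a := g k a * cutoff N a.
have cv : continuous v.
  by move=> a; apply: cvgM; [exact: cg|exact: continuous_cutoff].
have mv : measurable_fun setT v by exact: continuous_measurable_fun.
exists v; split => //.
  by apply: (@omega_cont v h N.+1%:R) => // a Na; rewrite /v cutoff0// mulr0.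
rewrite [e]splitr EFinD (le_trans _ (leeD (ltW gk) (ltW tN)))//.
have m1 : measurable_fun setT ((fun a => `|(u a - g k a)%:E|%E) \_ E).
  apply/(measurable_restrictT _ mE)/measurable_funTS.
  apply: (measurable_normB mu); exact: continuous_measurable_fun.
have m2 : measurable_fun setT (fun a => (`|u a| * (1 - cutoff N a))%:E).
  apply/measurable_EFinP; apply: measurable_funM; first exact: measurableT_comp.
  apply: measurable_funB => //.
  by apply: continuous_measurable_fun; exact: continuous_cutoff.
rewrite [X in (_ <= X + _)%E]integral_mkcond -ge0_integralD//.
- apply: ge0_le_integral => //.
  + exact: measurable_normB.
  + exact: emeasurable_funD.
  move=> a _; rewrite patchE; case: (boolP (a \in E)) => [_|aE].
    rewrite abse_EFin -EFinD lee_fin /v.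
    have -> : u a - g k a * cutoff N a =
      (u a - g k a) * cutoff N a + u a * (1 - cutoff N a) by ring.
    rewrite (le_trans (ler_normD _ _))// !normrM (ger0_norm (cutoff_ge0 N a)).
    have -> : `|1 - cutoff N a| = 1 - cutoff N a by rewrite ger0_norm// subr_ge0.
    by rewrite lerD2r ler_piMr.
  rewrite add0e lee_fin /v cutoff0 ?mulr0 ?subr0 ?mulr1//.
  move: aE; apply: contraNT; rewrite -leNgt ler_norml => aN.
  by apply/mem_set; rewrite /E/= in_itv/=.
- by move=> a _; exact: erestrict_ge0.
- by move=> a _; rewrite lee_fin mulr_ge0// subr_ge0.
Qed.

End L1_translation.

Lemma dominated_cvg0 d (T : measurableType d) (R : realType)
    (m : {measure set T -> \bar R}) (f : nat -> T -> \bar R) (g : T -> \bar R) :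
  (forall j, measurable_fun setT (f j)) -> m.-integrable setT g ->
  (forall j t, 0 <= f j t <= g t)%E ->
  {ae m, forall t, f^~ t @ \oo --> 0%E} ->
  (\int[m]_t f j t)%E @[j --> \oo] --> 0%E.
Proof.
move=> mf ig fg f0.
have [_ _] : [/\ m.-integrable setT (cst 0%E : T -> \bar R),
    [sequence \int[m]_(x in setT) `|f n x - cst 0 x|]_n%E @ \oo --> 0%E &
    [sequence \int[m]_(x in setT) (f n x)]_n%E @ \oo --> (\int[m]_(x in setT) (cst 0 x))%E].
  apply: (@dominated_convergence _ _ _ m setT measurableT f (cst 0%E) g) => //.
  - by apply: filterS f0 => t ft _.
  - apply: aeW => t j _; have /andP[f0' fg'] := fg j t.
    by rewrite gee0_abs.
by rewrite integral0.
Qed.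

Lemma integral_normB_le d (T : measurableType d) (R : realType)
    (m : {measure set T -> \bar R}) (f g : T -> R) :
  measurable_fun setT f -> measurable_fun setT g ->
  (\int[m]_t `|f t - g t|%:E <=
   \int[m]_t `|f t|%:E + \int[m]_t `|g t|%:E)%E.
Proof.
move=> mf mg.
have mn (k : T -> R) : measurable_fun setT k -> measurable_fun setT (fun t => `|k t|%:E).
  by move=> mk; apply/measurable_EFinP; exact: measurableT_comp.
rewrite -ge0_integralD//; [|exact: mn|exact: mn].
apply: ge0_le_integral => //.
- by apply: mn; exact: measurable_funB.
- by apply: emeasurable_funD; exact: mn.
- by move=> t _; rewrite -EFinD lee_fin ler_normB.
Qed.

(** Induction on the dimension: by moving the first coordinate and the others
    separately, the modulus is at most the sum of the integrals of the moduli [B j]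
    and [A j] of the sections of [u]. Almost every section is integrable, so that its
    modulus tends to 0, and the modulus of a section is at most twice its norm:
    dominated convergence applies. *)
Lemma L1_translation (R : realType) n (u : 'rV[R]_n -> R) (h : 'rV[R]_n) :
  (lebesgue_rV n).-integrable setT (EFin \o u) ->
  (\int[lebesgue_rV n]_x `|u x - u (x + j.+1%:R^-1 *: h)|%:E)%E @[j --> \oo]
    --> 0%E.
Proof.
elim: n u h => [|n IHn] u h iu.
  rewrite (_ : (fun _ => _) = cst 0%E); first exact: cvg_cst.
  apply/funext => j; apply: integral0_eq => x _.
  rewrite (_ : x + _ = x) ?subrr ?normr0//.
  by apply/rowP => -[].
have /integrableP[/measurable_EFinP mu _] := iu.
have mc := @measurable_consmx R n.
pose lam := @lebesgue_measure R.
pose m := @lebesgue_rV R n.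
pose U (z : R * 'rV[R]_n) := u (consmx z).
have mU : measurable_fun setT U by exact: measurableT_comp mu mc.
pose h0 := h ord0 ord0; pose h' : 'rV[R]_n := \row_j h ord0 (lift ord0 j).
have mUaff (b : R) (k : 'rV[R]_n) :
    measurable_fun setT (fun z : R * 'rV[R]_n => U (z.1 + b, z.2 + k)).
  apply: (measurableT_comp mU); apply: measurable_fun_pair.
    by apply: measurable_funD => //; exact: measurable_fst.
  by apply: measurable_rVD => //; exact: measurable_snd.
have absU : (\int[lam]_a \int[m]_x `|U (a, x)|%:E < +oo)%E.
  have /integrableP[_] := iu; rewrite ge0_integral_rVS//.
  by apply/measurable_EFinP; exact: measurableT_comp.
have mabsU : measurable_fun setT (fun z : R * 'rV[R]_n => `|U z|%:E).
  by apply/measurable_EFinP; exact: measurableT_comp.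
pose A (j : nat) a := (\int[m]_x `|U (a, x) - U (a, (x + j.+1%:R^-1 *: h')%R)|%:E)%E.
pose B (j : nat) x := (\int[lam]_a `|U (a, x) - U ((a + j.+1%:R^-1 * h0)%R, x)|%:E)%E.
have mUx a : measurable_fun setT (fun x : 'rV[R]_n => U (a, x)).
  by apply: (measurableT_comp mU).
have mUa x : measurable_fun setT (fun a : R => U (a, x)).
  by apply: (measurableT_comp mU).
have normr_EFin (k : R * 'rV[R]_n -> R) : measurable_fun setT k ->
    measurable_fun setT (fun z => `|k z|%:E).
  by move=> mk; apply/measurable_EFinP; exact: measurableT_comp.
have mD b k b' k' : measurable_fun setT (fun z : R * 'rV[R]_n =>
    `|U (z.1 + b, z.2 + k) - U (z.1 + b', z.2 + k')|%:E).
  by apply: normr_EFin; exact: measurable_funB.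
have mA j : measurable_fun setT (A j).
  rewrite [X in measurable_fun _ X](_ : _ = fubini_F m (fun z : R * 'rV[R]_n =>
    `|U (z.1 + 0, z.2 + 0) - U (z.1 + 0, z.2 + j.+1%:R^-1 *: h')|%:E)).
    apply: measurable_fun_fubini_tonelli_F; first exact: mD.
    by move=> z; rewrite lee_fin.
  by apply/funext => a; apply: eq_integral => x _ /=; rewrite !addr0.
have mB j : measurable_fun setT (B j).
  rewrite [X in measurable_fun _ X](_ : _ = fubini_G lam (fun z : R * 'rV[R]_n =>
    `|U (z.1 + 0, z.2 + 0) - U (z.1 + j.+1%:R^-1 * h0, z.2 + 0)|%:E)).
    apply: measurable_fun_fubini_tonelli_G; first exact: mD.
    by move=> z; rewrite lee_fin.
  by apply/funext => x; apply: eq_integral => a _ /=; rewrite !addr0.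
have shiftx a k : (\int[m]_x `|U (a, (x + k)%R)|%:E = \int[m]_x `|U (a, x)|%:E)%E.
  have mUx' : measurable_fun setT (fun x : 'rV[R]_n => `|U (a, x)|%:E).
    by apply/measurable_EFinP; apply: measurableT_comp.
  exact: (ge0_integral_translate k mUx' (fun x => abse_ge0 (U (a, x))%:E)).
have mUab b x : measurable_fun setT (fun a : R => U (a + b, x)).
  by apply: (measurableT_comp (mUa x)); exact: measurable_funD.
have shifta x b : (\int[lam]_a `|U ((a + b)%R, x)|%:E = \int[lam]_a `|U (a, x)|%:E)%E.
  have mUa' : measurable_fun setT (fun a : R => `|U (a, x)|%:E).
    by apply/measurable_EFinP; apply: measurableT_comp.
  exact: (ge0_integral_translate1 b mUa' (fun a => abse_ge0 (U (a, x))%:E)).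
have iU : (lam \x m)%E.-integrable setT (EFin \o U).
  by apply/integrable12ltyP => //; exact/measurable_EFinP.
have A0 : (\int[lam]_a A j a)%E @[j --> \oo] --> 0%E.
  apply: (@dominated_cvg0 _ _ _ lam A (fun a => 2%:E * \int[m]_x `|U (a, x)|%:E)%E) => //.
  - by apply: integrableZl => //; exact: (integrable_fubini_F (integrable_abse iU)).
  - move=> j a; rewrite integral_ge0//= (le_trans (integral_normB_le _ _ _))//.
      by apply: (measurableT_comp (mUx a)); exact: measurable_rVD.
    by rewrite shiftx -[2%:E]/((1 + 1)%:E)%E EFinD ge0_muleDl// mul1e.
  - have := ae_integrable1 iU; apply: filterS => a iUa.
    exact: (IHn (fun x => U (a, x)) h' iUa).
have B0 : (\int[m]_x B j x)%E @[j --> \oo] --> 0%E.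
  apply: (@dominated_cvg0 _ _ _ m B (fun x => 2%:E * \int[lam]_a `|U (a, x)|%:E)%E) => //.
  - apply: integrableZl => //; apply/integrableP; split.
      by apply: (@measurable_fun_fubini_tonelli_G _ _ _ _ _ lam (fun z => `|U z|%:E)).
    under eq_integral do rewrite gee0_abs ?integral_ge0//.
    by apply/(@integrable21ltyP _ _ _ _ R lam m (EFin \o U)) => //; exact/measurable_EFinP.
  - move=> j x; rewrite integral_ge0//=.
    apply: (le_trans (@integral_normB_le _ _ R lam _ _ (mUa x) (mUab _ x))).
    by rewrite shifta -[2%:E]/((1 + 1)%:E)%E EFinD ge0_muleDl// mul1e.
  - have := ae_integrable2 iU; apply: filterS => x iUx.
    exact: (@L1_translation_line R (fun a => U (a, x)) h0 iUx).
have AB0 : (\int[lam]_a A j a + \int[m]_x B j x)%E @[j --> \oo] --> (0 + 0)%E.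
  exact: cvgeD.
rewrite adde0 in AB0.
apply: (@squeeze_cvge _ _ _ _ (cst 0%E) _ _ _ _ _ AB0); last exact: cvg_cst.
apply: nearW => j; rewrite integral_ge0//=.
pose C (z : R * 'rV[R]_n) := `|U (z.1, z.2) - U (z.1 + j.+1%:R^-1 * h0, z.2)|%:E.
have mC : measurable_fun setT C.
  have := mD 0 0 (j.+1%:R^-1 * h0) 0; congr measurable_fun.
  by apply/funext => z; rewrite !addr0.
have -> : (\int[m]_x B j x = \int[m]_x \int[lam]_a C (a, x))%E by [].
rewrite -(@fubini_tonelli _ _ _ _ R lam m C mC); last by move=> z; rewrite lee_fin.
(* the step in the first coordinate is measured at the translated point *)
have CE a : (\int[m]_x C (a, x) = \int[m]_x C (a, (x + j.+1%:R^-1 *: h')%R))%E.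
  have mCa : measurable_fun setT (fun x : 'rV[R]_n => C (a, x)).
    by apply: (measurableT_comp mC).
  by rewrite (ge0_integral_translate _ mCa)// => x; rewrite lee_fin.
under [X in (_ <= _ + X)%E]eq_integral do rewrite CE.
have mC' : measurable_fun setT (fun z : R * 'rV[R]_n => C (z.1, z.2 + j.+1%:R^-1 *: h')).
  apply: (measurableT_comp mC); apply: measurable_fun_pair; first exact: measurable_fst.
  by apply: measurable_rVD => //; exact: measurable_snd.
pose C' a := (\int[m]_x C (a, (x + j.+1%:R^-1 *: h')%R))%E.
have C0 z : (0 <= C z)%E by rewrite lee_fin.
have C'0 a : setT a -> (0 <= C' a)%E.
  by move=> _; apply: integral_ge0 => x _; exact: C0.
have A0' a : setT a -> (0 <= A j a)%E by move=> _; exact: integral_ge0.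
have mC'' : measurable_fun setT C'.
  exact: (@measurable_fun_fubini_tonelli_F _ _ _ _ _ m
    (fun z : R * 'rV[R]_n => C (z.1, z.2 + j.+1%:R^-1 *: h')) mC').
rewrite -(@ge0_integralD _ _ R lam setT measurableT (A j) C')//; last exact: (mA j).
have mG : measurable_fun setT (fun x => u x - u (x + j.+1%:R^-1 *: h)).
  apply: measurable_funB => //; apply: (measurableT_comp mu).
  exact: measurable_rVD.
rewrite ge0_integral_rVS//; last first.
  by apply/measurable_EFinP; exact: measurableT_comp.
have consD a x : consmx (a, x) + j.+1%:R^-1 *: h =
    consmx (a + j.+1%:R^-1 * h0, x + j.+1%:R^-1 *: h').
  apply/rowP => i; rewrite !mxE.
  by have [k ->|->] := unliftP ord0 i; rewrite ?liftK ?unlift_none/= ?mxE.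
have mGc : measurable_fun setT (fun z : R * 'rV[R]_n =>
    `|u (consmx z) - u (consmx z + j.+1%:R^-1 *: h)|%:E).
  by apply: normr_EFin; exact: (measurableT_comp mG mc).
apply: ge0_le_integral => //.
- by move=> a _; exact: integral_ge0.
- exact: (@measurable_fun_fubini_tonelli_F _ _ _ _ _ m _ mGc).
- exact: (emeasurable_funD (mA j) mC'').
have mx (k : R * 'rV[R]_n -> \bar R) a : measurable_fun setT k ->
    measurable_fun setT (fun x : 'rV[R]_n => k (a, x)).
  by move=> mk; apply: (measurableT_comp mk); exact: measurable_fun_pair.
have mA1 a : measurable_fun setT (fun x : 'rV[R]_n =>
    `|U (a, x) - U (a, x + j.+1%:R^-1 *: h')|%:E).
  by have := mx _ a (mD 0 0 0 (j.+1%:R^-1 *: h')); under eq_fun do rewrite /= !addr0.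
move=> a _; rewrite -(@ge0_integralD _ _ R m)//; last exact: (mx _ a mC').
apply: ge0_le_integral => //.
- exact: (mx _ a mGc).
- by apply: emeasurable_funD => //; exact: (mx _ a mC').
move=> x _; rewrite consD -EFinD lee_fin -/(U _) -/(U _).
by rewrite (le_trans _ (ler_normD _ _))// addrA subrK.
Qed.

(** * The Abel weight and the Poisson kernel *)

Section poisson_kernel.
Context {R : realType}.
Local Notation lam := (@lebesgue_measure R).

(** A summation weight for the Fourier integral. The l^1 norm, unlike the
    Euclidean one, makes it and its transform products of functions of one
    variable. *)
Definition abel_weight n (xi : 'rV[R]_n) : R := expR (- \sum_i `|xi ord0 i|).

Definition poisson_kernel n (h : 'rV[R]_n) : R :=
  \prod_i (2 / (1 + h ord0 i ^+ 2)).

Let integralT_even (f : R -> R) (r : R) : (forall a, 0 <= f a) -> continuous f ->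
  (forall a, f (- a) = f a) ->
  (\int[lam]_(a in `]0%R, +oo[) (f a)%:E = r%:E)%E ->
  (\int[lam]_a (f a)%:E = (2 * r)%:E)%E.
Proof.
move=> f0 cf fe fr; rewrite ge0_symfun_integralT//; last by move=> a /=; rewrite fe.
rewrite EFinM; congr (_ * _)%E; rewrite -fr integral_itv_obnd_cbnd.
  by rewrite set_itvcy.
apply/measurable_EFinP; apply: measurable_funTS.
exact: continuous_measurable_fun.
Qed.

Let continuous_expRNn : continuous (fun a : R => expR (- `|a|)).
Proof.
move=> a; have h : - `|x| @[x --> a] --> - `|a|.
  by apply: cvgN; exact: norm_continuous.
exact: (cvg_comp _ _ h (@continuous_expR _ _)).
Qed.

Let measurable_expRNn : measurable_fun setT (fun a : R => expR (- `|a|)).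
Proof. exact: continuous_measurable_fun continuous_expRNn. Qed.

Let integral_expRNn : (\int[lam]_a (expR (- `|a|))%:E = (2 * 1^-1)%:E)%E.
Proof.
apply: (integralT_even (fun a => expR_ge0 (- `|a|)) continuous_expRNn).
  by move=> a; rewrite normrN.
rewrite -(integral_expRN ltr01); apply: eq_integral => a.
by rewrite inE/= in_itv/= andbT => a0; rewrite gtr0_norm// mul1r.
Qed.

Let integrable_expRNn : lam.-integrable setT (EFin \o (fun a : R => expR (- `|a|))).
Proof.
apply: ge0_integrable => //.
by rewrite integral_expRNn ltry.
Qed.

Let integrable_expRNn_cos b :
  lam.-integrable setT (EFin \o (fun a : R => expR (- `|a|) * cos (a * b))).
Proof.
apply: le_integrable integrable_expRNn => //.
  apply/measurable_EFinP; apply: measurable_funM => //; exact: measurable_cos_mul.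
by move=> a _; rewrite lee_fin normrM ler_piMr// ler_norml cos_le1 cos_geN1.
Qed.

Let Rintegral_expRNn_cos b :
  \int[lam]_a (expR (- `|a|) * cos (a * b)) = 2 / (1 + b ^+ 2).
Proof.
pose g (a : R) := expR (- `|a|) * (1 + cos (a * b)).
have g0 a : 0 <= g a.
  by rewrite mulr_ge0 ?expR_ge0// -(subrr 1) addrC -opprB opprK lerD2l cos_geN1.
have cg : continuous g.
  move=> a; apply: cvgM; first exact: continuous_expRNn.
  apply: cvgD; first exact: cvg_cst.
  have h : x * b @[x --> a] --> a * b by apply: cvgM; [exact: cvg_id|exact: cvg_cst].
  exact: (cvg_comp _ _ h (@continuous_cos _ _)).
have gE : (\int[lam]_a (g a)%:E = (2 * (1^-1 + 1 / (1 ^+ 2 + b ^+ 2)))%:E)%E.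
  apply: (integralT_even g0 cg).
    by move=> a; rewrite /g normrN mulNr cosN.
  rewrite -(integral_expRN_1cos b ltr01); apply: eq_integral => a.
  by rewrite inE/= in_itv/= andbT => a0; rewrite /g gtr0_norm// mul1r.
have ig : lam.-integrable setT (EFin \o g).
  apply: ge0_integrable => //; first exact: continuous_measurable_fun.
  by rewrite gE ltry.
have E a : expR (- `|a|) * cos (a * b) = g a - expR (- `|a|).
  by rewrite /g mulrDr mulr1 addrC addKr.
under eq_Rintegral do rewrite E.
rewrite RintegralB// /Rintegral gE integral_expRNn/= -mulrBr addrC addKr.
by rewrite expr1n mul1r.
Qed.

Let cauchy_ge0 (b : R) : 0 <= 2 / (1 + b ^+ 2).
Proof. by rewrite divr_ge0// addr_ge0 ?sqr_ge0. Qed.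

Let continuous_cauchy : continuous (fun b : R => 2 / (1 + b ^+ 2)).
Proof.
by move=> b; apply: cvgM; [exact: cvg_cst|exact: continuous_oneDsqrV].
Qed.

Let integral_cauchy :
  (\int[lam]_b (2 / (1 + b ^+ 2))%:E = (2 * (2 * (pi / 2)))%:E :> \bar R)%E.
Proof.
apply: (integralT_even cauchy_ge0 continuous_cauchy).
  by move=> a; rewrite sqrrN.
rewrite integral_itv_obnd_cbnd; last first.
  apply/measurable_EFinP; apply: measurable_funTS.
  exact: continuous_measurable_fun.
rewrite EFinM -integral0y_oneDsqr -ge0_integralZl_EFin//.
apply/measurable_EFinP; apply: measurable_funTS.
by apply: continuous_measurable_fun; exact: continuous_oneDsqrV.
Qed.

Let integrable_cauchy : lam.-integrable setT (EFin \o (fun b : R => 2 / (1 + b ^+ 2))).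
Proof.
apply: ge0_integrable => //; first exact: continuous_measurable_fun.
by rewrite integral_cauchy ltry.
Qed.

Lemma measurable_sin : measurable_fun setT (@sin R).
Proof. by apply: continuous_measurable_fun; exact: continuous_sin. Qed.

Lemma measurable_cos : measurable_fun setT (@cos R).
Proof. by apply: continuous_measurable_fun; exact: continuous_cos. Qed.

Lemma measurable_abel_weight n : measurable_fun setT (@abel_weight n).
Proof.
apply: measurableT_comp => //; apply: measurable_funN.
apply: measurable_sum => i; apply: measurableT_comp => //.
exact: measurable_coef.
Qed.

Lemma measurable_poisson_kernel n : measurable_fun setT (@poisson_kernel n).
Proof.
apply: measurable_prod => i _.
apply: (measurableT_comp (continuous_measurable_fun continuous_cauchy)).
exact: measurable_coef.
Qed.

Lemma poisson_kernel_ge0 n h : 0 <= @poisson_kernel n h.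
Proof.
by apply: prodr_ge0 => i _; rewrite divr_ge0// addr_ge0 ?sqr_ge0.
Qed.

Let abel_weight_cons n a x : @abel_weight n.+1 (consmx (a, x)) =
  expR (- `|a|) * abel_weight x.
Proof.
rewrite /abel_weight big_ord_recl consmx0 opprD expRD; congr (_ * expR (- _)).
by apply: eq_bigr => i _; rewrite consmxS.
Qed.

Let poisson_kernel_cons n a x : @poisson_kernel n.+1 (consmx (a, x)) =
  2 / (1 + a ^+ 2) * poisson_kernel x.
Proof.
rewrite /poisson_kernel big_ord_recl consmx0; congr (_ * _).
by apply: eq_bigr => i _; rewrite consmxS.
Qed.

Let integral_rV0 (f : 'rV[R]_0 -> \bar R) :
  (\int[lebesgue_rV 0]_x f x = f 0%R)%E.
Proof.
rewrite (eq_integral (cst (f 0))) => [|x _]; last by congr f; apply/rowP => -[].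
by rewrite integral_cst//= diracT mule1.
Qed.

Let integrable_rV0 (f : 'rV[R]_0 -> R) : measurable_fun setT f ->
  (lebesgue_rV 0).-integrable setT (EFin \o f).
Proof.
move=> mf; apply/integrableP; split; first exact/measurable_EFinP.
by rewrite integral_rV0 /= ltry.
Qed.

Lemma integrable_abel_weight n :
  (lebesgue_rV n).-integrable setT (EFin \o @abel_weight n).
Proof.
have mw := @measurable_abel_weight.
elim: n => [|n IHn]; first exact: integrable_rV0.
apply: integrable_rVS => //.
rewrite [X in integrable _ _ X](_ : _ =
    EFin \o (fun z : R * _ => expR (- `|z.1|) * abel_weight z.2)).
  exact: (@integrable_prodM _ _ _ _ R lam (lebesgue_rV n) _ _
    integrable_expRNn IHn).
by apply/funext => -[a x] /=; rewrite abel_weight_cons.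
Qed.

Let integrable_Rintegral_poisson_kernel n :
  (lebesgue_rV n).-integrable setT (EFin \o @poisson_kernel n) /\
  \int[lebesgue_rV n]_h poisson_kernel h = (2 * pi) ^+ n.
Proof.
have mK := @measurable_poisson_kernel.
elim: n => [|n [iK IHn]].
  split; first exact: integrable_rV0.
  by rewrite /Rintegral integral_rV0/= /poisson_kernel big_ord0.
have KE : @poisson_kernel n.+1 \o @consmx R n =
    fun z => 2 / (1 + z.1 ^+ 2) * poisson_kernel z.2.
  by apply/funext => -[a x] /=; rewrite poisson_kernel_cons.
have iKc : (lam \x lebesgue_rV n)%E.-integrable setT
    (EFin \o (@poisson_kernel n.+1 \o @consmx R n)).
  by rewrite KE; exact: (@integrable_prodM _ _ _ _ R lam (lebesgue_rV n) _ _
    integrable_cauchy iK).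
split; first exact: integrable_rVS.
rewrite Rintegral_rVS//.
transitivity (\int[(lam \x lebesgue_rV n)%E]_z
    (2 / (1 + z.1 ^+ 2) * poisson_kernel z.2)).
  apply: eq_Rintegral => z _.
  by rewrite -[LHS]/((@poisson_kernel n.+1 \o @consmx R n) z) KE.
rewrite (@Rintegral_prodM _ _ _ _ R lam (lebesgue_rV n) _ _ integrable_cauchy iK).
rewrite IHn exprS; congr (_ * _).
by rewrite /Rintegral integral_cauchy/=; field.
Qed.

Lemma integrable_poisson_kernel n :
  (lebesgue_rV n).-integrable setT (EFin \o @poisson_kernel n).
Proof. by have [] := integrable_Rintegral_poisson_kernel n. Qed.

Lemma Rintegral_poisson_kernel n :
  \int[lebesgue_rV n]_h @poisson_kernel n h = (2 * pi) ^+ n.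
Proof. by have [] := integrable_Rintegral_poisson_kernel n. Qed.

Lemma dotvN n (x y : 'rV[R]_n) : dotv (- x) y = - dotv x y.
Proof. by rewrite /dotv -sumrN; apply: eq_bigr => i _; rewrite mxE mulNr. Qed.

Lemma integrable_abel_weight_bounded n (f : R -> R) (h : 'rV[R]_n) :
  measurable_fun setT f -> (forall t, `|f t| <= 1) ->
  (lebesgue_rV n).-integrable setT (EFin \o (fun xi => abel_weight xi * f (dotv xi h))).
Proof.
move=> mf f1; apply: le_integrable (integrable_abel_weight n) => //.
  apply/measurable_EFinP; apply: measurable_funM; first exact: measurable_abel_weight.
  apply: (measurableT_comp mf); exact: measurable_dotv.
by move=> xi _; rewrite lee_fin normrM ler_piMr.
Qed.

Lemma normr_cos_le1 (t : R) : `|cos t| <= 1.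
Proof. by rewrite ler_norml cos_le1 cos_geN1. Qed.

Lemma normr_sin_le1 (t : R) : `|sin t| <= 1.
Proof. by rewrite ler_norml sin_le1 sin_geN1. Qed.

Let Rintegral_abel_weight_sin n (h : 'rV[R]_n) :
  \int[lebesgue_rV n]_xi (abel_weight xi * sin (dotv xi h)) = 0.
Proof.
pose F (xi : 'rV[R]_n) := abel_weight xi * sin (dotv xi h).
have mF : measurable_fun setT F.
  apply: measurable_funM; first exact: measurable_abel_weight.
  by apply: (measurableT_comp measurable_sin); exact: measurable_dotv.
have iF := integrable_abel_weight_bounded h measurable_sin normr_sin_le1.
have := @Rintegral_affine R n (-1) 0 F; rewrite oppr_eq0 oner_eq0 => /(_ isT mF).
rewrite normrN1 expr1n invr1 mul1r.
have -> : \int[lebesgue_rV n]_x F (-1 *: x + 0) = \int[lebesgue_rV n]_x (-1 * F x).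
  apply: eq_Rintegral => x _; rewrite addr0 scaleN1r /F dotvN sinN mulrN mulN1r.
  by congr (- (expR (- _) * _)); apply: eq_bigr => i _; rewrite mxE normrN.
rewrite RintegralZl// mulN1r -/F => /eqP; rewrite eq_sym -addr_eq0 => /eqP E.
lra.
Qed.

(** The addition formula of the cosine splits off the first coordinate; the sine
    terms vanish because the weight is even. *)
Lemma Rintegral_abel_weight_cos n (h : 'rV[R]_n) :
  \int[lebesgue_rV n]_xi (abel_weight xi * cos (dotv xi h)) = poisson_kernel h.
Proof.
elim: n h => [|n IHn] h.
  rewrite /Rintegral integral_rV0/= /poisson_kernel big_ord0.
  by rewrite /abel_weight /dotv !big_ord0 oppr0 expR0 cos0 mulr1.
pose h0 := h ord0 ord0; pose h' : 'rV[R]_n := \row_j h ord0 (lift ord0 j).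
have hE : h = consmx (h0, h').
  by rewrite -[LHS]unconsmxK.
have dE a x : dotv (consmx (a, x)) h = a * h0 + dotv x h'.
  rewrite /dotv big_ord_recl consmx0; congr (_ + _).
  by apply: eq_bigr => i _; rewrite consmxS mxE.
pose m := @lebesgue_rV R n.
have icos := integrable_abel_weight_bounded h' measurable_cos normr_cos_le1.
have isin := integrable_abel_weight_bounded h' measurable_sin normr_sin_le1.
have iesin : lam.-integrable setT (EFin \o (fun a : R => expR (- `|a|) * sin (a * h0))).
  apply: le_integrable integrable_expRNn => //.
    apply/measurable_EFinP; apply: measurable_funM => //.
    by apply: (measurableT_comp measurable_sin); exact: measurable_funM.
  by move=> a _; rewrite lee_fin normrM ler_piMr// normr_sin_le1.
pose F1 (z : R * 'rV[R]_n) := (expR (- `|z.1|) * cos (z.1 * h0)) *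
   (abel_weight z.2 * cos (dotv z.2 h')).
pose F2 (z : R * 'rV[R]_n) := (expR (- `|z.1|) * sin (z.1 * h0)) *
   (abel_weight z.2 * sin (dotv z.2 h')).
have i1 : (lam \x m)%E.-integrable setT (EFin \o F1).
  exact: (@integrable_prodM _ _ _ _ R lam m _ _ (integrable_expRNn_cos h0) icos).
have i2 : (lam \x m)%E.-integrable setT (EFin \o F2).
  exact: (@integrable_prodM _ _ _ _ R lam m _ _ iesin isin).
have FE : (fun xi => abel_weight xi * cos (dotv xi h)) \o @consmx R n =
    fun z => F1 z - F2 z.
  apply/funext => -[a x] /=; rewrite abel_weight_cons dE cosD /F1 /F2/=; ring.
rewrite Rintegral_rVS; last 2 first.
- apply: measurable_funM; first exact: measurable_abel_weight.
  by apply: (measurableT_comp measurable_cos); exact: measurable_dotv.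
- rewrite FE; exact: (integrableB measurableT i1 i2).
transitivity (\int[(lam \x m)%E]_z (F1 z - F2 z)).
  by apply: eq_Rintegral => z _; rewrite -[RHS]/((fun z => F1 z - F2 z) z) -FE.
rewrite RintegralB//.
rewrite (@Rintegral_prodM _ _ _ _ R lam m _ _ (integrable_expRNn_cos h0) icos).
rewrite (@Rintegral_prodM _ _ _ _ R lam m _ _ iesin isin).
rewrite Rintegral_abel_weight_sin mulr0 subr0 IHn Rintegral_expRNn_cos.
by rewrite hE poisson_kernel_cons.
Qed.

End poisson_kernel.

(** * The power spectrum *)

Section power_spectrum.
Context {R : realType} {n : nat}.
Local Notation V := 'rV[R]_n.
Local Notation mu := (@lebesgue_rV R n).
Local Notation mu2 := (prodm mu mu).
Implicit Types (u v : V -> R) (xi h x y : V).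

Definition cos_transform u xi : R := \int[mu]_x (u x * cos (dotv xi x)).

Definition sin_transform u xi : R := \int[mu]_x (u x * sin (dotv xi x)).

(** The squared modulus of the Fourier transform of a real-valued function. *)
Definition power_spectrum u xi : R :=
  cos_transform u xi ^+ 2 + sin_transform u xi ^+ 2.

Lemma dotvC x y : dotv x y = dotv y x.
Proof. by apply: eq_bigr => i _; rewrite mulrC. Qed.

Lemma dotvDl x y h : dotv (x + y) h = dotv x h + dotv y h.
Proof. by rewrite -big_split; apply: eq_bigr => i _; rewrite mxE mulrDl. Qed.

Lemma dotvZl (r : R) x h : dotv (r *: x) h = r * dotv x h.
Proof. by rewrite /dotv mulr_sumr; apply: eq_bigr => i _; rewrite mxE mulrA. Qed.

Lemma dotvBr xi x y : dotv xi (x - y) = dotv xi x - dotv xi y.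
Proof. by rewrite dotvC dotvDl dotvN !(dotvC xi). Qed.

Lemma integrable_mul_bounded d (T : measurableType d)
    (m : {measure set T -> \bar R}) (u f : T -> R) (B : R) :
  m.-integrable setT (EFin \o u) -> measurable_fun setT f ->
  (forall t, `|f t| <= B) -> m.-integrable setT (EFin \o (fun t => u t * f t)).
Proof.
move=> iu mf fB; have /integrableP[/measurable_EFinP meas_u _] := iu.
apply: le_integrable (integrableZl measurableT B iu) => //.
  by apply/measurable_EFinP; exact: measurable_funM.
move=> t _ /=; rewrite lee_fin !normrM mulrC ler_wpM2r//.
by rewrite (le_trans (fB t)) ?ler_norm.
Qed.

Lemma integrable_measurable d (T : measurableType d)
    (m : {measure set T -> \bar R}) (u : T -> R) :
  m.-integrable setT (EFin \o u) -> measurable_fun setT u.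
Proof. by move=> /integrableP[/measurable_EFinP]. Qed.

Lemma measurable_cos_dotv xi : measurable_fun setT (fun x : V => cos (dotv xi x)).
Proof. by apply: (measurableT_comp measurable_cos); exact: measurable_dotv. Qed.

Lemma measurable_sin_dotv xi : measurable_fun setT (fun x : V => sin (dotv xi x)).
Proof. by apply: (measurableT_comp measurable_sin); exact: measurable_dotv. Qed.

Lemma integrable_cos_dotv u xi : mu.-integrable setT (EFin \o u) ->
  mu.-integrable setT (EFin \o (fun x => u x * cos (dotv xi x))).
Proof.
move=> iu; apply: (integrable_mul_bounded iu (measurable_cos_dotv xi)) => x.
exact: normr_cos_le1.
Qed.

Lemma integrable_sin_dotv u xi : mu.-integrable setT (EFin \o u) ->
  mu.-integrable setT (EFin \o (fun x => u x * sin (dotv xi x))).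
Proof.
move=> iu; apply: (integrable_mul_bounded iu (measurable_sin_dotv xi)) => x.
exact: normr_sin_le1.
Qed.

Lemma measurable_power_spectrum u : measurable_fun setT u ->
  measurable_fun setT (power_spectrum u).
Proof.
move=> meas_u; apply: measurable_funD; apply: measurable_funX;
  apply: (@measurable_Rintegral _ _ _ _ R mu (fun z : V * V => u z.2 * _ (dotv z.1 z.2)));
  (apply: measurable_funM; first exact: (measurableT_comp meas_u measurable_snd)).
- apply: (measurableT_comp measurable_cos); apply: measurable_dotv.
    exact: measurable_fst.
  exact: measurable_snd.
- apply: (measurableT_comp measurable_sin); apply: measurable_dotv.
    exact: measurable_fst.
  exact: measurable_snd.
Qed.

Lemma power_spectrum_ge0 u xi : 0 <= power_spectrum u xi.
Proof. by rewrite addr_ge0 ?sqr_ge0. Qed.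

Lemma integrable_tensor u : mu.-integrable setT (EFin \o u) ->
  mu2.-integrable setT (EFin \o (fun z => u z.1 * u z.2)).
Proof. by move=> iu; exact: (@integrable_prodM _ _ _ _ R mu mu). Qed.

Lemma measurable_dotvB xi :
  measurable_fun setT (fun z : V * V => dotv xi (z.1 - z.2)).
Proof.
apply: measurable_dotv => //; apply: measurable_rVB; first exact: measurable_fst.
exact: measurable_snd.
Qed.

(** Expand the squares into double integrals and use the subtraction formula of
    the cosine. *)
Lemma power_spectrumE u xi : mu.-integrable setT (EFin \o u) ->
  power_spectrum u xi =
  \int[mu2]_z (u z.1 * u z.2 * cos (dotv xi (z.1 - z.2))).
Proof.
move=> iu; have ic := integrable_cos_dotv xi iu.
have isin := integrable_sin_dotv xi iu.
pose F1 (z : V * V) := (u z.1 * cos (dotv xi z.1)) * (u z.2 * cos (dotv xi z.2)).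
pose F2 (z : V * V) := (u z.1 * sin (dotv xi z.1)) * (u z.2 * sin (dotv xi z.2)).
transitivity (\int[mu2]_z (F1 z + F2 z)); last first.
  by apply: eq_Rintegral => z _; rewrite /F1 /F2 dotvBr cosB; ring.
rewrite RintegralD//; last 2 first.
- exact: (@integrable_prodM _ _ _ _ R mu mu _ _ ic ic).
- exact: (@integrable_prodM _ _ _ _ R mu mu _ _ isin isin).
rewrite /power_spectrum !expr2; congr (_ + _); apply/esym.
- exact: (@Rintegral_prodM _ _ _ _ R mu mu _ _ ic ic).
- exact: (@Rintegral_prodM _ _ _ _ R mu mu _ _ isin isin).
Qed.

End power_spectrum.

(** * The Plancherel theorem for bounded integrable functions *)

Section plancherel.
Context {R : realType} {n : nat}.
Local Notation V := 'rV[R]_n.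
Local Notation mu := (@lebesgue_rV R n).
Local Notation mu2 := (prodm mu mu).
Local Notation M := ((2 * pi) ^+ n : R).
Implicit Types (u : V -> R) (xi h x y : V) (r : R).

Definition poisson_dilate r h : R := r ^- n * poisson_kernel (r^-1 *: h).

Lemma measurable_poisson_dilate r : measurable_fun setT (poisson_dilate r).
Proof.
apply: measurable_funM => //; apply: (measurableT_comp (@measurable_poisson_kernel R n)).
exact: measurable_rVZ.
Qed.

Lemma poisson_dilate_ge0 r h : 0 < r -> 0 <= poisson_dilate r h.
Proof.
move=> r0; rewrite mulr_ge0 ?poisson_kernel_ge0// invr_ge0 exprn_ge0//.
exact: ltW.
Qed.

Lemma integral_poisson_kernel : (\int[mu]_h (poisson_kernel h)%:E = M%:E)%E.
Proof.
by rewrite -Rintegral_poisson_kernel EFin_Rintegral//; exact: integrable_poisson_kernel.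
Qed.

Lemma integral_poisson_dilate r (s : R) (v : V) : 0 < r -> `|s| = 1 ->
  (\int[mu]_h (poisson_dilate r (s *: h + v)%R)%:E = M%:E)%E.
Proof.
move=> r0 s1; have s0 : s != 0 by rewrite -normr_gt0 s1.
rewrite (integral_affine v s0 (measurable_poisson_dilate r)) s1 expr1n invr1 mul1e.
under eq_integral do rewrite EFinM.
have mKr0 : measurable_fun setT (fun h : V => poisson_kernel (r^-1 *: h)).
  apply: (measurableT_comp (@measurable_poisson_kernel R n)).
  exact: measurable_rVZ.
have mKr : measurable_fun setT (fun h : V => (poisson_kernel (r^-1 *: h))%:E).
  exact/measurable_EFinP.
have K0 h : setT h -> (0 <= (poisson_kernel (r^-1 *: h))%:E)%E.
  by rewrite lee_fin poisson_kernel_ge0.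
rewrite ge0_integralZl_EFin//; last by rewrite invr_ge0 exprn_ge0// ltW.
have r1 : r^-1 != 0 by rewrite invr_eq0 gt_eqF.
transitivity ((r ^- n)%:E * \int[mu]_h (poisson_kernel (r^-1 *: h + 0))%:E)%E.
  by congr (_ * _)%E; apply: eq_integral => h _; rewrite addr0.
rewrite (integral_affine (0 : V) r1 (@measurable_poisson_kernel R n)).
rewrite integral_poisson_kernel -!EFinM; congr EFin.
rewrite gtr0_norm ?invr_gt0// exprVn invrK mulrA mulVf ?mul1r//.
by rewrite expf_neq0// gt_eqF.
Qed.

Lemma Rintegral_abel_weightZ_cos r h : 0 < r ->
  \int[mu]_xi (abel_weight (r *: xi) * cos (dotv xi h)) = poisson_dilate r h.
Proof.
move=> r0; have r1 : r != 0 by rewrite gt_eqF.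
pose F xi := abel_weight xi * cos (dotv xi (r^-1 *: h)).
have mF : measurable_fun setT F.
  apply: measurable_funM; first exact: measurable_abel_weight.
  by apply: (measurableT_comp measurable_cos); exact: measurable_dotv.
have := Rintegral_affine (0 : V) r1 mF.
rewrite /F Rintegral_abel_weight_cos gtr0_norm// /poisson_dilate => <-.
apply: eq_Rintegral => xi _; rewrite addr0 dotvZl [dotv xi (_ *: _)]dotvC dotvZl.
by rewrite mulrA divff ?mul1r// [dotv h xi]dotvC.
Qed.

Lemma integrable_abel_weightZ r : 0 < r ->
  mu.-integrable setT (EFin \o (fun xi : V => abel_weight (r *: xi))).
Proof.
move=> r0; have r1 : r != 0 by rewrite gt_eqF.
have := integrable_affine (0 : V) r1 (@integrable_abel_weight R n).
by under [X in EFin \o X]eq_fun do rewrite addr0.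
Qed.

Section smoothed_identity.
Variables (u : V -> R) (B : R).
Hypotheses (iu : mu.-integrable setT (EFin \o u)) (uB : forall x, `|u x| <= B).

Let meas_u : measurable_fun setT u. Proof. exact: integrable_measurable iu. Qed.

Lemma integrable_sqr : mu.-integrable setT (EFin \o (fun x => u x ^+ 2)).
Proof.
have := integrable_mul_bounded iu meas_u uB.
by under [X in EFin \o X]eq_fun do rewrite -expr2.
Qed.

Let correlation r := \int[mu2]_z (u z.1 * u z.2 * poisson_dilate r (z.1 - z.2)).
Let defect r := (\int[mu2]_z
  (poisson_dilate r (z.1 - z.2)%R * (u z.1 - u z.2) ^+ 2)%:E)%E.

(** Fubini: the integral over [xi] of the weight against [cos (dotv xi (x - y))] is
    the Poisson kernel at [x - y]. *)
Lemma smoothed_energyE r : 0 < r ->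
  mu.-integrable setT (EFin \o (fun xi => abel_weight (r *: xi) * power_spectrum u xi)) /\
  \int[mu]_xi (abel_weight (r *: xi) * power_spectrum u xi) = correlation r.
Proof.
move=> r0.
pose F (p : V * (V * V)) := abel_weight (r *: p.1) *
  (u p.2.1 * u p.2.2 * cos (dotv p.1 (p.2.1 - p.2.2))).
have iw := integrable_abel_weightZ r0.
have it := integrable_tensor iu.
have iuc xi : mu2.-integrable setT
    (EFin \o (fun z => u z.1 * u z.2 * cos (dotv xi (z.1 - z.2)))).
  apply: (integrable_mul_bounded it); last by move=> z; exact: normr_cos_le1.
  by apply: (measurableT_comp measurable_cos); exact: measurable_dotvB.
have mp1 : measurable_fun setT (fun p : V * (V * V) => p.1) by exact: measurable_fst.
have mp21 : measurable_fun setT (fun p : V * (V * V) => p.2.1).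
  exact: measurableT_comp measurable_fst measurable_snd.
have mp22 : measurable_fun setT (fun p : V * (V * V) => p.2.2).
  exact: measurableT_comp measurable_snd measurable_snd.
have mF : measurable_fun setT F.
  apply: measurable_funM.
    by apply: (measurableT_comp (@measurable_abel_weight R n)); exact: measurable_rVZ.
  apply: measurable_funM.
    by apply: measurable_funM; [exact: (measurableT_comp meas_u mp21)|
                                exact: (measurableT_comp meas_u mp22)].
  apply: (measurableT_comp measurable_cos); apply: measurable_dotv => //.
  exact: measurable_rVB.
have iwc h : mu.-integrable setT (EFin \o (fun xi => abel_weight (r *: xi) * cos (dotv xi h))).
  apply: (integrable_mul_bounded iw); last by move=> xi; exact: normr_cos_le1.
  by apply: (measurableT_comp measurable_cos); exact: measurable_dotv.
have iF : (mu \x mu2)%E.-integrable setT (EFin \o F).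
  apply: le_integrable (@integrable_prodM _ _ _ _ R mu mu2 _ _ iw it) => //.
    exact/measurable_EFinP.
  move=> p _ /=; rewrite lee_fin /F mulrA normrM ler_piMr//.
  exact: normr_cos_le1.
have iF1 xi : mu2.-integrable setT (EFin \o (fun z => F (xi, z))).
  exact: (integrableZl measurableT (abel_weight (r *: xi)) (iuc xi)).
have iF2 z : mu.-integrable setT (EFin \o (fun xi => F (xi, z))).
  have := integrableZl measurableT (u z.1 * u z.2) (iwc (z.1 - z.2)).
  congr (integrable _ _ _); apply/funext => xi /=; rewrite -EFinM.
  by congr EFin; rewrite /F/=; ring.
have FE xi : \int[mu2]_z F (xi, z) = abel_weight (r *: xi) * power_spectrum u xi.
  by rewrite power_spectrumE// -RintegralZl.
split.
  have := integrable_Rintegral iF iF1.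
  by under [X in EFin \o X]eq_fun do rewrite FE.
transitivity (\int[mu]_xi \int[mu2]_z F (xi, z)); first by apply: eq_Rintegral => xi _; rewrite FE.
rewrite (Rintegral_swap iF iF1 iF2); apply: eq_Rintegral => z _.
rewrite -Rintegral_abel_weightZ_cos//.
rewrite -(RintegralZl (u z.1 * u z.2) measurableT (iwc (z.1 - z.2))).
by apply: eq_Rintegral => xi _; rewrite /F/=; ring.
Qed.

Let U2 (r : R) (z : V * V) := poisson_dilate r (z.1 - z.2).

Let mU2 r : measurable_fun setT (U2 r).
Proof.
apply: (measurableT_comp (measurable_poisson_dilate r)).
by apply: measurable_rVB; [exact: measurable_fst|exact: measurable_snd].
Qed.

Let meas_u1 : measurable_fun setT (fun z : V * V => u z.1).
Proof. exact: (measurableT_comp meas_u measurable_fst). Qed.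

Let meas_u2 : measurable_fun setT (fun z : V * V => u z.2).
Proof. exact: (measurableT_comp meas_u measurable_snd). Qed.

Let usqr_ge0 x : (0 <= (u x ^+ 2)%:E)%E.
Proof. by rewrite lee_fin sqr_ge0. Qed.

Let musqr : measurable_fun setT (fun x => (u x ^+ 2)%:E).
Proof. by apply/measurable_EFinP; exact: measurable_funX. Qed.

Let sqr_first r : 0 < r ->
  (\int[mu2]_z (U2 r z * u z.1 ^+ 2)%:E = M%:E * \int[mu]_x (u x ^+ 2)%:E)%E.
Proof.
move=> r0.
have m1 : measurable_fun setT (fun z => (U2 r z * u z.1 ^+ 2)%:E).
  by apply/measurable_EFinP; apply: measurable_funM => //; exact: measurable_funX.
rewrite (@fubini_tonelli1 _ _ _ _ R mu mu _ m1); last first.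
  by move=> z; rewrite lee_fin mulr_ge0 ?sqr_ge0// poisson_dilate_ge0.
rewrite -ge0_integralZl//; last by rewrite lee_fin exprn_ge0// mulr_ge0// pi_ge0.
apply: eq_integral => x _; rewrite /fubini_F/=.
under eq_integral do rewrite EFinM.
rewrite ge0_integralZr//; last 2 first.
- apply/measurable_EFinP; apply: (measurableT_comp (measurable_poisson_dilate r)).
  by apply: measurable_rVB; [exact: measurable_cst|exact: measurable_id].
- by move=> y _; rewrite lee_fin poisson_dilate_ge0.
congr (_ * _)%E; rewrite -(integral_poisson_dilate (s := -1) x r0 (normrN1 _)).
by apply: eq_integral => y _; rewrite scaleN1r addrC.
Qed.

Let sqr_second r : 0 < r ->
  (\int[mu2]_z (U2 r z * u z.2 ^+ 2)%:E = M%:E * \int[mu]_x (u x ^+ 2)%:E)%E.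
Proof.
move=> r0.
have m2 : measurable_fun setT (fun z => (U2 r z * u z.2 ^+ 2)%:E).
  by apply/measurable_EFinP; apply: measurable_funM => //; exact: measurable_funX.
have U0 z : (0 <= (U2 r z * u z.2 ^+ 2)%:E)%E.
  by rewrite lee_fin mulr_ge0 ?sqr_ge0// poisson_dilate_ge0.
rewrite (@fubini_tonelli1 _ _ _ _ R mu mu _ m2 U0) (@fubini_tonelli _ _ _ _ R mu mu _ m2 U0).
rewrite -ge0_integralZl//; last by rewrite lee_fin exprn_ge0// mulr_ge0// pi_ge0.
apply: eq_integral => x _ /=.
under eq_integral do rewrite EFinM.
rewrite ge0_integralZr//; last 2 first.
- apply/measurable_EFinP; apply: (measurableT_comp (measurable_poisson_dilate r)).
  by apply: measurable_rVB; [exact: measurable_id|exact: measurable_cst].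
- by move=> y _; rewrite lee_fin poisson_dilate_ge0.
congr (_ * _)%E; rewrite -(integral_poisson_dilate (s := 1) (- x) r0 (normr1 _)).
by apply: eq_integral => y _; rewrite scale1r.
Qed.

Let sqr_fin : (\int[mu]_x (u x ^+ 2)%:E)%E \is a fin_num.
Proof. exact: integrable_fin_num measurableT _ integrable_sqr. Qed.

Let integrable_sqr_first r : 0 < r ->
  mu2.-integrable setT (EFin \o (fun z => U2 r z * u z.1 ^+ 2)).
Proof.
move=> r0; apply: ge0_integrable => //.
- by move=> z; rewrite mulr_ge0 ?sqr_ge0// poisson_dilate_ge0.
- by apply: measurable_funM => //; exact: measurable_funX.
- by rewrite sqr_first// -(fineK sqr_fin) -EFinM ltry.
Qed.

Let integrable_sqr_second r : 0 < r ->
  mu2.-integrable setT (EFin \o (fun z => U2 r z * u z.2 ^+ 2)).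
Proof.
move=> r0; apply: ge0_integrable => //.
- by move=> z; rewrite mulr_ge0 ?sqr_ge0// poisson_dilate_ge0.
- by apply: measurable_funM => //; exact: measurable_funX.
- by rewrite sqr_second// -(fineK sqr_fin) -EFinM ltry.
Qed.

(** Polarization: [2 u(x) u(y) = u(x)^2 + u(y)^2 - (u(x) - u(y))^2], and the Poisson
    kernel integrates to [(2 pi)^n] in either variable. The last square makes the
    defect, which is the only obstacle to the Plancherel identity. *)
Lemma smoothed_identity r : 0 < r ->
  ((2 * M * \int[mu]_x (u x ^+ 2))%:E =
   (2 * \int[mu]_xi (abel_weight (r *: xi) * power_spectrum u xi))%:E + defect r)%E.
Proof.
move=> r0.
have i1 := integrable_sqr_first r0; have i2 := integrable_sqr_second r0.
have U0 z : 0 <= U2 r z by exact: poisson_dilate_ge0.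
have iG : mu2.-integrable setT
    (EFin \o (fun z => u z.1 * u z.2 * poisson_dilate r (z.1 - z.2))).
  apply: le_integrable (integrableD measurableT i1 i2) => //.
    by apply/measurable_EFinP; apply: measurable_funM; [exact: measurable_funM|exact: mU2].
  move=> z _; rewrite /= lee_fin -/(U2 r z) -mulrDr [leRHS]ger0_norm; last first.
    by rewrite mulr_ge0// addr_ge0 ?sqr_ge0.
  rewrite normrM mulrC (ger0_norm (U0 z)) ler_wpM2l// ler_norml.
  by have := sqr_ge0 (u z.1 - u z.2); have := sqr_ge0 (u z.1 + u z.2); nra.
have iD : mu2.-integrable setT (EFin \o (fun z =>
    poisson_dilate r (z.1 - z.2) * (u z.1 - u z.2) ^+ 2)).
  have iS := integrableD measurableT (integrableD measurableT i1 i2)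
    (integrableZl measurableT (-2) iG).
  congr (integrable _ _ _): iS; apply/funext => z /=.
  by rewrite -!EFinM -!EFinD /U2; congr EFin; ring.
have [_ ->] := smoothed_energyE r0.
have DE : defect r = (\int[mu2]_z (poisson_dilate r (z.1 - z.2) * (u z.1 - u z.2) ^+ 2))%:E.
  by rewrite EFin_Rintegral.
rewrite DE -EFinD; congr EFin.
have i2G : mu2.-integrable setT
    (EFin \o (fun z => 2 * (u z.1 * u z.2 * poisson_dilate r (z.1 - z.2)))).
  exact: (integrableZl measurableT 2 iG).
rewrite /correlation -(RintegralZl 2 measurableT iG) -(RintegralD measurableT i2G iD).
transitivity (\int[mu2]_z (U2 r z * u z.1 ^+ 2 + U2 r z * u z.2 ^+ 2)); last first.
  by apply: eq_Rintegral => z _; rewrite /U2; ring.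
rewrite RintegralD// /Rintegral sqr_first// sqr_second//.
by rewrite -(fineK sqr_fin) -EFinM/=; ring.
Qed.

End smoothed_identity.

End plancherel.

Section plancherel_limit.
Context {R : realType} {n : nat}.
Local Notation V := 'rV[R]_n.
Local Notation mu := (@lebesgue_rV R n).
Local Notation mu2 := (prodm mu mu).
Local Notation M := ((2 * pi) ^+ n : R).
Local Notation r_ j := (j.+1%:R^-1 : R).
Variables (u : V -> R) (B : R).
Hypotheses (iu : mu.-integrable setT (EFin \o u)) (uB : forall x, `|u x| <= B).

Let meas_u : measurable_fun setT u. Proof. exact: integrable_measurable iu. Qed.

Let B0 : 0 <= B. Proof. exact: le_trans (normr_ge0 _) (uB 0). Qed.

Let omega (h : V) := (\int[mu]_y `|u y - u (y + h)%R|%:E)%E.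

Let defect r := (\int[mu2]_z
  (poisson_dilate r (z.1 - z.2)%R * (u z.1 - u z.2) ^+ 2)%:E)%E.

Let omega_ge0 h : (0 <= omega h)%E.
Proof. by apply: integral_ge0 => y _; rewrite lee_fin. Qed.

Let measurable_shifted : measurable_fun setT (fun z : V * V => u (z.2 + z.1)).
Proof.
apply: (measurableT_comp meas_u).
by apply: measurable_rVD; [exact: measurable_snd|exact: measurable_fst].
Qed.

Let meas_u2 : measurable_fun setT (fun z : V * V => u z.2).
Proof. exact: (measurableT_comp meas_u measurable_snd). Qed.

Let measurable_omega : measurable_fun setT omega.
Proof.
apply: (@measurable_fun_fubini_tonelli_F _ _ _ _ R mu
  (fun z : V * V => `|u z.2 - u (z.2 + z.1)|%:E)) => [|z]; last by rewrite lee_fin.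
apply/measurable_EFinP; apply: measurableT_comp => //.
exact: measurable_funB.
Qed.

(** Substitute [x = y + r *: h]: the defect is the Poisson mean of the L^2 modulus
    of [u] at [r *: h], and one factor [|u(x) - u(y)|] is at most [2 * B]. *)
Let defect_le r : 0 < r ->
  (defect r <= \int[mu]_h ((poisson_kernel h)%:E * ((2 * B)%:E * omega (r *: h)%R)))%E.
Proof.
move=> r0; have r1 : r != 0 by rewrite gt_eqF.
pose f (z : V * V) := (poisson_dilate r (z.1 - z.2) * (u z.1 - u z.2) ^+ 2)%:E.
have f0 z : (0 <= f z)%E by rewrite lee_fin mulr_ge0 ?sqr_ge0// poisson_dilate_ge0.
have mf : measurable_fun setT f.
  apply/measurable_EFinP; apply: measurable_funM.
    apply: (measurableT_comp (measurable_poisson_dilate r)).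
    by apply: measurable_rVB; [exact: measurable_fst|exact: measurable_snd].
  apply: measurable_funX; apply: measurable_funB => //.
  exact: (measurableT_comp meas_u measurable_fst).
have mfx y : measurable_fun setT (fun x => f (x, y)).
  by apply: (measurableT_comp mf); exact: measurable_fun_pair.
pose g (z : V * V) := ((poisson_kernel z.2) * (u (z.1 + r *: z.2) - u z.1) ^+ 2)%:E.
have g0 z : (0 <= g z)%E by rewrite lee_fin mulr_ge0 ?sqr_ge0// poisson_kernel_ge0.
have mg : measurable_fun setT g.
  apply/measurable_EFinP; apply: measurable_funM.
    exact: (measurableT_comp (@measurable_poisson_kernel R n) measurable_snd).
  apply: measurable_funX; apply: measurable_funB.
    apply: (measurableT_comp meas_u); apply: measurable_rVD; first exact: measurable_fst.
    by apply: measurable_rVZ => //; exact: measurable_snd.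
  exact: (measurableT_comp meas_u measurable_fst).
rewrite /defect (@fubini_tonelli1 _ _ _ _ R mu mu _ mf f0).
rewrite (@fubini_tonelli _ _ _ _ R mu mu _ mf f0).
have -> : (\int[mu]_y \int[mu]_x f (x, y) = \int[mu]_y \int[mu]_h g (y, h))%E.
  apply: eq_integral => y _.
  have := ge0_integral_affine y r1 (mfx y) (fun x => f0 (x, y)).
  move=> /(congr1 (fun e => (r ^+ n)%:E * e)%E).
  rewrite muleA -EFinM gtr0_norm// mulfV ?mul1e; last by rewrite expf_neq0.
  move=> <-.
  have mfr : measurable_fun setT (fun h : V => f (r *: h + y, y)).
    apply: (measurableT_comp (mfx y)); apply: measurable_rVD => //.
    exact: measurable_rVZ.
  rewrite -ge0_integralZl_EFin//; last by rewrite exprn_ge0// ltW.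
  apply: eq_integral => h _; rewrite -EFinM; congr EFin.
  rewrite /poisson_dilate /= addrK scalerA mulVf// scale1r (addrC y).
  by rewrite -mulrA mulVKf// expf_neq0.
rewrite (@fubini_tonelli _ _ _ _ R mu mu _ mg g0); apply: ge0_le_integral => //.
- by move=> h _; apply: integral_ge0.
- exact: (@measurable_fun_fubini_tonelli_G _ _ _ _ _ mu _ mg).
- apply: emeasurable_funM.
    by apply/measurable_EFinP; exact: measurable_poisson_kernel.
  apply: emeasurable_funM => //; apply: (measurableT_comp measurable_omega).
  exact: measurable_rVZ.
move=> h _; rewrite /g /=.
under eq_integral do rewrite EFinM.
have ms : measurable_fun setT (fun y : V => u (y + r *: h)).
  by apply: (measurableT_comp meas_u); exact: measurable_rVD.
have sq0 y : setT y -> (0 <= ((u (y + r *: h) - u y) ^+ 2)%:E)%E.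
  by rewrite lee_fin sqr_ge0.
rewrite ge0_integralZl_EFin ?poisson_kernel_ge0//; last first.
  by apply/measurable_EFinP; apply: measurable_funX; exact: measurable_funB.
rewrite lee_wpmul2l ?lee_fin ?poisson_kernel_ge0//.
rewrite /omega -ge0_integralZl_EFin ?mulr_ge0//; last first.
  by apply/measurable_EFinP; apply: measurableT_comp => //; exact: measurable_funB.
apply: ge0_le_integral => //.
- by apply/measurable_EFinP; apply: measurable_funX; exact: measurable_funB.
- apply: emeasurable_funM => //; apply/measurable_EFinP.
  by apply: measurableT_comp => //; exact: measurable_funB.
move=> y _; rewrite -EFinM lee_fin distrC -real_normK ?num_real// expr2.
by rewrite ler_wpM2r// (le_trans (ler_normB _ _))// mulr_natl mulr2n lerD.
Qed.

Let omega_le h : (omega h <= 2%:E * \int[mu]_y `|u y|%:E)%E.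
Proof.
have mh : measurable_fun setT (fun y : V => u (y + h)).
  by apply: (measurableT_comp meas_u); exact: measurable_rVD.
apply: (le_trans (integral_normB_le _ meas_u mh)).
have mabs : measurable_fun setT (fun y => `|u y|%:E).
  by apply/measurable_EFinP; exact: measurableT_comp.
have abs0 y : (0 <= `|u y|%:E)%E by rewrite lee_fin.
rewrite (ge0_integral_translate h mabs abs0).
by rewrite -[2%:E]/((1 + 1)%:E)%E EFinD ge0_muleDl// mul1e.
Qed.

Let defect_cvg0 : defect (r_ j) @[j --> \oo] --> 0%E.
Proof.
pose f j h := ((poisson_kernel h)%:E * ((2 * B)%:E * omega (r_ j *: h)))%E.
pose N := (\int[mu]_y `|u y|%:E)%E.
have Nfin : N \is a fin_num.
  have /integrableP[_] := iu; rewrite -ge0_fin_numE//.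
  exact: integral_ge0.
pose c := 2 * B * (2 * fine N).
have f0 j h : (0 <= f j h)%E.
  by rewrite !mule_ge0// lee_fin ?poisson_kernel_ge0// mulr_ge0.
have fcv : (\int[mu]_h f j h)%E @[j --> \oo] --> 0%E.
  apply: (@dominated_cvg0 _ _ _ mu f (fun h => c%:E * (poisson_kernel h)%:E)%E).
  - move=> j; apply: emeasurable_funM.
      by apply/measurable_EFinP; exact: measurable_poisson_kernel.
    apply: emeasurable_funM => //; apply: (measurableT_comp measurable_omega).
    exact: measurable_rVZ.
  - by apply: integrableZl => //; exact: integrable_poisson_kernel.
  - move=> j h; rewrite f0/= /f muleC lee_wpmul2r ?lee_fin ?poisson_kernel_ge0//.
    have -> : c%:E = ((2 * B)%:E * (2%:E * N))%E.
      by rewrite -(fineK Nfin) -!EFinM.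
    by rewrite lee_wpmul2l ?lee_fin ?mulr_ge0// omega_le.
  - apply: aeW => h; rewrite /f.
    rewrite -(mule0 (poisson_kernel h)%:E); apply: cvgeZl => //.
    rewrite -(mule0 (2 * B)%:E); apply: cvgeZl => //.
    exact: L1_translation.
apply: (@squeeze_cvge _ _ _ _ (cst 0%E) _ _ _ _ _ fcv); last exact: cvg_cst.
apply: nearW => j; apply/andP; split; last by apply: defect_le; rewrite invr_gt0.
apply: integral_ge0 => z _.
by rewrite lee_fin mulr_ge0 ?sqr_ge0// poisson_dilate_ge0// invr_gt0.
Qed.

Let abel_weight_le1 (xi : V) : abel_weight xi <= 1.
Proof.
rewrite /abel_weight -expR0 ler_expR oppr_le0.
by apply: sumr_ge0 => i _.
Qed.

Let energy_ge0 xi r : (0 <= (abel_weight (r *: xi) * power_spectrum u xi)%:E)%E.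
Proof. by rewrite lee_fin mulr_ge0 ?expR_ge0 ?power_spectrum_ge0. Qed.

Let measurable_energy r :
  measurable_fun setT (fun xi : V => (abel_weight (r *: xi) * power_spectrum u xi)%:E).
Proof.
apply/measurable_EFinP; apply: measurable_funM.
  by apply: (measurableT_comp (@measurable_abel_weight R n)); exact: measurable_rVZ.
exact: measurable_power_spectrum.
Qed.

Let identity r : 0 < r ->
  (2%:E * (M%:E * \int[mu]_x (u x ^+ 2)%:E) =
   2%:E * \int[mu]_xi (abel_weight (r *: xi) * power_spectrum u xi)%:E + defect r)%E.
Proof.
move=> r0; have [iw _] := smoothed_energyE iu r0.
rewrite -(EFin_Rintegral measurableT iw).
rewrite -(EFin_Rintegral measurableT (integrable_sqr iu uB)).
by rewrite -!EFinM mulrA (smoothed_identity iu uB r0).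
Qed.

(** The Abel weight is at most 1, and the defect tends to 0. *)
Lemma plancherel_ge :
  (M%:E * \int[mu]_x (u x ^+ 2)%:E <= \int[mu]_xi (power_spectrum u xi)%:E)%E.
Proof.
set I := (\int[mu]_xi (power_spectrum u xi)%:E)%E.
have I0 : (0 <= I)%E by apply: integral_ge0 => xi _; rewrite lee_fin power_spectrum_ge0.
suff : (2%:E * (M%:E * \int[mu]_x (u x ^+ 2)%:E) <= 2%:E * I + 0)%E.
  by rewrite adde0 lee_pmul2l.
have lim : (2%:E * I + defect (r_ j))%E @[j --> \oo] --> (2%:E * I + 0)%E.
  apply: cvgeD => //; last exact: cvg_cst.
  by rewrite fin_num_adde_defl.
apply: (cvge_to_ge lim); apply: nearW => j.
have r0 : 0 < r_ j by rewrite invr_gt0.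
rewrite (identity r0) leeD2r// lee_wpmul2l ?lee_fin//.
apply: ge0_le_integral => //.
- by apply/measurable_EFinP; exact: measurable_power_spectrum.
- by move=> xi _; rewrite lee_fin ler_piMl// power_spectrum_ge0.
Qed.

(** The defect is nonnegative; Fatou removes the Abel weight. *)
Lemma plancherel_le :
  (\int[mu]_xi (power_spectrum u xi)%:E <= M%:E * \int[mu]_x (u x ^+ 2)%:E)%E.
Proof.
apply: (@fatou_le _ _ _ mu
  (fun j (xi : V) => (abel_weight (r_ j *: xi) * power_spectrum u xi)%:E)).
- by move=> j; exact: (measurable_energy (r_ j)).
- by move=> j xi; exact: energy_ge0.
- by apply/measurable_EFinP; exact: measurable_power_spectrum.
- by move=> xi; rewrite lee_fin power_spectrum_ge0.
- move=> xi.
  have cv : (abel_weight (r_ j *: xi) * power_spectrum u xi)%:E @[j --> \oo]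
      --> (power_spectrum u xi)%:E.
    apply: cvg_EFin; first exact: nearW.
    pose s := \sum_i `|xi ord0 i|.
    have wE j : abel_weight (r_ j *: xi) = expR (- (r_ j * s)).
      rewrite /abel_weight mulr_sumr; congr (expR (- _)); apply: eq_bigr => i _.
      by rewrite mxE normrM ger0_norm// invr_ge0.
    under eq_fun do rewrite wE.
    have h1 : - (r_ j * s) @[j --> \oo] --> - (0 * s).
      by apply: cvgN; apply: cvgM; [exact: cvg_harmonic|exact: cvg_cst].
    have h2 : expR (- (r_ j * s)) @[j --> \oo] --> expR (- (0 * s)).
      exact: (cvg_comp _ _ h1 (@continuous_expR _ _)).
    have h3 : expR (- (r_ j * s)) * power_spectrum u xi @[j --> \oo]
        --> expR (- (0 * s)) * power_spectrum u xi.
      by apply: cvgM; [exact: h2|exact: cvg_cst].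
    by rewrite mul0r oppr0 expR0 mul1r in h3.
  by rewrite (cvg_limn_einf_sup cv).1.
move=> j; have r0 : 0 < r_ j by rewrite invr_gt0.
rewrite -(@lee_pmul2l _ 2%:E)// (identity r0) leeDl//.
apply: integral_ge0 => z _.
by rewrite lee_fin mulr_ge0 ?sqr_ge0// poisson_dilate_ge0.
Qed.

End plancherel_limit.

(** * The convolution theorem for the power spectrum *)

Section convolution_theorem.
Context {R : realType} {n : nat}.
Local Notation V := 'rV[R]_n.
Local Notation mu := (@lebesgue_rV R n).
Implicit Types (p f : V -> R) (xi x y : V).

Definition rconv p f x : R := \int[mu]_y (p (x - y) * f y).

Definition rdilate p (t : R) x : R := t ^- n * p (t^-1 *: x).

Section bounded.
Variables (p f : V -> R) (B : R).
Hypotheses (ip : mu.-integrable setT (EFin \o p))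
  (intf : mu.-integrable setT (EFin \o f)) (fB : forall x, `|f x| <= B).

Let mp : measurable_fun setT p. Proof. exact: integrable_measurable ip. Qed.
Let mf : measurable_fun setT f. Proof. exact: integrable_measurable intf. Qed.

Let F (z : V * V) := p (z.1 - z.2) * f z.2.

Let mF : measurable_fun setT F.
Proof.
apply: measurable_funM; last exact: (measurableT_comp mf measurable_snd).
apply: (measurableT_comp mp).
by apply: measurable_rVB; [exact: measurable_fst|exact: measurable_snd].
Qed.

Let integrable_shift y : mu.-integrable setT (EFin \o (fun x => p (x - y))).
Proof.
have := integrable_affine (- y) (oner_neq0 R) ip.
by under [X in EFin \o X]eq_fun do rewrite scale1r.
Qed.

Let integrable_reflect x : mu.-integrable setT (EFin \o (fun y => p (x - y))).
Proof.
have N1 : (-1 : R) != 0 by rewrite oppr_eq0 oner_neq0.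
have := integrable_affine x N1 ip.
by under [X in EFin \o X]eq_fun do rewrite scaleN1r addrC.
Qed.

Lemma integrable_rconv_integrand x :
  mu.-integrable setT (EFin \o (fun y => p (x - y) * f y)).
Proof. exact: integrable_mul_bounded (integrable_reflect x) mf fB. Qed.

Let integrable_F1 y : mu.-integrable setT (EFin \o (fun x => F (x, y))).
Proof.
apply: (integrable_mul_bounded (integrable_shift y) (measurable_cst (f y))
  (B := `|f y|)).
by move=> x /=.
Qed.

Let integral_shift y : (\int[mu]_x `|p (x - y)|%:E = \int[mu]_x `|p x|%:E)%E.
Proof.
have mabs : measurable_fun setT (fun y => `|p y|%:E).
  by apply/measurable_EFinP; exact: measurableT_comp.
have abs0 x : (0 <= `|p x|%:E)%E by rewrite lee_fin.
exact: (ge0_integral_translate (- y) mabs abs0).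
Qed.

Let integrable_F : (mu \x mu)%E.-integrable setT (EFin \o F).
Proof.
have mEF : measurable_fun setT (EFin \o F) by exact/measurable_EFinP.
apply/(integrable21ltyP mu mu mEF).
have /integrableP[_ poo] := ip; have /integrableP[_ foo] := intf.
rewrite (_ : (\int[mu]_y _)%E =
    (\int[mu]_y ((\int[mu]_x `|p x|%:E) * `|f y|%:E))%E).
  rewrite ge0_integralZl//.
  - rewrite lte_mul_pinfty// ?integral_ge0// ge0_fin_numE// integral_ge0//.
  - by apply/measurable_EFinP; exact: measurableT_comp.
  - exact: integral_ge0.
apply: eq_integral => y _.
under eq_integral do rewrite /= /F/= normrM EFinM.
rewrite ge0_integralZr//; first by rewrite integral_shift.
apply/measurable_EFinP; apply: measurableT_comp => //.
exact: integrable_measurable (integrable_shift y).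
Qed.

Lemma integrable_rconv : mu.-integrable setT (EFin \o rconv p f).
Proof. exact: integrable_Rintegral integrable_F integrable_rconv_integrand. Qed.

Lemma rconv_bounded x : `|rconv p f x| <= \int[mu]_y `|p y| * B.
Proof.
have ix := integrable_rconv_integrand x.
rewrite (le_trans (le_normr_Rintegral measurableT ix))//.
have ir := integrable_norm (integrable_reflect x).
have irB : mu.-integrable setT (EFin \o (fun y => `|p (x - y)| * B)).
  by have := integrableZr measurableT B ir.
apply: (@le_trans _ _ (\int[mu]_y (`|p (x - y)| * B))).
  apply: le_Rintegral => //; first exact: integrable_norm.
  by move=> y _; rewrite normrM ler_wpM2l.
rewrite RintegralZr// ler_wpM2r//; first exact: le_trans (fB 0).
have N1 : (-1 : R) != 0 by rewrite oppr_eq0 oner_neq0.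
have mabs : measurable_fun setT (fun y => `|p y|) by exact: measurableT_comp.
have := Rintegral_affine x N1 mabs; rewrite normrN1 expr1n invr1 mul1r => <-.
rewrite le_eqVlt; apply/orP; left; apply/eqP.
by apply: eq_Rintegral => y _; rewrite scaleN1r addrC.
Qed.

(** Fubini, then the translation [x = z + y]; [e] stands for the cosine or the
    sine. *)
Let transform_rconv (e : R -> R) xi : measurable_fun setT e -> (forall t, `|e t| <= 1) ->
  \int[mu]_x (rconv p f x * e (dotv xi x)) =
  \int[mu]_y (f y * \int[mu]_z (p z * e (dotv xi z + dotv xi y))).
Proof.
move=> me e1.
have med : measurable_fun setT (fun x : V => e (dotv xi x)).
  by apply: (measurableT_comp me); exact: measurable_dotv.
pose G (z : V * V) := F z * e (dotv xi z.1).
have iG : (mu \x mu)%E.-integrable setT (EFin \o G).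
  apply: (integrable_mul_bounded integrable_F) => [|z]; last exact: e1.
  exact: (measurableT_comp med measurable_fst).
have iG1 x : mu.-integrable setT (EFin \o (fun y => G (x, y))).
  exact: (integrable_mul_bounded (integrable_rconv_integrand x)
    (measurable_cst (e (dotv xi x))) (fun=> e1 _)).
have iG2 y : mu.-integrable setT (EFin \o (fun x => G (x, y))).
  exact: (integrable_mul_bounded (integrable_F1 y) med (fun=> e1 _)).
transitivity (\int[mu]_x \int[mu]_y G (x, y)).
  apply: eq_Rintegral => x _; rewrite /rconv -RintegralZr//.
  exact: integrable_rconv_integrand.
rewrite (Rintegral_swap iG iG1 iG2); apply: eq_Rintegral => y _.
have ipe : mu.-integrable setT (EFin \o (fun x => p (x - y) * e (dotv xi x))).
  exact: (integrable_mul_bounded (integrable_shift y) med (fun=> e1 _)).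
transitivity (f y * \int[mu]_x (p (x - y) * e (dotv xi x))).
  rewrite -RintegralZl//; apply: eq_Rintegral => x _; rewrite /G /F/=; ring.
congr (_ * _).
have := Rintegral_affine y (oner_neq0 R) (integrable_measurable ipe).
rewrite normr1 expr1n invr1 mul1r => <-.
apply: eq_Rintegral => z _; rewrite scale1r addrK; congr (_ * e _).
by rewrite dotvC dotvDl !(dotvC xi).
Qed.

Let cos_rconv xi : cos_transform (rconv p f) xi =
  cos_transform p xi * cos_transform f xi - sin_transform p xi * sin_transform f xi.
Proof.
rewrite {1}/cos_transform transform_rconv; last 2 first.
- exact: measurable_cos.
- exact: normr_cos_le1.
have ic := integrable_cos_dotv xi ip; have isin := integrable_sin_dotv xi ip.
have fc := integrable_cos_dotv xi intf; have fs := integrable_sin_dotv xi intf.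
transitivity (\int[mu]_y (cos_transform p xi * (f y * cos (dotv xi y)) -
    sin_transform p xi * (f y * sin (dotv xi y)))).
  apply: eq_Rintegral => y _.
  transitivity (f y * \int[mu]_z (p z * cos (dotv xi z) * cos (dotv xi y) -
      p z * sin (dotv xi z) * sin (dotv xi y))).
    by congr (_ * _); apply: eq_Rintegral => z _; rewrite cosD; ring.
  rewrite RintegralB//; last 2 first.
  - exact: (integrableZr measurableT _ ic).
  - exact: (integrableZr measurableT _ isin).
  by rewrite !RintegralZr// -/(cos_transform p xi) -/(sin_transform p xi); ring.
rewrite RintegralB//; last 2 first.
- exact: (integrableZl measurableT _ fc).
- exact: (integrableZl measurableT _ fs).
by rewrite !RintegralZl.
Qed.

Let sin_rconv xi : sin_transform (rconv p f) xi =
  sin_transform p xi * cos_transform f xi + cos_transform p xi * sin_transform f xi.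
Proof.
rewrite {1}/sin_transform transform_rconv; last 2 first.
- exact: measurable_sin.
- exact: normr_sin_le1.
have ic := integrable_cos_dotv xi ip; have isin := integrable_sin_dotv xi ip.
have fc := integrable_cos_dotv xi intf; have fs := integrable_sin_dotv xi intf.
transitivity (\int[mu]_y (sin_transform p xi * (f y * cos (dotv xi y)) +
    cos_transform p xi * (f y * sin (dotv xi y)))).
  apply: eq_Rintegral => y _.
  transitivity (f y * \int[mu]_z (p z * sin (dotv xi z) * cos (dotv xi y) +
      p z * cos (dotv xi z) * sin (dotv xi y))).
    by congr (_ * _); apply: eq_Rintegral => z _; rewrite sinD; ring.
  rewrite RintegralD//; last 2 first.
  - exact: (integrableZr measurableT _ isin).
  - exact: (integrableZr measurableT _ ic).
  by rewrite !RintegralZr// -/(cos_transform p xi) -/(sin_transform p xi); ring.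
rewrite RintegralD//; last 2 first.
- exact: (integrableZl measurableT _ fc).
- exact: (integrableZl measurableT _ fs).
by rewrite !RintegralZl.
Qed.

(** The modulus of a product of complex numbers is the product of the moduli. *)
Lemma power_spectrum_rconv xi :
  power_spectrum (rconv p f) xi = power_spectrum p xi * power_spectrum f xi.
Proof. by rewrite /power_spectrum cos_rconv sin_rconv; ring. Qed.

End bounded.

Lemma integrable_rdilate p (t : R) : 0 < t -> mu.-integrable setT (EFin \o p) ->
  mu.-integrable setT (EFin \o rdilate p t).
Proof.
move=> t0 ip; have t1 : t^-1 != 0 by rewrite invr_eq0 gt_eqF.
have := integrableZl measurableT (t ^- n) (integrable_affine 0 t1 ip).
congr (integrable _ _ _); apply/funext => x /=.
by rewrite addr0 -EFinM.
Qed.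

Let transform_rdilate (e : R -> R) p (t : R) xi : 0 < t ->
  measurable_fun setT e -> (forall t, `|e t| <= 1) ->
  mu.-integrable setT (EFin \o p) ->
  \int[mu]_x (rdilate p t x * e (dotv xi x)) =
  \int[mu]_x (p x * e (dotv (t *: xi) x)).
Proof.
move=> t0 me e1 ip; have t1 : t^-1 != 0 by rewrite invr_eq0 gt_eqF.
have i1 : mu.-integrable setT (EFin \o (fun x => p x * e (dotv (t *: xi) x))).
  apply: (integrable_mul_bounded ip) => [|x]; last exact: e1.
  by apply: (measurableT_comp me); exact: measurable_dotv.
have := Rintegral_affine 0 t1 (integrable_measurable i1).
move=> /(congr1 (fun a => t ^- n * a)).
have tn : t ^+ n != 0 by rewrite expf_neq0// gt_eqF.
rewrite gtr0_norm ?invr_gt0// exprVn invrK mulKf// => <-.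
rewrite -RintegralZl//; last first.
  by have := integrable_affine 0 t1 i1.
apply: eq_Rintegral => x _; rewrite /rdilate addr0 mulrA; congr (_ * e _).
by rewrite dotvZl [dotv xi (_ *: _)]dotvC dotvZl mulrA divff ?gt_eqF// mul1r dotvC.
Qed.

Lemma power_spectrum_rdilate p (t : R) xi : 0 < t ->
  mu.-integrable setT (EFin \o p) ->
  power_spectrum (rdilate p t) xi = power_spectrum p (t *: xi).
Proof.
move=> t0 ip; rewrite /power_spectrum /cos_transform /sin_transform.
rewrite (transform_rdilate _ t0 measurable_cos normr_cos_le1 ip).
by rewrite (transform_rdilate _ t0 measurable_sin normr_sin_le1 ip).
Qed.

End convolution_theorem.

(** * The multiplier estimate *)

Section laplace_cosine.
Context {R : realType}.
Implicit Types (l s : R).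

(** The Laplace transform at [l] of [fun t => cos (t * s)]. *)
Definition laplace_cos (l s : R) : R := l / (l ^+ 2 + s ^+ 2).

Lemma measurable_laplace_cos :
  measurable_fun setT (fun w : R * R => laplace_cos w.1 w.2).
Proof.
rewrite (_ : (fun w => _) = fun w : R * R =>
    w.1 * ((w.1 ^+ 2 + w.2 ^+ 2) `^ (-1))); last first.
  by apply/funext => w; rewrite powR_inv1// addr_ge0 ?sqr_ge0.
apply: measurable_funM; first exact: measurable_fst.
apply: (measurableT_comp (measurable_powR (-1))).
by apply: measurable_funD; apply: measurable_funX; [exact: measurable_fst|exact: measurable_snd].
Qed.

Lemma laplace_cos_bound l s : 0 < l -> `|laplace_cos l s| <= l^-1.
Proof.
move=> l0; rewrite ger0_norm; last by rewrite divr_ge0 ?addr_ge0 ?sqr_ge0 ?ltW.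
rewrite ler_pdivrMr ?ltr_wpDr ?sqr_ge0 ?exprn_gt0//.
by rewrite expr2 mulrDr mulrA mulVf ?gt_eqF// mul1r lerDl mulr_ge0 ?invr_ge0 ?sqr_ge0 ?ltW.
Qed.

End laplace_cosine.

Section multiplier.
Context {R : realType} {n : nat}.
Local Notation V := 'rV[R]_n.
Local Notation mu := (@lebesgue_rV R n).
Local Notation mu2 := (prodm mu mu).
Local Notation lam := (@lebesgue_measure R).
Local Notation D := `]0%R, +oo[%classic.
Variables (p : V -> R).
Hypothesis ip : mu.-integrable setT (EFin \o p).

Let mp : measurable_fun setT p. Proof. exact: integrable_measurable ip. Qed.

Let pp (z : V * V) := p z.1 * p z.2.

Let ipp : mu2.-integrable setT (EFin \o pp).
Proof. exact: integrable_tensor. Qed.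

Let mpp : measurable_fun setT pp.
Proof. exact: integrable_measurable ipp. Qed.

Let s xi (z : V * V) := dotv xi (z.1 - z.2).

Let ms xi : measurable_fun setT (s xi). Proof. exact: measurable_dotvB. Qed.

Let measurable_mult_s l xi : measurable_fun setT (fun z => laplace_cos l (s xi z)).
Proof.
have mls : measurable_fun setT (fun z : V * V => (l, s xi z)).
  exact: measurable_fun_pair.
exact: (measurableT_comp measurable_laplace_cos mls).
Qed.

Let integrable_pp_mult l xi : 0 < l ->
  mu2.-integrable setT (EFin \o (fun z => pp z * laplace_cos l (s xi z))).
Proof.
move=> l0; apply: (integrable_mul_bounded ipp (measurable_mult_s l xi)) => z.
exact: laplace_cos_bound.
Qed.

Let measurable_ps xi : measurable_fun setT (fun t : R => power_spectrum p (t *: xi)).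
Proof.
apply: (measurableT_comp (measurable_power_spectrum mp)).
exact: measurable_rVZ.
Qed.

(** Fubini and the Laplace transform of the cosine. *)
Let laplace l xi : 0 < l ->
  (\int[lam]_(t in D) (expR (- (l * t)) * power_spectrum p (t *: xi))%:E =
   (\int[mu2]_z (pp z * laplace_cos l (s xi z)))%:E)%E.
Proof.
move=> l0; have mD : measurable (D : set (measurableTypeR R)) by exact: measurable_itv.
pose e : R -> R := (fun t => expR (- (l * t))) \_ D.
have ie : lam.-integrable setT (EFin \o e).
  by rewrite /e -restrict_EFin; apply/(integrable_mkcond _ mD); exact: integrable_expRN.
have me : measurable_fun setT e by exact: integrable_measurable ie.
pose F (w : R * (V * V)) := e w.1 * (pp w.2 * cos (w.1 * s xi w.2)).
have mcos : measurable_fun setT (fun w : R * (V * V) => cos (w.1 * s xi w.2)).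
  apply: (measurableT_comp measurable_cos); apply: measurable_funM.
    exact: measurable_fst.
  exact: (measurableT_comp (ms xi) measurable_snd).
have iF : (lam \x mu2)%E.-integrable setT (EFin \o F).
  have iep := @integrable_prodM _ _ _ _ R lam mu2 _ _ ie ipp.
  have := integrable_mul_bounded iep mcos (fun=> normr_cos_le1 _).
  by under [X in EFin \o X]eq_fun do rewrite -mulrA.
have icos t : mu2.-integrable setT (EFin \o (fun z => pp z * cos (t * s xi z))).
  apply: (integrable_mul_bounded ipp _ (fun=> normr_cos_le1 _)).
  by apply: (measurableT_comp measurable_cos); exact: measurable_funM.
have iF1 t : mu2.-integrable setT (EFin \o (fun z => F (t, z))).
  exact: (integrableZl measurableT (e t) (icos t)).
have iec z : lam.-integrable setT (EFin \o (fun t => e t * cos (t * s xi z))).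
  exact: (integrable_mul_bounded ie (measurable_cos_mul _) (fun=> normr_cos_le1 _)).
have iF2 z : lam.-integrable setT (EFin \o (fun t => F (t, z))).
  have := integrableZl measurableT (pp z) (iec z).
  congr (integrable _ _ _); apply/funext => t /=; rewrite -EFinM.
  by congr EFin; rewrite /F/=; ring.
have FE t : \int[mu2]_z F (t, z) = e t * power_spectrum p (t *: xi).
  rewrite power_spectrumE// -RintegralZl//.
    by apply: eq_Rintegral => z _; rewrite /F/= /s dotvZl.
  by have := icos t; under [X in EFin \o X]eq_fun do rewrite /s -dotvZl.
have iE := integrable_Rintegral iF iF1.
transitivity (\int[lam]_t (e t * power_spectrum p (t *: xi))%:E)%E.
  rewrite integral_mkcond; apply: eq_integral => t _; rewrite /e !patchE.
  by case: ifP => _; rewrite ?mul0r.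
transitivity ((\int[lam]_t \int[mu2]_z F (t, z))%:E).
  by rewrite (EFin_Rintegral measurableT iE); apply: eq_integral => t _; rewrite FE.
rewrite (Rintegral_swap iF iF1 iF2); congr EFin; apply: eq_Rintegral => z _.
rewrite /laplace_cos -(Rintegral_expRN_cos (s xi z) l0) [in RHS]Rintegral_mkcond.
transitivity (pp z * \int[lam]_t (e t * cos (t * s xi z))).
  by rewrite -RintegralZl//; apply: eq_Rintegral => t _; rewrite /F/=; ring.
congr (_ * _); apply: eq_Rintegral => t _; rewrite /e !patchE.
by case: ifP => _; rewrite ?mul0r.
Qed.

(** The power spectrum does not see constants added to the kernel, because [p] has
    mean zero: the kernel at [c] may be subtracted before taking absolute values. *)
Let laplace_le l xi c : 0 < l -> \int[mu]_x p x = 0 ->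
  (\int[lam]_(t in D) (expR (- (l * t)) * power_spectrum p (t *: xi))%:E <=
   \int[mu2]_z (`|pp z| * `|laplace_cos l (s xi z) - laplace_cos l c|)%:E)%E.
Proof.
move=> l0 p0; rewrite laplace//.
have i1 := integrable_pp_mult xi l0.
have i2 : mu2.-integrable setT (EFin \o (fun z => pp z * laplace_cos l c)).
  by have := integrableZr measurableT (laplace_cos l c) ipp.
pose G z := pp z * laplace_cos l (s xi z) - pp z * laplace_cos l c.
have iG : mu2.-integrable setT (EFin \o G) by exact: (integrableB measurableT i1 i2).
have -> : \int[mu2]_z (pp z * laplace_cos l (s xi z)) = \int[mu2]_z G z.
  rewrite RintegralB// RintegralZr//.
  have -> : \int[mu2]_z pp z = 0.
    by rewrite /pp (@Rintegral_prodM _ _ _ _ R mu mu _ _ ip ip) p0 mul0r.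
  by rewrite mul0r subr0.
apply: (@le_trans _ _ (\int[mu2]_z `|G z|)%:E).
  by rewrite lee_fin (le_trans (ler_norm _))// le_normr_Rintegral.
rewrite EFin_Rintegral//; last exact: integrable_norm.
rewrite le_eqVlt; apply/orP; left; apply/eqP; apply: eq_integral => z _.
by rewrite /G -mulrBr normrM.
Qed.

(** At [a = 0] the left side diverges, in accordance with [lne 0 = -oo]. *)
Lemma integral_laplace_cos_le (a c : R) : 0 < c ->
  (\int[lam]_(l in D) `|laplace_cos l a - laplace_cos l c|%:E <=
   `|lne (`|a| / c)%:E|)%E.
Proof.
move=> c0; have [->|a0] := eqVneq a 0.
  by rewrite normr0 mul0r /= lexx /= leey.
have a1 : 0 < `|a| by rewrite normr_gt0.
have ac : (`|a| / c <= 0) = false by rewrite leNgt divr_gt0.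
rewrite /= ac /= -(integral_laplace_cos_diff a1 c0).
rewrite le_eqVlt; apply/orP; left; apply/eqP; apply: eq_integral => l _.
by rewrite /laplace_cos real_normK ?num_real.
Qed.

(** Write [1 / t] as the integral of [expR (- (l * t))] over [l], so that Tonelli
    brings in the Laplace transforms. The comparison value [c = |xi|] turns the
    logarithm of [|dotv xi (x - y)| / c] into the one of the log energy at the unit
    vector [xi / |xi|]. *)
Lemma multiplier_le (L : \bar R) : \int[mu]_x p x = 0 -> (0 <= L)%E ->
  (forall xi, enorm xi = 1 ->
    (\int[(mu \x mu)%E]_z (`|p z.1 * p z.2|%:E * `| lne `|dotv xi (z.1 - z.2)|%:E |)
      <= L)%E) ->
  forall xi, (\int[lam]_(t in D) (power_spectrum p (t *: xi) / t)%:E <= L)%E.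
Proof.
move=> p0 L0 HL xi.
have mD : measurable (D : set (measurableTypeR R)) by exact: measurable_itv.
pose c := enorm xi.
have [c0|c0] := leP c 0.
  (* at the origin the power spectrum is the square of the integral of p *)
  have xi0 : xi = 0.
    have : dotv xi xi <= 0.
      by rewrite -[leRHS]/0 -sqrtr_eq0 eq_le c0 sqrtr_ge0.
    move=> xx; apply/rowP => i; rewrite mxE; apply/eqP; rewrite -sqrf_eq0 eq_le sqr_ge0 andbT.
    apply: le_trans xx; rewrite /dotv (bigD1 i)//= -expr2 lerDl sumr_ge0// => j _.
    by rewrite -expr2 sqr_ge0.
  rewrite (_ : (\int[lam]_(t in D) _)%E = 0%E)//; apply: integral0_eq => t _.
  rewrite xi0 scaler0 /power_spectrum /cos_transform /sin_transform.
  have -> : \int[mu]_x (p x * cos (dotv 0 x)) = 0.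
    rewrite -[RHS]p0; apply: eq_Rintegral => x _.
    by rewrite /dotv big1 ?cos0 ?mulr1// => i _; rewrite mxE mul0r.
  have -> : \int[mu]_x (p x * sin (dotv 0 x)) = 0.
    rewrite /Rintegral integral0_eq// => x _.
    by rewrite /dotv big1 ?sin0 ?mulr0// => i _; rewrite mxE mul0r.
  by rewrite expr0n addr0 mul0r.
have c1 : enorm (c^-1 *: xi) = 1.
  rewrite /enorm dotvZl dotvC dotvZl mulrA -expr2 sqrtrM ?sqr_ge0// sqrtr_sqr.
  by rewrite gtr0_norm ?invr_gt0// mulVf// gt_eqF.
apply: le_trans (HL _ c1).
pose G (w : R * R) := (expR (- (w.2 * w.1)) * power_spectrum p (w.1 *: xi))%:E.
have G0 w : (0 <= G w)%E by rewrite lee_fin mulr_ge0 ?expR_ge0 ?power_spectrum_ge0.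
have mG : measurable_fun setT G.
  apply/measurable_EFinP; apply: measurable_funM.
    apply: measurableT_comp => //; apply: measurable_funN.
    by apply: measurable_funM; [exact: measurable_snd|exact: measurable_fst].
  exact: (measurableT_comp (measurable_ps xi) measurable_fst).
have -> : (\int[lam]_(t in D) (power_spectrum p (t *: xi) / t)%:E =
    \int[lam]_(t in D) \int[lam]_(l in D) G (t, l))%E.
  apply: eq_integral => t; rewrite inE/= in_itv/= andbT => t0.
  under eq_integral => l _ do rewrite /G/= EFinM (mulrC l).
  have me : measurable_fun (D : set R) (fun l : R => (expR (- (t * l)))%:E).
    by apply/measurable_EFinP; apply: measurable_funTS; exact: measurable_expRN_mul.
  rewrite ge0_integralZr ?lee_fin ?power_spectrum_ge0//.
  by rewrite integral_expRN// -EFinM mulrC.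
rewrite (@tonelli_setX _ _ _ _ R lam lam D D G mD mD mG G0).
pose H (w : R * (V * V)) :=
  (`|pp w.2| * `|laplace_cos w.1 (s xi w.2) - laplace_cos w.1 c|)%:E.
have H0 w : (0 <= H w)%E by rewrite lee_fin mulr_ge0.
have mH : measurable_fun setT H.
  apply/measurable_EFinP; apply: measurable_funM.
    apply: measurableT_comp => //; exact: (measurableT_comp mpp measurable_snd).
  have m1 : measurable_fun setT (fun w : R * (V * V) => (w.1, s xi w.2)).
    apply: measurable_fun_pair; first exact: measurable_fst.
    exact: (measurableT_comp (ms xi) measurable_snd).
  have m2 : measurable_fun setT (fun w : R * (V * V) => (w.1, c)).
    by apply: measurable_fun_pair => //; exact: measurable_fst.
  apply: measurableT_comp => //; apply: measurable_funB.
    exact: (measurableT_comp measurable_laplace_cos m1).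
  exact: (measurableT_comp measurable_laplace_cos m2).
apply: (@le_trans _ _ (\int[lam]_(l in D) \int[mu2]_z H (l, z))%E).
  apply: ge0_le_integral => //.
  - by move=> l _; apply: integral_ge0.
  - apply: measurable_funTS.
    exact: (@measurable_integral_fst _ _ _ _ R lam D G mD mG G0).
  - apply: measurable_funTS.
    exact: (@measurable_fun_fubini_tonelli_F _ _ _ _ R mu2 H mH H0).
  move=> l; rewrite /= in_itv/= andbT => l0; exact: laplace_le.
rewrite (@tonelli_setX _ _ _ _ R lam mu2 D setT H mD measurableT mH H0).
apply: ge0_le_integral => //.
- by move=> z _; apply: integral_ge0.
- exact: (@measurable_integral_fst _ _ _ _ R lam D H mD mH H0).
- apply: emeasurable_funM.
    by apply/measurable_EFinP; apply: measurableT_comp => //; exact: mpp.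
  apply: measurableT_comp => //; apply: (measurableT_comp (@measurable_lne_EFin R)).
  by apply: measurableT_comp => //; exact: ms.
move=> z _.
under eq_integral do rewrite /H/= EFinM.
rewrite ge0_integralZl_EFin//; last first.
  have m1 : measurable_fun setT (fun l : R => (l, s xi z)) by exact: measurable_fun_pair.
  have m2 : measurable_fun setT (fun l : R => (l, c)) by exact: measurable_fun_pair.
  apply/measurable_EFinP; apply: measurable_funTS; apply: measurableT_comp => //.
  apply: measurable_funB.
    exact: (measurableT_comp measurable_laplace_cos m1).
  exact: (measurableT_comp measurable_laplace_cos m2).
rewrite lee_wpmul2l ?lee_fin// (le_trans (integral_laplace_cos_le _ c0))//.
by rewrite dotvZl normrM gtr0_norm ?invr_gt0// mulrC.
Qed.

End multiplier.

(** * The square function of real functions *)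

Section real_case.
Context {R : realType} {n : nat}.
Local Notation V := 'rV[R]_n.
Local Notation mu := (@lebesgue_rV R n).
Local Notation lam := (@lebesgue_measure R).
Local Notation D := `]0%R, +oo[%classic.
Local Notation M := ((2 * pi) ^+ n : R).

Lemma measurable_rdilateB (r : V -> R) : measurable_fun setT r ->
  measurable_fun setT (fun w : (V * R) * V => rdilate r w.1.2 (w.1.1 - w.2)).
Proof.
move=> mr.
have m12 : measurable_fun setT (fun w : (V * R) * V => (w.1.2)^-1).
  apply: (measurableT_comp (@measurable_invr R)).
  exact: (measurableT_comp measurable_snd measurable_fst).
have m11 : measurable_fun setT (fun w : (V * R) * V => w.1.1).
  exact: (measurableT_comp measurable_fst measurable_fst).
apply: measurable_funM.
  under eq_fun do rewrite -exprVn.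
  exact: measurable_funX.
apply: (measurableT_comp mr); apply: measurable_rVZ => //.
by apply: measurable_rVB => //; exact: measurable_snd.
Qed.

Lemma measurable_rconv_rdilate (p f : V -> R) :
  measurable_fun setT p -> measurable_fun setT f ->
  measurable_fun setT (fun z : V * R => rconv (rdilate p z.2) f z.1).
Proof.
move=> mp mf.
apply: (@measurable_Rintegral _ _ _ _ R mu
  (fun w : (V * R) * V => rdilate p w.1.2 (w.1.1 - w.2) * f w.2)).
apply: measurable_funM; first exact: measurable_rdilateB.
exact: (measurableT_comp mf measurable_snd).
Qed.

(** Plancherel in [x] for every [t], Tonelli, the multiplier estimate for every
    frequency, and Plancherel back. Each of the two inequalities that make up
    Plancherel is used once. *)
Lemma real_square_function_le (p f : V -> R) (B L : R) :
  mu.-integrable setT (EFin \o p) -> mu.-integrable setT (EFin \o f) ->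
  (forall x, `|f x| <= B) -> \int[mu]_x p x = 0 -> 0 <= L ->
  (forall xi, enorm xi = 1 ->
    (\int[(mu \x mu)%E]_z (`|p z.1 * p z.2|%:E * `| lne `|dotv xi (z.1 - z.2)|%:E |)
      <= L%:E)%E) ->
  (\int[mu]_x \int[lam]_(t in D) (rconv (rdilate p t) f x ^+ 2 / t)%:E <=
   L%:E * \int[mu]_x (f x ^+ 2)%:E)%E.
Proof.
move=> ip intf fB p0 L0 HL.
have mD : measurable (D : set (measurableTypeR R)) by exact: measurable_itv.
have mp := integrable_measurable ip; have mf := integrable_measurable intf.
have M0 : 0 < M by rewrite exprn_gt0// mulr_gt0// pi_gt0.
pose u t := rconv (rdilate p t) f.
(* with |t| instead of t the integrand is nonnegative on the whole line *)
pose F (z : V * R) := (u z.2 z.1 ^+ 2 / `|z.2|)%:E.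
have F0 z : (0 <= F z)%E by rewrite lee_fin divr_ge0 ?sqr_ge0.
have minv : measurable_fun setT (fun t : R => `|t|^-1).
  apply: (measurableT_comp (@measurable_invr R)).
  exact: normr_measurable.
have mF : measurable_fun setT F.
  apply/measurable_EFinP; apply: measurable_funM.
    by apply: measurable_funX; exact: measurable_rconv_rdilate.
  exact: (measurableT_comp minv measurable_snd).
rewrite (_ : (\int[mu]_x _)%E = (\int[mu]_(x in setT) \int[lam]_(t in D) F (x, t))%E); last first.
  apply: eq_integral => x _; apply: eq_integral => t.
  by rewrite inE/= in_itv/= andbT => t0; rewrite /F/= gtr0_norm.
rewrite (@tonelli_setX _ _ _ _ R mu lam setT D F measurableT mD mF F0).
rewrite -(@lee_pmul2l _ M%:E)//.
pose P := power_spectrum p; pose Q := power_spectrum f.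
have mP : measurable_fun setT P by exact: measurable_power_spectrum.
have mQ : measurable_fun setT Q by exact: measurable_power_spectrum.
pose G (w : R * V) := (P (w.1 *: w.2) * Q w.2 / `|w.1|)%:E.
have G0 w : (0 <= G w)%E.
  by rewrite lee_fin divr_ge0// mulr_ge0// power_spectrum_ge0.
have mG : measurable_fun setT G.
  apply/measurable_EFinP; apply: measurable_funM; last first.
    exact: (measurableT_comp minv measurable_fst).
  apply: measurable_funM; last exact: (measurableT_comp mQ measurable_snd).
  apply: (measurableT_comp mP).
  by apply: measurable_rVZ; [exact: measurable_fst|exact: measurable_snd].
have mFt : measurable_fun setT (fun t => \int[mu]_x F (x, t))%E.
  exact: (@measurable_integral_fst _ _ _ _ R mu setT F measurableT mF F0).
apply: (@le_trans _ _ (\int[lam]_(t in D) \int[mu]_xi G (t, xi))%E).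
  have F1 t : D t -> (0 <= \int[mu]_x F (x, t))%E by move=> _; exact: integral_ge0.
  rewrite -ge0_integralZl_EFin//; [|exact: measurable_funTS|exact: ltW].
  apply: ge0_le_integral => //.
  - by move=> t Dt; rewrite mule_ge0 ?F1// lee_fin ltW.
  - by apply: measurable_funTS; exact: emeasurable_funM.
  - apply: measurable_funTS.
    exact: (@measurable_fun_fubini_tonelli_F _ _ _ _ R mu G mG G0).
  move=> t; rewrite /= in_itv/= andbT => t0.
  have ipt := integrable_rdilate t0 ip.
  have iu := integrable_rconv ipt intf fB.
  have mut := integrable_measurable iu.
  have Hpl := plancherel_ge iu (rconv_bounded ipt intf fB).
  have t1 : 0 <= t^-1 by rewrite invr_ge0 ltW.
  have -> : (\int[mu]_x F (x, t) = (t^-1)%:E * \int[mu]_x (u t x ^+ 2)%:E)%E.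
    rewrite -ge0_integralZl_EFin//.
    - by apply: eq_integral => x _; rewrite /F/= gtr0_norm// -EFinM mulrC.
    - by move=> x _; rewrite lee_fin sqr_ge0.
    - by apply/measurable_EFinP; exact: measurable_funX.
  have -> : (\int[mu]_xi G (t, xi) =
      (t^-1)%:E * \int[mu]_xi (power_spectrum (u t) xi)%:E)%E.
    rewrite -ge0_integralZl_EFin//.
    - apply: eq_integral => xi _; rewrite /G/= gtr0_norm// -EFinM mulrC.
      by rewrite (power_spectrum_rconv ipt intf fB) power_spectrum_rdilate.
    - by move=> xi _; rewrite lee_fin power_spectrum_ge0.
    - by apply/measurable_EFinP; exact: measurable_power_spectrum.
  by rewrite muleCA lee_wpmul2l ?lee_fin.
rewrite (@tonelli_setX _ _ _ _ R lam mu D setT G mD measurableT mG G0).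
apply: (@le_trans _ _ (\int[mu]_xi (L%:E * (Q xi)%:E))%E).
  apply: ge0_le_integral => //.
  - by move=> xi _; exact: integral_ge0.
  - exact: (@measurable_integral_fst _ _ _ _ R lam D G mD mG G0).
  - by apply: emeasurable_funM => //; exact/measurable_EFinP.
  move=> xi _.
  have Q0 : (0 <= (Q xi)%:E)%E by rewrite lee_fin power_spectrum_ge0.
  have := multiplier_le ip p0 (L := L%:E) L0 HL xi.
  move=> /(lee_wpmul2l Q0); rewrite [(_ * L%:E)%E]muleC -ge0_integralZl//; last 2 first.
  - apply/measurable_EFinP; apply: measurable_funTS; apply: measurable_funM.
      by apply: (measurableT_comp mP); exact: measurable_rVZ.
    exact: measurable_invr.
  - by move=> t; rewrite /= in_itv/= andbT => t0;
      rewrite lee_fin divr_ge0 ?power_spectrum_ge0 ?ltW.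
  apply: le_trans; rewrite le_eqVlt; apply/orP; left; apply/eqP.
  apply: eq_integral => t; rewrite inE/= in_itv/= andbT => t0.
  by rewrite -EFinM /G/= gtr0_norm// -/P; congr EFin; ring.
have Q0 xi : (0 <= (Q xi)%:E)%E by rewrite lee_fin power_spectrum_ge0.
rewrite ge0_integralZl_EFin//; last exact/measurable_EFinP.
rewrite muleCA lee_wpmul2l//.
exact: plancherel_le.
Qed.

End real_case.

Section truncation.
Context {d : measure_display} {T : measurableType d} {R : realType}.
Variable m : {measure set T -> \bar R}.

Lemma limn_einf_ge0 (a : nat -> \bar R) : (forall k, 0 <= a k)%E ->
  (0 <= limn_einf a)%E.
Proof.
move=> a0; rewrite limn_einf_lim; apply: lime_ge; first exact: is_cvg_einfs.
apply: nearW => k; apply: le_ereal_inf_tmp => _ [j _ <-]; exact: a0.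
Qed.

Lemma Rintegral_nonintegrable (g : T -> R) : measurable_fun setT g ->
  ~ m.-integrable setT (EFin \o g) -> \int[m]_x g x = 0.
Proof.
move=> mg ng; rewrite /Rintegral.
have : ~~ ((\int[m]_x (g x)%:E)%E \is a fin_num).
  apply/negP; rewrite -integral_fin_num_abs// => goo; apply: ng.
  by apply/integrableP; split; first exact/measurable_EFinP.
by case: integral.
Qed.

(** Dominated convergence when [g] is integrable. Otherwise the integral of [g] has
    the default value 0 and the inequality is trivial, so that nothing need be known
    about the convergence of a convolution. *)
Lemma sqr_Rintegral_le_liminf (g : T -> R) (B : nat -> set T) (c : R) :
  measurable_fun setT g -> (forall k, measurable (B k)) ->
  (forall x, \forall k \near \oo, B k x) -> 0 <= c ->
  (((\int[m]_x g x) ^+ 2 * c)%:E <=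
   limn_einf (fun k => ((\int[m]_x (g \_ (B k)) x) ^+ 2 * c)%:E))%E.
Proof.
move=> mg mB Bx c0.
have [ig|ng] := pselect (m.-integrable setT (EFin \o g)); last first.
  rewrite Rintegral_nonintegrable// expr0n/= mul0r.
  by apply: limn_einf_ge0 => k; rewrite lee_fin mulr_ge0 ?sqr_ge0.
have mgB k : measurable_fun setT (g \_ (B k)).
  by apply/(measurable_restrictT _ (mB k)); exact: measurable_funTS.
have gBle k x : `|(g \_ (B k)) x| <= `|g x|.
  by rewrite patchE; case: ifP => // _; rewrite normr0.
have igB k : m.-integrable setT (EFin \o (g \_ (B k))).
  apply: le_integrable ig => //; first exact/measurable_EFinP.
  by move=> x _; rewrite lee_fin.
have cvI : (\int[m]_x ((g \_ (B k)) x)%:E)%E @[k --> \oo] --> (\int[m]_x (g x)%:E)%E.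
  apply: (@dominated_cvg _ _ _ m setT measurableT _ _ (fun x => `|g x|%:E)) => //.
  - by move=> k; exact/measurable_EFinP.
  - move=> x _; apply: cvg_near_cst; apply: filterS (Bx x) => k Bk.
    by rewrite patchE mem_set.
  - exact: integrable_norm.
  - by move=> k x _; rewrite lee_fin.
rewrite -(EFin_Rintegral measurableT ig) in cvI.
have lim1 : \int[m]_x (g \_ (B k)) x @[k --> \oo] --> \int[m]_x g x.
  exact: (fine_cvg cvI).
have lim2 : (\int[m]_x (g \_ (B k)) x) ^+ 2 * c @[k --> \oo] -->
    (\int[m]_x g x) ^+ 2 * c.
  by apply: cvgM; [rewrite !expr2; exact: cvgM|exact: cvg_cst].
have lim3 : ((\int[m]_x (g \_ (B k)) x) ^+ 2 * c)%:E @[k --> \oo] -->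
    ((\int[m]_x g x) ^+ 2 * c)%:E.
  by apply: cvg_EFin => //; exact: nearW.
by rewrite (cvg_limn_einf_sup lim3).1.
Qed.

End truncation.

Section real_pair.
Context {R : realType} {n : nat}.
Local Notation V := 'rV[R]_n.
Local Notation mu := (@lebesgue_rV R n).
Local Notation lam := (@lebesgue_measure R).
Local Notation D := `]0%R, +oo[%classic.

(** Real and imaginary part of a complex convolution both have this form. It is one
    integral, and not a sum of two, because each summand may fail to be
    integrable. *)
Definition pair_conv (p q f g : V -> R) (t : R) (x : V) : R :=
  \int[mu]_y (rdilate p t (x - y) * f y + rdilate q t (x - y) * g y).

Let mD : measurable (D : set (measurableTypeR R)). Proof. exact: measurable_itv. Qed.

Lemma measurable_pair_conv (p q f g : V -> R) : measurable_fun setT p ->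
  measurable_fun setT q -> measurable_fun setT f -> measurable_fun setT g ->
  measurable_fun setT (fun z : V * R => pair_conv p q f g z.2 z.1).
Proof.
move=> mp mq mf mg.
apply: (@measurable_Rintegral _ _ _ _ R mu (fun w : (V * R) * V =>
  rdilate p w.1.2 (w.1.1 - w.2) * f w.2 + rdilate q w.1.2 (w.1.1 - w.2) * g w.2)).
by apply: measurable_funD; apply: measurable_funM;
  (exact: measurable_rdilateB || exact: (measurableT_comp _ measurable_snd)).
Qed.

Let measurable_abs_integrand (h : V * R -> R) : measurable_fun setT h ->
  measurable_fun setT (fun z : V * R => (h z ^+ 2 / `|z.2|)%:E).
Proof.
move=> mh; apply/measurable_EFinP; apply: measurable_funM; first exact: measurable_funX.
apply: (measurableT_comp (@measurable_invr R)).
by apply: measurableT_comp => //; exact: measurable_snd.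
Qed.

Let abs_integrand_ge0 (h : V * R -> R) z : (0 <= (h z ^+ 2 / `|z.2|)%:E)%E.
Proof. by rewrite lee_fin divr_ge0 ?sqr_ge0. Qed.

Let vertical_energyE (h : V * R -> R) x :
  (\int[lam]_(t in D) (h (x, t) ^+ 2 / t)%:E =
   \int[lam]_(t in D) (h (x, t) ^+ 2 / `|t|)%:E)%E.
Proof.
apply: eq_integral => t; rewrite inE/= in_itv/= andbT => t0.
by rewrite gtr0_norm.
Qed.

Lemma measurable_vertical_energy (h : V * R -> R) : measurable_fun setT h ->
  measurable_fun setT (fun x => \int[lam]_(t in D) (h (x, t) ^+ 2 / t)%:E)%E.
Proof.
move=> mh; under eq_fun do rewrite vertical_energyE.
apply: (@measurable_integral_snd _ _ _ _ R lam D
  (fun z : V * R => (h z ^+ 2 / `|z.2|)%:E) mD).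
  exact: measurable_abs_integrand.
exact: abs_integrand_ge0.
Qed.

Lemma vertical_energy_ge0 (h : V * R -> R) x :
  (0 <= \int[lam]_(t in D) (h (x, t) ^+ 2 / t)%:E)%E.
Proof.
apply: integral_ge0 => t; rewrite /= in_itv/= andbT => t0.
by rewrite lee_fin divr_ge0 ?sqr_ge0 ?ltW.
Qed.

Lemma measurable_vertical_integrand (h : V * R -> R) x : measurable_fun setT h ->
  measurable_fun (D : set R) (fun t : R => (h (x, t) ^+ 2 / t)%:E).
Proof.
move=> mh; apply/measurable_EFinP; apply: measurable_funTS; apply: measurable_funM.
  apply: measurable_funX; apply: (measurableT_comp mh).
  exact: measurable_fun_pair.
exact: measurable_invr.
Qed.

Variables (p q : V -> R) (L : R).
Hypotheses (ip : mu.-integrable setT (EFin \o p))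
  (iq : mu.-integrable setT (EFin \o q)) (L0 : 0 <= L)
  (p0 : \int[mu]_x p x = 0) (q0 : \int[mu]_x q x = 0).
Hypotheses (Lp : forall xi, enorm xi = 1 ->
    (\int[(mu \x mu)%E]_z (`|p z.1 * p z.2|%:E * `| lne `|dotv xi (z.1 - z.2)|%:E |)
      <= L%:E)%E)
  (Lq : forall xi, enorm xi = 1 ->
    (\int[(mu \x mu)%E]_z (`|q z.1 * q z.2|%:E * `| lne `|dotv xi (z.1 - z.2)|%:E |)
      <= L%:E)%E).

Let mp : measurable_fun setT p. Proof. exact: integrable_measurable ip. Qed.
Let mq : measurable_fun setT q. Proof. exact: integrable_measurable iq. Qed.

Let bounded_case f g B :
  mu.-integrable setT (EFin \o f) -> mu.-integrable setT (EFin \o g) ->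
  (forall x, `|f x| <= B) -> (forall x, `|g x| <= B) ->
  (\int[mu]_x \int[lam]_(t in D) (pair_conv p q f g t x ^+ 2 / t)%:E <=
   (2 * L)%:E * (\int[mu]_x (f x ^+ 2)%:E + \int[mu]_x (g x ^+ 2)%:E))%E.
Proof.
move=> intf ig fB gB.
have mf := integrable_measurable intf; have mg := integrable_measurable ig.
pose a (z : V * R) := rconv (rdilate p z.2) f z.1.
pose b (z : V * R) := rconv (rdilate q z.2) g z.1.
have ma : measurable_fun setT a by exact: measurable_rconv_rdilate.
have mb : measurable_fun setT b by exact: measurable_rconv_rdilate.
pose I (h : V * R -> R) x := (\int[lam]_(t in D) (h (x, t) ^+ 2 / t)%:E)%E.
have I0 h x : (0 <= I h x)%E by exact: vertical_energy_ge0.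
have mI h : measurable_fun setT h -> measurable_fun setT (I h).
  by move=> mh; exact: measurable_vertical_energy.
have mpc := measurable_pair_conv mp mq mf mg.
apply: (@le_trans _ _ (\int[mu]_x (2%:E * (I a x + I b x)))%E).
  apply: ge0_le_integral => //.
  - by move=> x _; exact: (I0 (fun z => pair_conv p q f g z.2 z.1)).
  - exact: (mI (fun z => pair_conv p q f g z.2 z.1)).
  - by apply: emeasurable_funM => //; apply: emeasurable_funD; exact: mI.
  move=> x _; rewrite /I.
  have t0P (h : V * R -> R) t : D t -> (0 <= (h (x, t) ^+ 2 / t)%:E)%E.
    by rewrite /= in_itv/= andbT => t0; rewrite lee_fin divr_ge0 ?sqr_ge0 ?ltW.
  have mt (h : V * R -> R) : measurable_fun setT h ->
      measurable_fun (D : set R) (fun t : R => (h (x, t) ^+ 2 / t)%:E).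
    exact: measurable_vertical_integrand.
  have mta := mt _ ma; have mtb := mt _ mb.
  rewrite -ge0_integralD//; [|exact: t0P|exact: t0P].
  rewrite -ge0_integralZl_EFin//; last 2 first.
  - by move=> t Dt; rewrite adde_ge0//; exact: t0P.
  - exact: emeasurable_funD.
  apply: ge0_le_integral => //.
  - exact: (t0P (fun z => pair_conv p q f g z.2 z.1)).
  - exact: (mt (fun z => pair_conv p q f g z.2 z.1)).
  - by apply: emeasurable_funM => //; exact: emeasurable_funD.
  move=> t; rewrite /= in_itv/= andbT => t0.
  have ipt := integrable_rdilate t0 ip; have iqt := integrable_rdilate t0 iq.
  have -> : pair_conv p q f g t x = a (x, t) + b (x, t).
    rewrite /pair_conv RintegralD//.
    - exact: (integrable_rconv_integrand ipt intf fB).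
    - exact: (integrable_rconv_integrand iqt ig gB).
  rewrite -EFinD -EFinM lee_fin -mulrDl mulrA ler_wpM2r ?invr_ge0 ?(ltW t0)//.
  by have := sqr_ge0 (a (x, t) - b (x, t)); nra.
rewrite ge0_integralZl_EFin//; last 2 first.
- by move=> x _; rewrite adde_ge0.
- by apply: emeasurable_funD; exact: mI.
rewrite ge0_integralD//; [|exact: mI|exact: mI].
rewrite EFinM -muleA lee_wpmul2l// ge0_muleDr ?integral_ge0//; last 2 first.
- by move=> x _; rewrite lee_fin sqr_ge0.
- by move=> x _; rewrite lee_fin sqr_ge0.
apply: leeD.
  exact: (real_square_function_le ip intf fB p0 L0 Lp).
exact: (real_square_function_le iq ig gB q0 L0 Lq).
Qed.

(** Truncate [f] and [g] to sets of finite measure where they are bounded, and apply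
    Fatou in [t] and then in [x]. *)
Lemma pair_square_function_le f g :
  measurable_fun setT f -> measurable_fun setT g ->
  (\int[mu]_x \int[lam]_(t in D) (pair_conv p q f g t x ^+ 2 / t)%:E <=
   (2 * L)%:E * (\int[mu]_x (f x ^+ 2)%:E + \int[mu]_x (g x ^+ 2)%:E))%E.
Proof.
move=> mf mg.
have /sigma_finiteP[G [TG ndG Goo]] := sigma_finiteT mu.
pose B k := G k `&` [set x | `|f x| <= k%:R /\ `|g x| <= k%:R].
have mG k : measurable (G k) by have [] := Goo k.
have mle (h : V -> R) k : measurable_fun setT h ->
    measurable [set x | `|h x| <= k%:R].
  move=> mh.
  have mn : measurable_fun setT (fun x => `|h x|) by exact: measurableT_comp.
  have := measurable_fun_ler mn (measurable_cst (k%:R : R)) measurableT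
    (Y := [set true]) I.
  by rewrite setTI.
have mB k : measurable (B k).
  by apply: measurableI => //; apply: measurableI; exact: mle.
have Bx x : \forall k \near \oo, B k x.
  have [N _ xN] : (\bigcup_k G k) x by rewrite -TG.
  pose K := maxn N (maxn (Num.truncn `|f x|).+1 (Num.truncn `|g x|).+1).
  have trunc_le (r : R) k : ((Num.truncn `|r|).+1 <= k)%N -> `|r| <= k%:R.
    move=> rk; have /andP[_ /ltW] := truncn_itv (normr_ge0 r).
    by move=> /le_trans; apply; rewrite ler_nat.
  exists K => // k /= Kk; split.
    have NK : (N <= k)%N by exact: leq_trans (leq_maxl _ _) Kk.
    by move: xN; apply/subsetPset/ndG.
  by split; apply: trunc_le; apply: leq_trans Kk; rewrite !leq_max leqnn ?orbT.
have bB (h : V -> R) k : measurable_fun setT h -> (forall x, B k x -> `|h x| <= k%:R) ->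
    (forall x, `|(h \_ (B k)) x| <= k%:R) /\ mu.-integrable setT (EFin \o (h \_ (B k))).
  move=> mhh hB; split=> [x|].
    rewrite patchE; case: ifPn => [|_]; last by rewrite normr0.
    by rewrite inE; exact: hB.
  rewrite -restrict_EFin; apply/(integrable_mkcond _ (mB k)).
  apply: measurable_bounded_integrable => //.
  - have [_] := Goo k; apply: le_lt_trans.
    by apply: le_measure; rewrite ?inE//; exact: subIsetl.
  - exact: measurable_funTS.
  - exists k%:R; split; rewrite ?num_real// => M kM x Bx'.
    by apply: (le_trans (hB x Bx')); exact: ltW.
have fk k := bB f k mf (fun x Bkx => Bkx.2.1).
have gk k := bB g k mg (fun x Bkx => Bkx.2.2).
pose h (z : V * R) := pair_conv p q f g z.2 z.1.
pose hk k (z : V * R) := pair_conv p q (f \_ (B k)) (g \_ (B k)) z.2 z.1.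
have mh : measurable_fun setT h by exact: measurable_pair_conv.
have mhk k : measurable_fun setT (hk k).
  apply: measurable_pair_conv => //; apply/(measurable_restrictT _ (mB k));
    exact: measurable_funTS.
apply: (@fatou_le _ _ _ mu (fun k x => \int[lam]_(t in D) (hk k (x, t) ^+ 2 / t)%:E)%E).
- by move=> k; exact: measurable_vertical_energy.
- by move=> k x; exact: vertical_energy_ge0.
- exact: (measurable_vertical_energy mh).
- by move=> x; exact: (vertical_energy_ge0 h).
- move=> x.
  apply: (@le_fatou _ _ _ lam D (fun k t => (hk k (x, t) ^+ 2 / t)%:E)
     (fun t => (h (x, t) ^+ 2 / t)%:E) mD).
  + by move=> k; exact: measurable_vertical_integrand.
  + move=> k t; rewrite /= in_itv/= andbT => t0.
    by rewrite lee_fin divr_ge0 ?sqr_ge0 ?ltW.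
  + exact: measurable_vertical_integrand.
  + move=> t; rewrite /= in_itv/= andbT => t0.
    by rewrite lee_fin divr_ge0 ?sqr_ge0 ?ltW.
  move=> t; rewrite /= in_itv/= andbT => t0.
  pose e y := rdilate p t (x - y) * f y + rdilate q t (x - y) * g y.
  have mrB (r : V -> R) : measurable_fun setT r ->
      measurable_fun setT (fun y : V => rdilate r t (x - y)).
    move=> mr; apply: measurable_funM => //; apply: (measurableT_comp mr).
    by apply: measurable_rVZ => //; exact: measurable_rVB.
  have me : measurable_fun setT e.
    by apply: measurable_funD; apply: measurable_funM => //; exact: mrB.
  have := @sqr_Rintegral_le_liminf _ _ R mu e B t^-1 me mB Bx.
  rewrite invr_ge0 (ltW t0) => /(_ isT).
  congr (_ <= limn_einf _)%E; apply/funext => k; congr (_ ^+ 2 / t)%:E.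
  apply: eq_Rintegral => y _; rewrite /e !patchE.
  by case: ifP => // _; rewrite !mulr0 addr0.
move=> k; have [fkB ifk] := fk k; have [gkB igk] := gk k.
apply: (le_trans (bounded_case ifk igk fkB gkB)).
rewrite lee_wpmul2l ?lee_fin ?mulr_ge0//.
have sq_le (r : V -> R) : measurable_fun setT r ->
    (\int[mu]_x ((r \_ (B k)) x ^+ 2)%:E <= \int[mu]_x (r x ^+ 2)%:E)%E.
  move=> mr; apply: ge0_le_integral => //.
  - by move=> x _; rewrite lee_fin sqr_ge0.
  - apply/measurable_EFinP; apply: measurable_funX.
    by apply/(measurable_restrictT _ (mB k)); exact: measurable_funTS.
  - by apply/measurable_EFinP; exact: measurable_funX.
  move=> x _; rewrite lee_fin patchE; case: ifP => // _.
  by rewrite expr0n sqr_ge0.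
by rewrite leeD// sq_le.
Qed.

End real_pair.

(** * The square function of complex functions *)

Section complex_modulus.
Context {R : realType}.
Local Notation normc := (@Normc.normc R).

Lemma normc_sqr (z : R[i]) : normc z ^+ 2 = complex.Re z ^+ 2 + complex.Im z ^+ 2.
Proof. by case: z => a b /=; rewrite sqr_sqrtr// addr_ge0 ?sqr_ge0. Qed.

Lemma normc_ge0 (z : R[i]) : 0 <= normc z.
Proof. by case: z => a b /=; exact: sqrtr_ge0. Qed.

Lemma Re_le_normc (z : R[i]) : `|complex.Re z| <= normc z.
Proof.
case: z => a b /=; rewrite -sqrtr_sqr ler_wsqrtr//.
by rewrite lerDl sqr_ge0.
Qed.

Lemma Im_le_normc (z : R[i]) : `|complex.Im z| <= normc z.
Proof.
case: z => a b /=; rewrite -sqrtr_sqr ler_wsqrtr//.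
by rewrite lerDr sqr_ge0.
Qed.

Lemma measurable_normc d (T : measurableType d) (f : T -> R[i]) :
  Cmeasurable f -> measurable_fun setT (fun x => normc (f x)).
Proof.
move=> [mRe mIm]; rewrite (_ : (fun x => _) = fun x =>
    (complex.Re (f x) ^+ 2 + complex.Im (f x) ^+ 2) `^ 2^-1); last first.
  apply/funext => x; rewrite powR12_sqrt ?addr_ge0 ?sqr_ge0//.
  by rewrite -normc_sqr sqrtr_sqr ger0_norm// normc_ge0.
apply: (measurableT_comp (measurable_powR 2^-1)).
by apply: measurable_funD; exact: measurable_funX.
Qed.

End complex_modulus.

Section complex_square_function.
Context {R : realType} {n : nat}.
Local Notation V := 'rV[R]_n.
Local Notation mu := (@lebesgue_rV R n).
Local Notation lam := (@lebesgue_measure R).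
Local Notation D := `]0%R, +oo[%classic.
Local Notation normc := (@Normc.normc R).
Local Notation Re := (@complex.Re R).
Local Notation Im := (@complex.Im R).
Variable psi : V -> R[i].
Hypotheses (psi1 : CLfun mu 1 psi) (psi0 : Cintegral mu psi = 0)
  (Lpsi : (log_energy psi < +oo)%E).

Let p x := Re (psi x).
Let q x := Im (psi x).

Let mpsi : measurable_fun setT (fun x => normc (psi x)).
Proof. by apply: measurable_normc; case: psi1. Qed.

Let ipsi : mu.-integrable setT (EFin \o (fun x => normc (psi x))).
Proof.
apply: ge0_integrable => //; first by move=> x; exact: normc_ge0.
case: psi1 => _; rewrite /CLnorm Lnorm1.
under eq_integral do rewrite /= ger0_norm ?normc_ge0//.
by [].
Qed.

Let ip : mu.-integrable setT (EFin \o p).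
Proof.
apply: le_integrable ipsi => //.
  by apply/measurable_EFinP; case: psi1 => -[].
by move=> x _; rewrite /= lee_fin (le_trans (Re_le_normc _))// ler_norm.
Qed.

Let iq : mu.-integrable setT (EFin \o q).
Proof.
apply: le_integrable ipsi => //.
  by apply/measurable_EFinP; case: psi1 => -[].
by move=> x _; rewrite /= lee_fin (le_trans (Im_le_normc _))// ler_norm.
Qed.

Let p0 : \int[mu]_x p x = 0. Proof. by case: psi0. Qed.
Let q0 : \int[mu]_x q x = 0. Proof. by case: psi0. Qed.

(* in dimension 0 the unit sphere is empty and the supremum is -oo *)
Let L := Num.max 0 (fine (log_energy psi)).

Let L0 : 0 <= L. Proof. by rewrite le_max lexx. Qed.

Let log_energy_le xi : enorm xi = 1 ->
  (\int[(mu \x mu)%E]_z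
    ((normc (psi z.1 * psi z.2))%:E * `| lne `|dotv xi (z.1 - z.2)|%:E |) <= L%:E)%E.
Proof.
move=> xi1; set I := (X in (X <= _)%E).
have I0 : (0 <= I)%E.
  by apply: integral_ge0 => z _; rewrite mule_ge0// lee_fin normc_ge0.
have IL : (I <= log_energy psi)%E by apply: ereal_sup_ubound; exists xi.
have fL : log_energy psi \is a fin_num.
  by rewrite ge0_fin_numE// (le_trans I0).
by rewrite (le_trans IL)// -(fineK fL) lee_fin /L /= le_max lexx orbT.
Qed.

Let real_log_energy_le (r : V -> R) : measurable_fun setT r ->
  (forall x, `|r x| <= normc (psi x)) -> forall xi, enorm xi = 1 ->
  (\int[(mu \x mu)%E]_z (`|r z.1 * r z.2|%:E * `| lne `|dotv xi (z.1 - z.2)|%:E |)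
      <= L%:E)%E.
Proof.
move=> mr rpsi xi xi1; apply: le_trans (log_energy_le xi1).
have mk : measurable_fun setT (fun z : V * V => `| lne `|dotv xi (z.1 - z.2)|%:E |%E).
  apply: measurableT_comp => //; apply: (measurableT_comp (@measurable_lne_EFin R)).
  by apply: measurableT_comp => //; exact: measurable_dotvB.
apply: ge0_le_integral => //.
- apply: emeasurable_funM => //; apply/measurable_EFinP; apply: measurableT_comp => //.
  by apply: measurable_funM; [exact: (measurableT_comp mr measurable_fst)
                             |exact: (measurableT_comp mr measurable_snd)].
- apply: emeasurable_funM => //; apply/measurable_EFinP.
  under eq_fun do rewrite Normc.normcM.
  by apply: measurable_funM; [exact: (measurableT_comp mpsi measurable_fst)
                             |exact: (measurableT_comp mpsi measurable_snd)].
by move=> z _; rewrite lee_wpmul2r// lee_fin Normc.normcM normrM ler_pM.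
Qed.

Let Re_convolution f t x : Re (convolution (dilation psi t) f x) =
  pair_conv p q (fun y => Re (f y)) (fun y => - Im (f y)) t x.
Proof.
rewrite /convolution /Cintegral /=; apply: eq_Rintegral => y _.
rewrite /dilation /rdilate /p /q.
case: (psi _) => a b; case: (f y) => c e /=; ring.
Qed.

Let Im_convolution f t x : Im (convolution (dilation psi t) f x) =
  pair_conv p q (fun y => Im (f y)) (fun y => Re (f y)) t x.
Proof.
rewrite /convolution /Cintegral /=; apply: eq_Rintegral => y _.
rewrite /dilation /rdilate /p /q.
case: (psi _) => a b; case: (f y) => c e /=; ring.
Qed.

(** The squared modulus of the convolution is the sum of the squares of its real and
    imaginary parts, and each of them contributes [2 * L]. *)
Lemma square_function_energy_le f : Cmeasurable f ->
  (\int[mu]_x \int[lam]_(t in D)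
      (normc (convolution (dilation psi t) f x) ^+ 2 / t)%:E <=
   (4 * L)%:E * \int[mu]_x (normc (f x) ^+ 2)%:E)%E.
Proof.
move=> [mRe mIm]; have mNIm : measurable_fun setT (fun y => - Im (f y)).
  exact: measurable_funN.
have [mp mq] : measurable_fun setT p /\ measurable_fun setT q by case: psi1 => -[].
pose h1 (z : V * R) := pair_conv p q (fun y => Re (f y)) (fun y => - Im (f y)) z.2 z.1.
pose h2 (z : V * R) := pair_conv p q (fun y => Im (f y)) (fun y => Re (f y)) z.2 z.1.
have mh1 : measurable_fun setT h1 by exact: measurable_pair_conv.
have mh2 : measurable_fun setT h2 by exact: measurable_pair_conv.
pose I (h : V * R -> R) x := (\int[lam]_(t in D) (h (x, t) ^+ 2 / t)%:E)%E.
have mI h : measurable_fun setT h -> measurable_fun setT (I h).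
  exact: measurable_vertical_energy.
have I0 h x : (0 <= I h x)%E by exact: vertical_energy_ge0.
have -> : (\int[mu]_x \int[lam]_(t in D)
    (normc (convolution (dilation psi t) f x) ^+ 2 / t)%:E =
    \int[mu]_x I h1 x + \int[mu]_x I h2 x)%E.
  rewrite -ge0_integralD//; [|exact: mI|exact: mI].
  apply: eq_integral => x _; rewrite /I -ge0_integralD//.
  - apply: eq_integral => t _.
    by rewrite normc_sqr Re_convolution Im_convolution mulrDl EFinD.
  - move=> t; rewrite /= in_itv/= andbT => t0.
    by rewrite lee_fin divr_ge0 ?sqr_ge0 ?ltW.
  - exact: measurable_vertical_integrand.
  - move=> t; rewrite /= in_itv/= andbT => t0.
    by rewrite lee_fin divr_ge0 ?sqr_ge0 ?ltW.
  - exact: measurable_vertical_integrand.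
have Lp := real_log_energy_le mp (fun x => Re_le_normc (psi x)).
have Lq := real_log_energy_le mq (fun x => Im_le_normc (psi x)).
have E1 := pair_square_function_le ip iq L0 p0 q0 Lp Lq mRe mNIm.
have E2 := pair_square_function_le ip iq L0 p0 q0 Lp Lq mIm mRe.
apply: (le_trans (leeD E1 E2)).
have msq (r : V -> R) : measurable_fun setT r -> measurable_fun setT (fun x => (r x ^+ 2)%:E).
  by move=> mr; apply/measurable_EFinP; exact: measurable_funX.
have -> : (\int[mu]_x ((- Im (f x)) ^+ 2)%:E = \int[mu]_x (Im (f x) ^+ 2)%:E)%E.
  by apply: eq_integral => x _; rewrite sqrrN.
have -> : (\int[mu]_x (normc (f x) ^+ 2)%:E =
    \int[mu]_x (Re (f x) ^+ 2)%:E + \int[mu]_x (Im (f x) ^+ 2)%:E)%E.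
  rewrite -(@ge0_integralD _ _ R mu setT measurableT (fun x => (Re (f x) ^+ 2)%:E)
    (fun x => (Im (f x) ^+ 2)%:E));
    [|by move=> x _; rewrite lee_fin sqr_ge0|exact: (msq _ mRe)
     |by move=> x _; rewrite lee_fin sqr_ge0|exact: (msq _ mIm)].
  by apply: eq_integral => x _; rewrite normc_sqr.
set A := (\int[mu]_x _)%E; set B := (\int[mu]_x _)%E.
have A0 : (0 <= A)%E by apply: integral_ge0 => x _; rewrite lee_fin sqr_ge0.
have B0 : (0 <= B)%E by apply: integral_ge0 => x _; rewrite lee_fin sqr_ge0.
rewrite [(B + A)%E]addeC -ge0_muleDl ?adde_ge0 ?lee_fin ?mulr_ge0//.
by rewrite -EFinD -mulrDl -natrD.
Qed.

End complex_square_function.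

Local Open Scope ereal_scope.

Theorem proposition3 (R : realType) (n : nat) (n_gt0 : (0 < n)%N)
    (psi : 'rV[R]_n -> R[i]) :
  CLfun (lebesgue_rV n) 1 psi ->
  Cintegral (lebesgue_rV n) psi = 0%R ->
  log_energy psi < +oo ->
  exists C : R, forall f : 'rV[R]_n -> R[i],
    CLfun (lebesgue_rV n) 2%:E f ->
    'N[lebesgue_rV n]_2%:E[square_function psi f] <=
      C%:E * CLnorm (lebesgue_rV n) 2%:E f.
Proof.
move=> psi1 psi0 Lpsi; pose A : R := (4 * Num.max 0 (fine (log_energy psi)))%R.
have A0 : (0 <= A)%R by rewrite mulr_ge0// le_max lexx.
(* the energy estimate has the constant A, so its square root is taken *)
exists (A `^ 2^-1)%R => f [mf _].
have S0 x : 0 <= \int[lebesgue_measure]_(t in `]0%R, +oo[)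
      (Normc.normc (convolution (dilation psi t) f x) ^+ 2 / t)%:E.
  exact: (vertical_energy_ge0
    (fun z => Normc.normc (convolution (dilation psi z.2) f z.1))).
have powS x : `|square_function psi f x| `^ 2 =
    \int[lebesgue_measure]_(t in `]0%R, +oo[)
      (Normc.normc (convolution (dilation psi t) f x) ^+ 2 / t)%:E.
  rewrite gee0_abs ?poweR_ge0// /square_function -poweRrM mulVf ?poweRe1//.
have powf x : `|(EFin \o (@Normc.normc R \o f)) x| `^ 2 =
    (Normc.normc (f x) ^+ 2)%:E.
  by rewrite /= ger0_norm ?normc_ge0// powR_mulrn ?normc_ge0.
rewrite /CLnorm unlock; under eq_integral do rewrite powS.
under [X in (_ <= _ * X `^ _)]eq_integral do rewrite powf.
rewrite -poweR_EFin -poweRM ?lee_fin//; last first.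
  by apply: integral_ge0 => x _; rewrite lee_fin sqr_ge0.
apply: gt0_ler_poweR; rewrite ?invr_ge0// ?in_itv/= ?andbT ?leey//.
- by rewrite andbT; apply: integral_ge0 => x _; exact: S0.
- by rewrite andbT mule_ge0// ?lee_fin//; apply: integral_ge0 => x _; rewrite lee_fin sqr_ge0.
- exact: square_function_energy_le.
Qed.
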